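(* Given a finite undirected graph $G$ (not necessarily connected), the problem of finding a rooted binary tree $T$ and a bijection $\varphi:V(G)\to V_L(T)$ minimizing $L(T,\varphi,G)$ is not solvable in polynomial time unless $\mathrm{P}=\mathrm{NP}$.
   Context: A rooted binary tree is a tree with a designated root node of degree $2$ in which every other non-leaf node has degree $3$ (two children); $V_L(T)$ denotes its set of leaves. For a bijection $\varphi:V(G)\to V_L(T)$, the length is $L(T,\varphi,G)=\sum_{\{u,v\}\in E(G)} d_T(\varphi(u),\varphi(v))$, where $d_T$ is the path distance in $T$. *)

(* Defs.v *)
From mathcomp Require Import all_boot all_order all_algebra.
Set Implicit Arguments.
Unset Strict Implicit.
Unset Printing Implicit Defensive.

Record sgraph (V : finType) := SGraph {
  adj :> rel V;
  adj_sym : symmetric adj;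
  adj_irrefl : irreflexive adj }.

Section GraphNotions.
Variables (W : finType) (T : sgraph W).

Definition degree (x : W) : nat := #|[set y | T x y]|.

Definition leaves : {set W} := [set x | degree x == 1].

Definition is_walk_length (x y : W) (k : nat) : bool :=
  [exists p : k.-tuple W, path T x p && (last x p == y)].

(* The least k < #|W| such that some walk of length k joins x to y; the value
   is #|W| when x and y are not connected, which does not happen in a tree. *)
Definition dist (x y : W) : nat := find (is_walk_length x y) (iota 0 #|W|).

(* [ucycle] accepts x - y - x for every edge, hence the bound 2. *)
Definition is_tree : Prop :=
  (forall x y, connect T x y) /\ (forall c, ucycle T c -> size c <= 2).

Definition rooted_binary_tree (r : W) : Prop :=
  [/\ is_tree, degree r = 2
    & forall x, x != r -> x \notin leaves -> degree x = 3].

End GraphNotions.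

Section Layout.
Variables (n : nat) (G : sgraph 'I_n).

Definition layout (W : finType) (T : sgraph W) (r : W) (phi : 'I_n -> W) :
    Prop :=
  [/\ rooted_binary_tree T r, injective phi & phi @: setT = leaves T].

Definition layout_length (W : finType) (T : sgraph W) (phi : 'I_n -> W) : nat :=
  \sum_(u < n) \sum_(v < n | (u < v) && G u v) dist T (phi u) (phi v).

Definition optimal_layout (W : finType) (T : sgraph W) (r : W)
    (phi : 'I_n -> W) : Prop :=
  layout T r phi /\
  forall (W' : finType) (T' : sgraph W') (r' : W') (phi' : 'I_n -> W'),
    layout T' r' phi' -> layout_length T phi <= layout_length T' phi'.

End Layout.

Inductive move := MoveLeft | Stay | MoveRight.

(* The tape alphabet is [option (bool + tm_extra)]: [None] is the blank,
   [inl] the input/output bits and [inr] the auxiliary work symbols.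
   [C] is the type of the choice made at each step: a deterministic machine
   has [C = unit], a nondeterministic one has [C = bool], that is, two
   transition functions.  A state halts iff its verdict is not [None];
   [Some true] means acceptance and [Some false] rejection. *)
Record TM (C : Type) := MkTM {
  tm_state : finType;
  tm_extra : finType;
  tm_tapes : nat;
  tm_start : tm_state;
  tm_verdict : tm_state -> option bool;
  tm_delta : C -> tm_state ->
    {ffun 'I_tm_tapes.+1 -> option (bool + tm_extra)} ->
    tm_state * {ffun 'I_tm_tapes.+1 -> option (bool + tm_extra) * move} }.

Section Run.
Variables (C : Type) (M : TM C).

Definition sym := option (bool + tm_extra M).

(* A tape is infinite in both directions.  The first component lists the cells
   to the left of the head, nearest first; the second one starts with the
   scanned cell.  All cells beyond either list are blank. *)
Definition tape := (seq sym * seq sym)%type.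

Definition tape_read (t : tape) : sym := head None t.2.

Definition tape_write (a : sym) (t : tape) : tape := (t.1, a :: behead t.2).

Definition tape_move (d : move) (t : tape) : tape :=
  match d with
  | MoveLeft => (behead t.1, head None t.1 :: t.2)
  | Stay => t
  | MoveRight => (head None t.2 :: t.1, behead t.2)
  end.

Definition config := (tm_state M * {ffun 'I_(tm_tapes M).+1 -> tape})%type.

Definition verdict (c : config) : option bool := tm_verdict c.1.

Definition step (c : config) (choice : C) : config :=
  if verdict c is Some _ then c else
  let: (q, act) := tm_delta choice c.1 [ffun i => tape_read (c.2 i)] in
  (q, [ffun i => tape_move (act i).2 (tape_write (act i).1 (c.2 i))]).

Definition init (x : seq bool) : config :=
  (tm_start M,
   [ffun i => ([::], if i == ord0 then [seq Some (inl b) | b <- x]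
                     else [::])]).

Definition run (x : seq bool) (choices : seq C) : config :=
  foldl step (init x) choices.

Fixpoint leading_bits (s : seq sym) : seq bool :=
  if s is Some (inl b) :: s' then b :: leading_bits s' else [::].

(* The output is the maximal block of bits on the input tape that starts at the
   scanned cell and extends to the right. *)
Definition output (c : config) : seq bool := leading_bits (c.2 ord0).2.

End Run.

Definition run_for (M : TM unit) (t : nat) (x : seq bool) : config M :=
  run M x (nseq t tt).

Definition language := seq bool -> Prop.

Definition class_P (L : language) : Prop :=
  exists (M : TM unit) (p : {poly nat}), forall x : seq bool,
    let c := run_for M (p.[size x])%R x in
    verdict c <> None /\ (L x <-> verdict c = Some true).

Definition class_NP (L : language) : Prop :=
  exists (M : TM bool) (p : {poly nat}), forall x : seq bool,
    (forall cs : ((p.[size x])%R).-tuple bool, verdict (run M x cs) <> None) /\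
    (L x <-> exists cs : ((p.[size x])%R).-tuple bool,
               verdict (run M x cs) = Some true).

Definition P_eq_NP : Prop := forall L : language, class_P L <-> class_NP L.

Definition enc_nat (k : nat) : seq bool := rcons (nseq k true) false.

Definition enc_graph (n : nat) (G : sgraph 'I_n) : seq bool :=
  enc_nat n ++ [seq G u v | u <- enum 'I_n, v <- enum 'I_n].

Definition enc_layout (n m : nat) (T : sgraph 'I_m) (r : 'I_m)
    (phi : 'I_n -> 'I_m) : seq bool :=
  enc_graph T ++ enc_nat r ++ flatten [seq enc_nat (phi u) | u <- enum 'I_n].

(* A rooted binary tree has at least two leaves, so that graphs with fewer than
   two vertices have no layout and are not instances. *)
Definition min_layout_poly_time_solvable : Prop :=
  exists (M : TM unit) (p : {poly nat}),
  forall (n : nat) (G : sgraph 'I_n), 2 <= n ->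
    let x := enc_graph G in
    let c := run_for M (p.[size x])%R x in
    verdict c <> None /\
    exists (m : nat) (T : sgraph 'I_m) (r : 'I_m) (phi : 'I_n -> 'I_m),
      output c = enc_layout T r phi /\ optimal_layout G T r phi.

(* Main.v *)
(** The length of a layout is the sum over the edges of the tree of the cuts they
    make.  If [G] is the complement of a graph [H] on [n] vertices, an edge
    that cuts off a set [S] of [s] leaves costs [s (n - s) - cut H S], which is at
    least [s (n - s) - vol H S].  Let [n = 3 * 2 ^ k] and [vol H < 2 ^ k].  Hang
    the tree from a median vertex: supporting lines of the minimal cost of a
    subtree with [s] leaves show that three complete subtrees of depth [k] are
    best, and that in case of equality [cut H S = vol H S] for each branch [S],
    that is, branches contain no edge of [H].  The root adds the cut of the edge it
    subdivides, at least [n - 1] minus the maximal degree of [H], with equality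
    at the leaf of a vertex of maximal degree.  If [H] is 3-colourable, putting
    the colour classes into different branches attains this bound; then every
    optimal layout has a vertex whose removal separates the ends of each edge of
    [H].  Conversely the at most three branches at such a vertex colour [H].

    A polynomial-time verifier is turned into [H] by a tableau whose columns are
    positions relative to the heads: a square is determined by the three squares
    above it, so that acceptance is the satisfiability of clauses of bounded
    width, which a gadget expresses as a 3-colouring.  A deterministic machine
    computes the complement of [H], runs the solver once, and looks for a
    separating vertex in the output. *)

From mathcomp Require Import all_boot all_order all_algebra fingroup perm.
From mathcomp Require Import zify ring.
From Stdlib Require Import FunctionalExtensionality.
Require Import Defs.
Set Implicit Arguments.
Unset Strict Implicit.
Unset Printing Implicit Defensive.

(** The difficulty lies in unbalanced trees: being deeper, they let an edge of [H] be cut, and thus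
    save, more often than the [k.+1] times per end that a balanced tree allows. The parameters
    exclude this. Where a subtree could gain a further level, the complete graph already charges it
    at least [2 ^ k - 1] more than the supporting line, and [vol H < 2 ^ k] makes that no gain. The
    choice [n = 3 * 2 ^ k] fits a centre with three branches: equal branches are then complete
    binary trees. Enough isolated vertices are added to [H] to make [2 ^ k] exceed the square of the
    number of gadget vertices, hence the volume.

    The optimal value is never computed. In any layout a separating vertex yields a colouring, so
    the answer of the solver is a certificate, and optimality only ensures that a colourable [H] has
    one.

    On the machine side, time bounds are propagated by a calculus of closure properties: word
    functions in [pf] come with a stack program whose steps are those of the compiled machine, and
    the solver is one more fragment between two such programs. *)

(** * Fragments of multi-tape machines and their composition *)

Section Machines.
Variables (E : finType) (K : nat).

Let symb := option (bool + E).

(* Cells are functions, so that trailing blanks are invisible to equality. *)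
Definition ftape := ((nat -> symb) * (nat -> symb))%type.

Definition ftape_act (a : symb) (d : move) (t : ftape) : ftape :=
  let t2 := fun i => if i is 0 then a else t.2 i in
  match d with
  | MoveLeft => (fun i => t.1 i.+1, fun i => if i is j.+1 then t2 j else t.1 0)
  | Stay => (t.1, t2)
  | MoveRight => (fun i => if i is j.+1 then t.1 j else a, fun i => t2 i.+1)
  end.

Definition ftapes := 'I_K.+1 -> ftape.

Definition reads (tp : ftapes) : {ffun 'I_K.+1 -> symb} := [ffun i => (tp i).2 0].

Record frag := Frag {
  fstate : finType;
  fini : fstate;
  fhalt : pred fstate;
  fdelta : fstate -> {ffun 'I_K.+1 -> symb} ->
    fstate * {ffun 'I_K.+1 -> symb * move} }.

Definition act_all (act : {ffun 'I_K.+1 -> symb * move}) (tp : ftapes) : ftapes :=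
  fun i => ftape_act (act i).1 (act i).2 (tp i).

Definition fstep (F : frag) (c : fstate F * ftapes) : fstate F * ftapes :=
  let qa := fdelta c.1 (reads c.2) in (qa.1, act_all qa.2 c.2).

(** Only non-halting states take a step, so a run stops at the first halting state and its time is
    exact. *)
Inductive frun (F : frag) : fstate F * ftapes -> fstate F * ftapes -> nat -> Prop :=
| frun0 c : frun c c 0
| frunS c c' t : ~~ fhalt c.1 -> frun (fstep c) c' t -> frun c c' t.+1.

Definition fexec (F : frag) (tp tp' : ftapes) (t : nat) :=
  exists2 q, fhalt q & frun (fini F, tp) (q, tp') t.

Lemma frun_trans (F : frag) (c1 c2 c3 : fstate F * ftapes) t1 t2 :
  frun c1 c2 t1 -> frun c2 c3 t2 -> frun c1 c3 (t1 + t2).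
Proof. by elim=> // c c' t hc _ IH h; rewrite addSn; apply: frunS => //; apply: IH. Qed.

Definition noop (rd : {ffun 'I_K.+1 -> symb}) : {ffun 'I_K.+1 -> symb * move} :=
  [ffun i => (rd i, Stay)].

Lemma act_noop (tp : ftapes) : act_all (noop (reads tp)) tp = tp.
Proof.
apply: functional_extensionality => i; rewrite /act_all /noop !ffunE /=.
by case: (tp i) => l r /=; congr pair; apply: functional_extensionality; case.
Qed.

Definition fprim (f : {ffun 'I_K.+1 -> symb} -> {ffun 'I_K.+1 -> symb * move}) : frag :=
  @Frag bool false id (fun _ rd => (true, f rd)).

Lemma fprimP f tp : fexec (fprim f) tp (act_all (f (reads tp)) tp) 1.
Proof. by exists true => //; apply: frunS => //; apply: frun0. Qed.

Definition fseq (F1 F2 : frag) : frag :=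
  @Frag (fstate F1 + fstate F2)%type (inl (fini F1))
    (fun q => if q is inr q2 then fhalt q2 else false)
    (fun q rd => match q with
      | inl q1 => if fhalt q1 then (inr (fini F2), noop rd)
                  else let qa := fdelta q1 rd in (inl qa.1, qa.2)
      | inr q2 => let qa := fdelta q2 rd in (inr qa.1, qa.2) end).

(** The additional step is the hand-over: the control enters the second fragment while [noop] leaves
    the tapes alone. *)
Lemma fseqP (F1 F2 : frag) tp1 tp2 tp3 t1 t2 :
  fexec F1 tp1 tp2 t1 -> fexec F2 tp2 tp3 t2 ->
  fexec (fseq F1 F2) tp1 tp3 (t1 + t2).+1.
Proof.
move=> [q1 hq1 r1] [q2 hq2 r2]; exists (inr q2) => //.
rewrite -addnS; apply: (@frun_trans (fseq F1 F2) _ (inl q1, tp2)).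
  have: forall c c' t, frun c c' t ->
     @frun (fseq F1 F2) (inl c.1, c.2) (inl c'.1, c'.2) t.
    move=> c c' t; elim=> [?|{c c'} {}t c c' hc _ IH]; first exact: frun0.
    by apply: frunS => //; rewrite /fstep /= (negbTE hc).
  by move/(_ _ _ _ r1).
apply: frunS => //; rewrite /fstep /= hq1 /= act_noop.
have: forall c c' t, frun c c' t ->
     @frun (fseq F1 F2) (inr c.1, c.2) (inr c'.1, c'.2) t.
  move=> c c' t; elim=> [?|{c c'} {}t c c' hc _ IH]; first exact: frun0.
  by apply: frunS.
by move/(_ _ _ _ r2).
Qed.

Definition fcase (i : 'I_K.+1) (F0 F1 F2 : frag) : frag :=
  @Frag (option (fstate F0 + fstate F1 + fstate F2)%type) None
    (fun q => match q with
      | None => false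
      | Some (inl (inl q)) => fhalt q
      | Some (inl (inr q)) => fhalt q
      | Some (inr q) => fhalt q end)
    (fun q rd => match q with
      | None => (match rd i with
                 | Some (inl true) => Some (inl (inr (fini F1)))
                 | Some (inl false) => Some (inr (fini F2))
                 | _ => Some (inl (inl (fini F0))) end, noop rd)
      | Some (inl (inl q)) => let qa := fdelta q rd in (Some (inl (inl qa.1)), qa.2)
      | Some (inl (inr q)) => let qa := fdelta q rd in (Some (inl (inr qa.1)), qa.2)
      | Some (inr q) => let qa := fdelta q rd in (Some (inr qa.1), qa.2) end).

Lemma fcaseP i (F0 F1 F2 : frag) tp tp' t :
  fexec (match (tp i).2 0 with
         | Some (inl true) => F1
         | Some (inl false) => F2
         | _ => F0 end) tp tp' t ->
  fexec (fcase i F0 F1 F2) tp tp' t.+1.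
Proof.
set F := fcase i F0 F1 F2.
have h0 c c' u : frun c c' u ->
    @frun F (Some (inl (inl c.1)), c.2) (Some (inl (inl c'.1)), c'.2) u.
  by elim=> [?|{c c'} {}u c c' hc _ IH]; [exact: frun0|apply: frunS].
have h1 c c' u : frun c c' u ->
    @frun F (Some (inl (inr c.1)), c.2) (Some (inl (inr c'.1)), c'.2) u.
  by elim=> [?|{c c'} {}u c c' hc _ IH]; [exact: frun0|apply: frunS].
have h2 c c' u : frun c c' u ->
    @frun F (Some (inr c.1), c.2) (Some (inr c'.1), c'.2) u.
  by elim=> [?|{c c'} {}u c c' hc _ IH]; [exact: frun0|apply: frunS].
have step1 : fstep (F:=F) (None, tp) = (match (tp i).2 0 with
                 | Some (inl true) => Some (inl (inr (fini F1)))
                 | Some (inl false) => Some (inr (fini F2))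
                 | _ => Some (inl (inl (fini F0))) end, tp).
  by rewrite /fstep /= act_noop ffunE.
case eq0 : ((tp i).2 0) => [[[]|e]|] [q hq r].
- exists (Some (inl (inr q))) => //; apply: frunS => //.
  by rewrite step1 eq0; apply: h1 r.
- exists (Some (inr q)) => //; apply: frunS => //.
  by rewrite step1 eq0; apply: h2 r.
- exists (Some (inl (inl q))) => //; apply: frunS => //.
  by rewrite step1 eq0; apply: h0 r.
- exists (Some (inl (inl q))) => //; apply: frunS => //.
  by rewrite step1 eq0; apply: h0 r.
Qed.

Definition is_bit (a : symb) : bool := if a is Some (inl _) then true else false.

(** [None] is the test, [Some None] the exit, and the other states belong to the body. The test and
    the return to it take one step each, whence two extra steps per round. *)
Definition fwhile (i : 'I_K.+1) (F : frag) : frag :=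
  @Frag (option (option (fstate F))) None
    (fun q => if q is Some None then true else false)
    (fun q rd => match q with
      | None => (Some (if is_bit (rd i) then Some (fini F) else None), noop rd)
      | Some None => (q, noop rd)
      | Some (Some q) => if fhalt q then (None, noop rd)
                         else let qa := fdelta q rd in (Some (Some qa.1), qa.2)
      end).

Lemma fwhile_stop i F tp : ~~ is_bit ((tp i).2 0) -> fexec (fwhile i F) tp tp 1.
Proof.
move=> h; exists (Some None) => //; apply: frunS => //.
by rewrite /fstep /= act_noop ffunE (negbTE h); apply: frun0.
Qed.

Lemma fwhile_next i F tp tp1 tp' t1 t2 : is_bit ((tp i).2 0) ->
  fexec F tp tp1 t1 -> fexec (fwhile i F) tp1 tp' t2 ->
  fexec (fwhile i F) tp tp' (t1 + t2).+2.
Proof.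
move=> h [q1 hq1 r1] [q2 hq2 r2]; exists q2 => //.
apply: frunS => //; rewrite /fstep /= act_noop ffunE h -addnS.
apply: (@frun_trans (fwhile i F) _ (Some (Some q1), tp1)).
  have: forall c c' t, frun c c' t ->
     @frun (fwhile i F) (Some (Some c.1), c.2) (Some (Some c'.1), c'.2) t.
    move=> c c' t; elim=> [?|{c c'} {}t c c' hc _ IH]; first exact: frun0.
    by apply: frunS => //; rewrite /fstep /= (negbTE hc).
  by move/(_ _ _ _ r1).
by apply: frunS => //; rewrite /fstep /= hq1 act_noop.
Qed.

End Machines.
Arguments fexec {E K}.

(** * Stack programs *)

Inductive cmd :=
| Skip
| Push (r : nat) (b : bool)
| Pop (r : nat)
| Seq (c1 c2 : cmd)
| Case (r : nat) (c0 c1 c2 : cmd)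
| While (r : nat) (c : cmd).

Definition store := nat -> seq bool.

Definition upd (s : store) (r : nat) (v : seq bool) : store :=
  fun r' => if r' == r then v else s r'.

(* The last argument counts the steps of the compiled machine. *)
Inductive exec : cmd -> store -> store -> nat -> Prop :=
| ESkip s : exec Skip s s 1
| EPush r b s : exec (Push r b) s (upd s r (b :: s r)) 3
| EPop r s : exec (Pop r) s (upd s r (behead (s r))) 1
| ESeq c1 c2 s1 s2 s3 t1 t2 : exec c1 s1 s2 t1 -> exec c2 s2 s3 t2 ->
    exec (Seq c1 c2) s1 s3 (t1 + t2).+1
| ECase r c0 c1 c2 s s' t :
    exec (match s r with [::] => c0 | true :: _ => c1 | false :: _ => c2 end) s s' t ->
    exec (Case r c0 c1 c2) s s' t.+1
| EWhile0 r c s : s r = [::] -> exec (While r c) s s 1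
| EWhileS r c s s1 s2 t1 t2 : s r <> [::] -> exec c s s1 t1 ->
    exec (While r c) s1 s2 t2 -> exec (While r c) s s2 (t1 + t2).+2.

Fixpoint maxreg (c : cmd) : nat :=
  match c with
  | Skip => 0
  | Push r _ => r
  | Pop r => r
  | Seq c1 c2 => maxn (maxreg c1) (maxreg c2)
  | Case r c0 c1 c2 => maxn r (maxn (maxreg c0) (maxn (maxreg c1) (maxreg c2)))
  | While r c => maxn r (maxreg c)
  end.

Section Compile.
Variables (E : finType) (K : nat).

Definition bits (w : seq bool) : seq (option (bool + E)) := [seq Some (inl b) | b <- w].

Definition word_tape (w : seq bool) : ftape E := (fun=> None, nth None (bits w)).

Definition on_tape (r : nat) (f : option (bool + E) -> option (bool + E) * move)
    (rd : {ffun 'I_K.+1 -> option (bool + E)}) :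
    {ffun 'I_K.+1 -> option (bool + E) * move} :=
  [ffun i : 'I_K.+1 => if i == r :> nat then f (rd i) else (rd i, Stay)].

(** The top of a stack is the scanned cell. A push steps onto the blank at its left before writing,
    a pop blanks the cell before moving right; so the left half of the tape stays empty. *)
Fixpoint compile (c : cmd) : frag E K :=
  match c with
  | Skip => fprim (@noop E K)
  | Push r b => fseq (fprim (on_tape r (fun a => (a, MoveLeft))))
                     (fprim (on_tape r (fun a => (Some (inl b), Stay))))
  | Pop r => fprim (on_tape r (fun a => (None, MoveRight)))
  | Seq c1 c2 => fseq (compile c1) (compile c2)
  | Case r c0 c1 c2 => fcase (inord r) (compile c0) (compile c1) (compile c2)
  | While r c => fwhile (inord r) (compile c)
  end.

Definition represents (A : nat) (s : store) (tp : ftapes E K) :=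
  forall i : 'I_K.+1, i < A -> tp i = word_tape (s i).

Lemma act_on_tape r f (tp : ftapes E K) (i : 'I_K.+1) :
  act_all (on_tape r f (reads tp)) tp i =
  if i == r :> nat then let am := f ((tp i).2 0) in ftape_act am.1 am.2 (tp i) else tp i.
Proof.
rewrite /act_all /on_tape !ffunE; case: ifP => //= _.
by case: (tp i) => l u; congr pair; apply: functional_extensionality; case.
Qed.

Lemma word_tape_nil (w : seq bool) : is_bit ((word_tape w).2 0) = (w != [::]).
Proof. by case: w. Qed.

(** The tapes from [A] on are a frame: they may hold anything and stay untouched, which protects the
    tapes of the solver. *)
Lemma compileP c A s s' t (tp : ftapes E K) :
  A <= K.+1 -> maxreg c < A -> exec c s s' t -> represents A s tp ->
  exists tp', [/\ fexec (compile c) tp tp' t, represents A s' tp'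
    & forall i : 'I_K.+1, A <= i -> tp' i = tp i].
Proof.
move=> AK + ex; elim: ex tp => {c s s' t}
  [s|r b s|r s|c1 c2 s1 s2 s3 t1 t2 _ IH1 _ IH2|r c0 c1 c2 s s' t _ IH
  |r c s hs|r c s s1 s2 t1 t2 hs _ IH1 _ IH2] tp /=.
- move=> _ rp; exists tp; split=> //.
  by rewrite -[X in fexec _ _ X _](act_noop tp); apply: fprimP.
- move=> rA rp; eexists; split; first by apply: (fseqP (fprimP _ _) (fprimP _ _)).
  + move=> i iA; rewrite !act_on_tape /upd; case: eqP => [e|_]; last exact: rp.
    rewrite rp // e /=; congr pair; apply: functional_extensionality.
    by case=> [|[]].
  + move=> i Ai; rewrite !act_on_tape; case: eqP => // e.
    by move: Ai; rewrite e leqNgt rA.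
- move=> rA rp; eexists; split; first exact: fprimP.
  + move=> i iA; rewrite !act_on_tape /upd; case: eqP => [e|_]; last exact: rp.
    rewrite rp // e /= /word_tape; congr pair; apply: functional_extensionality.
      by case.
    by move=> j; case: (s r) => //=; rewrite !nth_nil.
  + move=> i Ai; rewrite !act_on_tape; case: eqP => // e.
    by move: Ai; rewrite e leqNgt rA.
- rewrite gtn_max => /andP[h1 h2] rp.
  have [tp1 [x1 rp1 f1]] := IH1 _ h1 rp.
  have [tp2 [x2 rp2 f2]] := IH2 _ h2 rp1.
  exists tp2; split=> //; first exact: fseqP x1 x2.
  by move=> i Ai; rewrite f2 ?f1.
- rewrite !gtn_max => /and4P[rA h0 h1 h2] rp.
  have e : tp (inord r) = word_tape (s r).
    by rewrite rp inordK //; exact: leq_trans rA AK.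
  have [|tp1 [x1 rp1 f1]] := IH tp _ rp; first by case: (s r) => [|[]].
  exists tp1; split=> //; apply: fcaseP; rewrite e /=.
  by case: (s r) x1 => [|[]].
- rewrite gtn_max => /andP[rA h0] rp; exists tp; split=> //.
  by apply: fwhile_stop; rewrite rp inordK ?word_tape_nil ?hs //; apply: leq_trans rA AK.
- rewrite gtn_max => /andP[rA h0] rp.
  have [tp1 [x1 rp1 f1]] := IH1 _ h0 rp.
  have [|tp2 [x2 rp2 f2]] := IH2 tp1 _ rp1; first by rewrite gtn_max rA.
  exists tp2; split=> //; last by move=> i Ai; rewrite f2 ?f1.
  have rK : r < K.+1 by exact: leq_trans rA AK.
  by apply: fwhile_next x1 x2; rewrite rp inordK // word_tape_nil; apply/eqP.
Qed.

End Compile.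

(** * Polynomial-time functions on words *)

Definition env := seq (seq bool).
Definition sz (e : env) : nat := sumn (map size e).
Definition un (n : nat) : seq bool := nseq n true.

Lemma leq_expl m n e : m <= n -> m ^ e <= n ^ e.
Proof. by case: e => // e mn; rewrite leq_exp2r. Qed.

(** The base is at least 2, so that constants and sums are absorbed by a larger exponent. *)
Definition polyb (g : env -> nat) := exists d, forall e, g e <= (sz e + 2) ^ d.

Lemma polyb_le g h : (forall e, g e <= h e) -> polyb h -> polyb g.
Proof. by move=> gh [d hd]; exists d => e; apply: leq_trans (hd e). Qed.

Lemma polyb_const c : polyb (fun=> c).
Proof.
exists c => e; apply: (@leq_trans (2 ^ c)); first exact/ltnW/ltn_expl.
by rewrite leq_expl // leq_addl.
Qed.

Lemma polyb_sz : polyb sz.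
Proof. by exists 1 => e; rewrite expn1 leq_addr. Qed.

Lemma polyb_mul g h : polyb g -> polyb h -> polyb (fun e => g e * h e).
Proof.
by move=> [d hd] [d' hd']; exists (d + d') => e; rewrite expnD leq_mul.
Qed.

Lemma polyb_add g h : polyb g -> polyb h -> polyb (fun e => g e + h e).
Proof.
move=> [d hd] [d' hd']; exists (maxn d d').+1 => e.
rewrite expnS; apply: (@leq_trans (2 * (sz e + 2) ^ maxn d d')); last first.
  by rewrite leq_mul2r leq_addl orbT.
rewrite mul2n -addnn leq_add // ?(leq_trans (hd e)) ?(leq_trans (hd' e)) //;
  by rewrite leq_pexp2l ?addn2 ?leq_maxl ?leq_maxr.
Qed.

Lemma polyb_S g : polyb g -> polyb (fun e => (g e).+1).
Proof.
move=> h; apply: (@polyb_le _ (fun e => g e + 1)) => [e|]; first by rewrite addn1.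
exact: polyb_add (polyb_const 1).
Qed.

Lemma polyb_exp g k : polyb g -> polyb (fun e => g e ^ k).
Proof.
move=> hg; elim: k => [|k IH].
  by apply: (@polyb_le _ (fun=> 1)) => //; apply: polyb_const.
by apply: (@polyb_le _ (fun e => g e * g e ^ k)) => [e|]; [rewrite expnS|apply: polyb_mul].
Qed.

Ltac polyb := repeat first [assumption | apply: polyb_const | apply: polyb_sz
  | apply: polyb_add | apply: polyb_mul | apply: polyb_S | apply: polyb_exp].

(** The registers from [b] on are empty and serve as scratch space without being cleared first; in
    return every program leaves them empty again, up to its value. *)
Definition holds (e : env) (loc : seq nat) (b : nat) (s : store) :=
  [/\ size loc = size e,
      forall i, i < size e -> nth 0 loc i < b /\ s (nth 0 loc i) = nth [::] e i
    & forall r, b <= r -> s r = [::]].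

(* A program for [f] depends on the registers [loc] of the arguments and on the
   first free register [b], where it leaves the value. *)
Definition pf (f : env -> seq bool) :=
  exists c : seq nat -> nat -> cmd, exists tm : env -> nat,
  [/\ polyb tm, polyb (fun e => size (f e))
    & forall e loc b s, holds e loc b s ->
      exists2 t, t <= tm e & exec (c loc b) s (upd s b (f e)) t].

Ltac updt := rewrite /upd; repeat match goal with
  |- context [@eq_op _ ?x ?y] => case: (@eqP _ x y) => ?; try (exfalso; lia) end.

Lemma exec_eq c s s1 s2 t : exec c s s1 t -> (forall r, s1 r = s2 r) -> exec c s s2 t.
Proof. by move=> h e; rewrite -(functional_extensionality _ _ e). Qed.

Lemma holds_over e loc b s v : holds e loc b s -> holds e loc b.+1 (upd s b v).
Proof.
move=> [h1 h2 h3]; split=> //.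
  by move=> i /h2[l1 l2]; rewrite /upd ltn_eqF // l2; split=> //; apply: ltnW.
by move=> r hr; rewrite /upd gtn_eqF // h3 // ltnW.
Qed.

Definition clear r := While r (Pop r).

Lemma clearP r s : exec (clear r) s (upd s r [::]) (3 * size (s r)).+1.
Proof.
have [n e] : {n | size (s r) = n} by exists (size (s r)).
rewrite e; elim: n s e => [|n IH] s e.
  have es : s r = [::] by apply: size0nil.
  apply: exec_eq (EWhile0 _ es) _ => q; rewrite /upd; case: eqP => // -> //.
rewrite (_ : (_.+1) = (1 + (3 * n).+1).+2) ; last by lia.
apply: EWhileS; [by case: (s r) e|exact: EPop|].
apply: exec_eq; first by apply: IH; rewrite /upd eqxx size_behead e.
by move=> q; rewrite /upd; case: eqP.
Qed.

Definition moverev r r' :=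
  While r (Case r Skip (Seq (Pop r) (Push r' true)) (Seq (Pop r) (Push r' false))).

Lemma moverevP r r' s : r != r' ->
  exec (moverev r r') s (upd (upd s r' (rev (s r) ++ s r')) r [::]) (8 * size (s r)).+1.
Proof.
move=> rr'; have [w e] : {w | s r = w} by exists (s r).
rewrite e; elim: w s e => [|x w IH] s e /=.
  apply: exec_eq (EWhile0 _ e) _ => q.
  by rewrite /upd; case: eqP => [->|_] //; case: eqP => [->|].
rewrite (_ : (_.+1) = (6 + (8 * size w).+1).+2); last by lia.
apply: (@EWhileS _ _ _ (upd (upd s r w) r' (x :: s r'))); first by rewrite e.
  have -> : upd (upd s r w) r' (x :: s r') =
      upd (upd s r (behead (s r))) r' (x :: (upd s r (behead (s r))) r').
    by rewrite e /= /upd eq_sym (negbTE rr').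
  apply: ECase; rewrite {1}e; case: (x); rewrite -[5]/(1 + 3).+1;
  by apply: ESeq; constructor.
apply: exec_eq; first by apply: IH; rewrite /upd (negbTE rr') eqxx.
move=> q; rewrite /upd eqxx; case: eqP => // /eqP qr; case: eqP => // _.
by rewrite rev_cons cat_rcons.
Qed.

(** Moving a stack reverses it. The copy therefore goes through [tmp], and the way back restores [r]
    while it fills [r']. *)
Definition copy r r' tmp :=
  Seq (moverev r tmp)
   (While tmp (Case tmp Skip (Seq (Pop tmp) (Seq (Push r true) (Push r' true)))
                         (Seq (Pop tmp) (Seq (Push r false) (Push r' false))))).

Lemma copyP r r' tmp s : uniq [:: r; r'; tmp] -> s r' = [::] -> s tmp = [::] ->
  exec (copy r r' tmp) s (upd s r' (s r)) (20 * size (s r) + 3).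
Proof.
rewrite /= !inE negb_or => /and3P[/andP[rr' rt] r't _] s1 s2.
rewrite (_ : _ + 3 = ((8 * size (s r)).+1 + (12 * size (s r)).+1).+1); last by lia.
apply: ESeq; first exact: moverevP.
rewrite s2 cats0 -(size_rev (s r)).
set s0 := upd _ r _.
have: s0 tmp = rev (s r) by rewrite /s0 /upd eqxx eq_sym (negbTE rt).
(* Invariant of the second loop: the reversed rest of [tmp], followed by [r] or by [r'], is the
   original word. *)
have: s r = rev (rev (s r)) ++ s0 r by rewrite revK /s0 /upd eqxx cats0.
have: s r = rev (rev (s r)) ++ s0 r' by rewrite revK /s0 /upd (negbTE r't) eq_sym (negbTE rr') s1 cats0.
have: forall q, q != r -> q != r' -> q != tmp -> s0 q = s q.
  by move=> q q1 q2 q3; rewrite /s0 /upd (negbTE q1) (negbTE q3).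
clearbody s0; elim: (rev (s r)) s0 => [|x w IH] s0 h1 h2 h3 h4 /=.
  apply: exec_eq (EWhile0 _ h4) _ => q; rewrite /upd.
  case: eqP => [->|/eqP qr']; first by rewrite h2.
  case: (eqVneq q r) => [->|qr]; first by rewrite h3.
  case: (eqVneq q tmp) => [->|qt]; first by rewrite h4 s2.
  exact: h1.
rewrite (_ : (_.+1) = (10 + (12 * size w).+1).+2); last by lia.
apply: (@EWhileS _ _ _ (upd (upd (upd s0 tmp w) r (x :: s0 r)) r' (x :: s0 r'))).
- by rewrite h4.
- have -> : upd (upd (upd s0 tmp w) r (x :: s0 r)) r' (x :: s0 r') =
    let s1 := upd s0 tmp (behead (s0 tmp)) in
    let s2 := upd s1 r (x :: s1 r) in upd s2 r' (x :: s2 r').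
    by rewrite /= h4 /= /upd (negbTE rt) (negbTE r't) eq_sym (negbTE rr').
  rewrite /=; apply: ECase; rewrite {1}h4; case: (x); rewrite -[9]/(1 + (3 + 3).+1).+1;
  by do 2 (apply: ESeq; first by constructor); constructor.
apply: IH.
- by move=> q q1 q2 q3; rewrite /upd (negbTE q1) (negbTE q2) (negbTE q3) h1.
- by rewrite h2 /upd eqxx rev_cons cat_rcons.
- by rewrite h3 /upd eqxx (negbTE rr') rev_cons cat_rcons.
- by rewrite /upd (eq_sym tmp r') (eq_sym tmp r) (negbTE rt) (negbTE r't) eqxx.
Qed.

Lemma size_nth_sz e i : size (nth [::] e i) <= sz e.
Proof.
elim: e i => [|v e IH] [|i] //=; rewrite /sz /=; first exact: leq_addr.
exact: leq_trans (IH i) (leq_addl _ _).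
Qed.

Lemma pf_var i : pf (fun e => nth [::] e i).
Proof.
exists (fun loc b => if i < size loc then copy (nth 0 loc i) b b.+1 else Skip).
exists (fun e => 20 * sz e + 3); split; first by polyb.
  exact: (polyb_le (fun e => size_nth_sz e i) polyb_sz).
move=> e loc b s [h1 h2 h3]; case: ltnP; rewrite h1 => hi.
  have [l1 l2] := h2 _ hi; rewrite -l2; eexists; last first.
    by apply: copyP; rewrite ?h3 //= !inE; lia.
  by rewrite l2 leq_add2r leq_mul2l size_nth_sz.
exists 1; first by lia.
apply: exec_eq (ESkip _) _ => r; rewrite /upd nth_default //.
by case: eqP => // ->; rewrite h3.
Qed.

Lemma pf_nil : pf (fun=> [::]).
Proof.
exists (fun _ _ => Skip), (fun=> 1); split; [by polyb|by polyb|].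
move=> e loc b s [h1 h2 h3]; exists 1 => //.
apply: exec_eq (ESkip _) _ => r; rewrite /upd.
by case: eqP => // ->; rewrite h3.
Qed.

Lemma upd_upd s b v w : upd (upd s b v) b w = upd s b w.
Proof. by apply: functional_extensionality => r; rewrite /upd; case: eqP. Qed.

Lemma updE s b v : upd s b v b = v.
Proof. by rewrite /upd eqxx. Qed.

Lemma pf_cons x f : pf f -> pf (fun e => x :: f e).
Proof.
move=> [c [tm [p1 p2 h]]].
exists (fun loc b => Seq (c loc b) (Push b x)), (fun e => tm e + 4); split.
- by polyb.
- exact: polyb_S.
move=> e loc b s hs; have [t ht ex] := h _ _ _ _ hs.
exists (t + 3).+1; first by lia.
by apply: ESeq ex _; apply: exec_eq (EPush _ _ _) _ => r; rewrite updE upd_upd.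
Qed.

Lemma pf_behead f : pf f -> pf (fun e => behead (f e)).
Proof.
move=> [c [tm [p1 p2 h]]].
exists (fun loc b => Seq (c loc b) (Pop b)), (fun e => tm e + 2); split.
- by polyb.
- by apply: polyb_le p2 => e; rewrite size_behead leq_pred.
move=> e loc b s hs; have [t ht ex] := h _ _ _ _ hs.
exists (t + 1).+1; first by lia.
by apply: ESeq ex _; apply: exec_eq (EPop _ _) _ => r; rewrite updE upd_upd.
Qed.

Lemma pf_case f g0 g1 g2 : pf f -> pf g0 -> pf g1 -> pf g2 ->
  pf (fun e => match f e with [::] => g0 e | true :: _ => g1 e | false :: _ => g2 e end).
Proof.
move=> [c [tm [p1 p2 h]]] [c0 [tm0 [p10 p20 h0]]] [c1 [tm1 [p11 p21 h1]]] [c2 [tm2 [p12 p22 h2]]].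
exists (fun loc b => Seq (c loc b) (Case b (c0 loc b) (Seq (clear b) (c1 loc b))
   (Seq (clear b) (c2 loc b)))).
exists (fun e => tm e + tm0 e + tm1 e + tm2 e + 3 * size (f e) + 5); split.
- by polyb.
- apply: (@polyb_le _ (fun e => size (g0 e) + size (g1 e) + size (g2 e))); last by polyb.
  by move=> e; case: (f e) => [|[] _]; lia.
move=> e loc b s hs; have [t ht ex] := h _ _ _ _ hs.
have [t0 ht0 ex0] := h0 _ _ _ _ hs.
have [t1 ht1 ex1] := h1 _ _ _ _ hs.
have [t2 ht2 ex2] := h2 _ _ _ _ hs.
have clr : exec (clear b) (upd s b (f e)) s (3 * size (f e)).+1.
  rewrite -{2}(updE s b (f e)); apply: exec_eq (clearP _ _) _ => r.
  by rewrite upd_upd /upd; case: eqP => // ->; case: hs => _ _ ->.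
case E : (f e) => [|[] w].
- exists (t + t0.+1).+1; first by lia.
  apply: ESeq ex _; apply: ECase; rewrite updE E.
  rewrite (_ : upd s b [::] = s) //; apply: functional_extensionality => r.
  by rewrite /upd; case: eqP => // ->; case: hs => _ _ ->.
- exists (t + ((3 * size (f e)).+1 + t1).+1.+1).+1; first by rewrite E in ht *; lia.
  by apply: ESeq ex _; apply: ECase; rewrite updE E -E; apply: ESeq clr ex1.
- exists (t + ((3 * size (f e)).+1 + t2).+1.+1).+1; first by rewrite E in ht *; lia.
  by apply: ESeq ex _; apply: ECase; rewrite updE E -E; apply: ESeq clr ex2.
Qed.

Lemma pf_eq f g : pf f -> (forall e, f e = g e) -> pf g.
Proof. by move=> pf_f fg; rewrite -(functional_extensionality _ _ fg). Qed.

Definition shift r r' := Seq (moverev r r.+1) (moverev r.+1 r').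

Lemma shiftP r r' s : r' < r -> s r.+1 = [::] -> s r' = [::] ->
  exec (shift r r') s (upd (upd s r [::]) r' (s r)) (16 * size (s r) + 3).
Proof.
move=> rr' e1 e2.
rewrite (_ : _ + 3 = ((8 * size (s r)).+1 + (8 * size (s r)).+1).+1); last by lia.
apply: ESeq; first by apply: moverevP; lia.
rewrite e1 cats0 -(size_rev (s r)).
set s0 := upd _ r _.
have e3 : s0 r.+1 = rev (s r) by rewrite /s0 /upd eqxx gtn_eqF.
rewrite -e3; apply: exec_eq; first by apply: moverevP; lia.
rewrite e3 revK => q; rewrite /s0 /upd.
case: (eqVneq q r.+1) => [->|r1]; first by rewrite !gtn_eqF ?e1 //; lia.
case: (eqVneq q r') => [_|r2]; last by case: eqP.
by rewrite ltn_eqF // ltn_eqF ?e2 ?cats0 //; lia.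
Qed.

Definition recf (n a h : env -> seq bool) (e : env) : seq bool :=
  iteri (size (n e)) (fun i acc => h (acc :: un i :: e)) (a e).

Lemma size_un n : size (un n) = n. Proof. exact: size_nseq. Qed.

(** Bounded recursion in the sense of Cobham: iterating a polynomial-time step can make words grow
    exponentially, so a polynomial bound [B] on all intermediate values is demanded. *)
Lemma pf_rec n a h B : pf n -> pf a -> pf h -> polyb B ->
  (forall e i, i <= size (n e) ->
     size (iteri i (fun i acc => h (acc :: un i :: e)) (a e)) <= B e) ->
  pf (recf n a h).
Proof.
move=> [cn [tn [pn1 pn2 hn]]] [ca [ta [pa1 pa2 ha]]] [ch [th [[dh pdh] ph2 hh]]] pB hB.
(* Register [b] holds the accumulator, [b.+1] the counter in unary, [b.+2] a word whose length is
   the number of rounds left; [b.+3] receives the new accumulator, which is then shifted to [b]. *)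
pose body loc b := Seq (Pop b.+2) (Seq (ch (b :: b.+1 :: loc) b.+3)
   (Seq (clear b) (Seq (shift b.+3 b) (Push b.+1 true)))).
exists (fun loc b => Seq (ca loc b) (Seq (cn loc b.+2)
   (Seq (While b.+2 (body loc b)) (clear b.+1)))).
exists (fun e => ta e + tn e +
  size (n e) * ((B e + (size (n e) + sz e) + 2) ^ dh + 19 * B e + 20) + 3 * size (n e) + 10); split.
- by polyb.
- by apply: polyb_le pB => e; apply: hB.
move=> e loc b s hs.
have [t1 ht1 ex1] := ha _ _ _ _ hs.
set F := fun i => iteri i (fun i acc => h (acc :: un i :: e)) (a e).
pose st i m := upd (upd (upd s b (F i)) b.+1 (un i)) b.+2 (un m).
have [hs1 hs2 hs3] := hs.
have hsb : holds e loc b.+2 (upd s b (a e)).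
  split=> //; first by move=> i /hs2[l1 l2]; rewrite /upd ltn_eqF // l2; split=> //; lia.
  by move=> r hr; rewrite /upd gtn_eqF ?hs3 //; lia.
have [t2 ht2 ex2] := hn _ _ _ _ hsb.
have loop m i w : i + size w = size (n e) -> m = size w -> exists2 t,
    t <= m * ((B e + (size (n e) + sz e) + 2) ^ dh + 19 * B e + 20) + 1 &
    exec (While b.+2 (body loc b)) (upd (st i m) b.+2 w) (upd (st (i + m) 0) b.+2 [::]) t.
  elim: m i w => [|m IH] i w.
    move=> _ /esym/size0nil->; exists 1; first lia.
    by rewrite addn0 /st !upd_upd; apply: EWhile0; rewrite /upd eqxx.
  case: w => //= x w iw [mw].
  have [||t ht ex] := IH i.+1 w; [by lia|by []|].
  set s1 := upd (upd (upd s b (F i)) b.+1 (un i)) b.+2 w.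
  have hs' : holds (F i :: un i :: e) (b :: b.+1 :: loc) b.+3 s1.
    split=> /=; first by rewrite hs1.
      case=> [_|[_|j]] /=.
      - by rewrite /s1 /upd; split; [lia|rewrite ltn_eqF // ltn_eqF // eqxx].
      - by rewrite /s1 /upd; split; [lia|rewrite ltn_eqF // eqxx].
      - by rewrite !ltnS => /hs2[l1 l2]; rewrite /s1 /upd !ltn_eqF; try lia; split=> //; lia.
    by move=> r hr; rewrite /s1 /upd !gtn_eqF ?hs3 //; lia.
  have [t3 ht3 ex3] := hh _ _ _ _ hs'.
  have FS : h (F i :: un i :: e) = F i.+1 by [].
  have szi : t3 <= (B e + (size (n e) + sz e) + 2) ^ dh.
    apply: leq_trans ht3 _; apply: leq_trans (pdh _) _.
    rewrite leq_expl // /sz /= size_un leq_add2r leq_add //; first by apply: hB; lia.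
    by rewrite leq_add2r; lia.
  have sz1 : size (F i) <= B e by apply: hB; lia.
  have sz2 : size (F i.+1) <= B e by apply: hB; lia.
  rewrite FS in ex3; rewrite addSnnS in ex.
  exists ((1 + (t3 + ((3 * size (F i)).+1 + ((16 * size (F i.+1) + 3) + 3).+1).+1).+1).+1 + t).+2.
    by lia.
  apply: EWhileS ex; first by rewrite /upd eqxx.
  apply: ESeq; first exact: EPop.
  rewrite upd_upd updE /= /st upd_upd -/s1.
  apply: ESeq ex3 _.
  have e1 : upd s1 b.+3 (F i.+1) b = F i.
    by rewrite /s1 /upd; do 4 (case: eqP => //; try lia).
  apply: ESeq; first by rewrite -e1; apply: clearP.
  set s2 := upd _ b [::].
  have e2 : s2 b.+3 = F i.+1 by rewrite /s2 /upd eqxx gtn_eqF //; lia.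
  have exS : exec (shift b.+3 b) s2 (upd (upd s2 b.+3 [::]) b (s2 b.+3))
      (16 * size (s2 b.+3) + 3).
    apply: shiftP; [by lia| |by rewrite /s2 updE].
    by rewrite /s2 /s1 /upd; updt; rewrite hs3 //; lia.
  rewrite e2 in exS; apply: ESeq exS _; apply: exec_eq; first exact: EPush.
  have b3 : s b.+3 = [::] by rewrite hs3 //; lia.
  move=> r; rewrite /s2 /s1; updt; subst => //; try (exfalso; lia).
have [||t3 ht3 ex3] := loop (size (n e)) 0 (n e); [by []|by []|].
exists (t1 + (t2 + (t3 + (3 * size (n e)).+1).+1).+1).+1.
  by lia.
apply: ESeq ex1 _; apply: ESeq ex2 _; apply: ESeq.
  move: ex3; rewrite /st upd_upd.
  set sA := upd _ b.+2 _; set sB := upd _ b.+2 (n e).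
  rewrite (_ : sA = sB); first by apply.
  apply: functional_extensionality => r; rewrite /sA /sB /upd.
  case: eqP => // _; case: eqP => // ->; rewrite gtn_eqF //= hs3 //; lia.
rewrite add0n upd_upd; set sC := upd _ b.+2 _.
have -> : size (n e) = size (sC b.+1) by rewrite /sC /upd ltn_eqF // eqxx size_un.
have b1 : s b.+1 = [::] by rewrite hs3.
have b2 : s b.+2 = [::] by rewrite hs3 //; lia.
apply: exec_eq; first exact: clearP.
by move=> r; rewrite /sC; updt; subst.
Qed.

Fixpoint pfs (fs : seq (env -> seq bool)) : Prop :=
  if fs is f :: fs' then pf f /\ pfs fs' else True.

(** Each value raises the first free register by one ([holds_over]), so the values pile up in
    consecutive registers while all functions read the same arguments. *)
Lemma pfs_run fs : pfs fs -> exists c tm, [/\ polyb tm,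
    polyb (fun e => sz [seq f e | f <- fs]) &
  forall e loc b s, holds e loc b s ->
  exists2 t, t <= tm e & exec (c loc b) s (fun r => if b <= r < b + size fs
     then nth [::] [seq f e | f <- fs] (r - b) else s r) t].
Proof.
elim: fs => [|f fs IH] /=.
  move=> _; exists (fun _ _ => Skip), (fun=> 1); split; [by polyb|by polyb|].
  move=> e loc b s _; exists 1 => //; apply: exec_eq (ESkip _) _ => r.
  by rewrite addn0; case: ifP => //; lia.
move=> [[c [tm [p1 p2 h]]] /IH[c' [tm' [p1' p2' h']]]].
exists (fun loc b => Seq (c loc b) (c' loc b.+1)), (fun e => tm e + tm' e + 1); split.
- by polyb.
- by rewrite /sz /=; polyb.
move=> e loc b s hs; have [t ht ex] := h _ _ _ _ hs.
have [t' ht' ex'] := h' _ _ _ _ (holds_over (f e) hs).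
exists (t + t').+1; first by lia.
apply: ESeq ex _; apply: exec_eq ex' _ => r; rewrite /upd.
case: (eqVneq r b) => [->|rb]; first by rewrite ltnn leqnn subnn /= addnS leq_addr.
case: ifP => h1; case: ifP => h2; try by move: h1 h2 rb; clear; lia.
  by rewrite (_ : r - b = (r - b.+1).+1) //; lia.
by [].
Qed.

Fixpoint clears b n := if n is n'.+1 then Seq (clear b) (clears b.+1 n') else Skip.

Lemma clearsP n b s : exists2 t, t <= 3 * sumn [seq size (s r) | r <- iota b n] + 2 * n + 1 &
  exec (clears b n) s (fun r => if b <= r < b + n then [::] else s r) t.
Proof.
elim: n b s => [|n IH] b s /=.
  by exists 1 => //; apply: exec_eq (ESkip _) _ => r; rewrite addn0; case: ifP => //; lia.
have [t ht ex] := IH b.+1 (upd s b [::]).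
exists ((3 * size (s b)).+1 + t).+1.
  have -> : [seq size (s r) | r <- iota b.+1 n] =
            [seq size (upd s b [::] r) | r <- iota b.+1 n].
    by apply/eq_in_map => r; rewrite mem_iota /upd => hr; rewrite gtn_eqF //; lia.
  by lia.
apply: ESeq (clearP _ _) _; apply: exec_eq ex _ => r; rewrite /upd.
case: (eqVneq r b) => rb; case: ifP => h1; case: ifP => h2 //; exfalso;
  by move: h1 h2 rb; clear; lia.
Qed.

(** The outer function sees the registers of the inner values as its only arguments. They are
    cleared afterwards and the result is moved down to [b], where it already is if [fs] is empty. *)
Lemma pf_comp fs g : pfs fs -> pf g -> pf (fun e => g [seq f e | f <- fs]).
Proof.
move=> /pfs_run[c [tm [p1 p2 h]]] [c' [tm' [[d' p1'] [d2 p2'] h']]].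
pose k := size fs.
have sg : polyb (fun e => size (g [seq f e | f <- fs])).
  apply: (@polyb_le _ (fun e => (sz [seq f e | f <- fs] + 2) ^ d2)) => [e|]; first exact: p2'.
  by polyb.
exists (fun loc b => if k is 0 then Seq (c loc b) (c' (iota b k) (b + k)) else
  Seq (c loc b) (Seq (c' (iota b k) (b + k)) (Seq (clears b k) (shift (b + k) b)))).
exists (fun e => tm e + (sz [seq f e | f <- fs] + 2) ^ d' +
  (3 * sz [seq f e | f <- fs] + 2 * k + 1 + 16 * size (g [seq f e | f <- fs])) + 6); split=> //.
  by polyb.
move=> e loc b s hs; have [t ht ex] := h _ _ _ _ hs.
set s1 := fun r => if _ then _ else _ in ex.
set e' := [seq f e | f <- fs].
have hs1 : holds e' (iota b k) (b + k) s1.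
  split; first by rewrite size_iota size_map.
    rewrite size_map => i hi; rewrite nth_iota // ltn_add2l hi /s1.
    by rewrite leq_addr ltn_add2l hi addKn.
  by case: hs => _ _ h3 r hr; rewrite /s1 h3 ?if_same; [case: ifP => //; lia|lia].
have [t' ht' ex'] := h' _ _ _ _ hs1.
have {}ht' := leq_trans ht' (p1' _).
have s1z r : b <= r -> (b + k <= r) || (r < b) -> s1 r = [::].
  case: hs => _ _ h3 hr1 hr2; rewrite /s1 h3 //.
  by case: ifP => //; move: hr1 hr2; rewrite -/k; lia.
case: (posnP k) => k0.
  exists (t + t').+1; first by lia.
  rewrite k0 in ex' *; rewrite addn0 in ex' *; apply: ESeq ex _.
  apply: exec_eq ex' _ => r; rewrite /upd /s1 -/k k0 addn0.
  by case: ifP => //; case: ifP => //; lia.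
rewrite -(prednK k0) [k.-1.+1]prednK //.
have [t2 ht2 ex2] := clearsP k b (upd s1 (b + k) (g e')).
set s2 := fun r => if _ then _ else _ in ex2.
have e2 : s2 (b + k) = g e' by rewrite /s2 ltnn andbF updE.
exists (t + (t' + (t2 + (16 * size (g e') + 3)).+1).+1).+1.
  have : t2 <= 3 * sz e' + 2 * k + 1.
    apply: leq_trans ht2 _.
    rewrite (_ : map _ _ = map size e') ?leqnn //.
    apply: (@eq_from_nth _ 0); rewrite ?size_map ?size_iota // => i hi.
    rewrite (nth_map 0) ?size_iota // (nth_map [::]) ?size_map // nth_iota //.
    by rewrite /upd ltn_eqF ?ltn_add2l // /s1 leq_addr ltn_add2l hi addKn.
  move: ht ht' e2; rewrite -/e'; clear; lia.
apply: ESeq ex _; apply: ESeq ex' _; apply: ESeq ex2 _.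
rewrite -e2; apply: exec_eq; first apply: shiftP.
- by lia.
- by rewrite /s2 /upd gtn_eqF // s1z //; [case: ifP => //; lia|lia|lia].
- by rewrite /s2 leqnn; case: ifP => //; lia.
case: hs => _ _ h3 r; rewrite e2 /upd; case: eqP => // /eqP rb.
rewrite /s2 /upd.
have [->|rk] := eqVneq r (b + k); first by rewrite h3 ?leq_addr.
case: ifP => h5; first by rewrite h3 //; case/andP: h5.
by rewrite /s1 -/k h5.
Qed.

Lemma sz_drop k e : sz (drop k e) <= sz e.
Proof. by elim: k e => [|k IH] [|v e] //; apply: leq_trans (IH e) (leq_addl _ _). Qed.

(** Weakening: recursions and bounded quantifiers put new entries in front of the environment, and
    [drop] reaches the old ones, as with de Bruijn indices. *)
Lemma pf_drop k f : pf f -> pf (fun e => f (drop k e)).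
Proof.
move=> [c [tm [[d p1] [d2 p2] h]]].
exists (fun loc b => c (drop k loc) b), (fun e => (sz e + 2) ^ d); split.
- by polyb.
- exists d2 => e; apply: leq_trans (p2 _) _.
  by rewrite leq_expl // leq_add2r sz_drop.
move=> e loc b s [h1 h2 h3].
have [|t ht ex] := h (drop k e) (drop k loc) b s.
  split=> //; first by rewrite !size_drop h1.
  move=> i; rewrite size_drop !nth_drop => hi; apply: h2; lia.
exists t => //; apply: leq_trans ht _; apply: leq_trans (p1 _) _.
by rewrite leq_expl // leq_add2r sz_drop.
Qed.

(** * Unary arithmetic, bounded quantifiers and finite tables *)

Definition pn (f : env -> nat) := pf (fun e => un (f e)).
Definition pb (b : env -> bool) := pn (fun e => b e).
Definition V k (e : env) : nat := size (nth [::] e k).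

Lemma pn_polyb f : pn f -> polyb f.
Proof.
by move=> [c [tm [_ [d p] _]]]; exists d => e; rewrite -(size_un (f e)).
Qed.

Lemma pf_polyb f : pf f -> polyb (fun e => size (f e)).
Proof. by move=> [c [tm []]]. Qed.

Lemma pn_size f : pf f -> pn (fun e => size (f e)).
Proof.
move=> pff.
have E e i : iteri i (fun i acc => true :: nth [::] (acc :: un i :: e) 0) [::] = un i.
  by elim: i => //= i ->.
apply: (@pf_eq (recf f (fun=> [::]) (fun e => true :: nth [::] e 0))).
  apply: (@pf_rec _ _ _ _ pff pf_nil _ (pf_polyb pff)) => [|e i hi].
    exact/pf_cons/pf_var.
  by rewrite E size_un.
by move=> e; apply: E.
Qed.

Lemma pn_V k : pn (V k). Proof. exact/pn_size/pf_var. Qed.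

Lemma pn_S f : pn f -> pn (fun e => (f e).+1).
Proof. exact: pf_cons. Qed.

Lemma pn_const c : pn (fun=> c).
Proof. by elim: c => [|c IH]; [exact: pf_nil|exact: pn_S]. Qed.

Lemma pn_eq f g : pn f -> (forall e, f e = g e) -> pn g.
Proof. by move=> pff h; apply: pf_eq pff _ => e; rewrite h. Qed.

Lemma pn_rec n a h B : pn n -> pn a -> pn h -> polyb B ->
  (forall e i, i <= n e -> iteri i (fun i acc => h (un acc :: un i :: e)) (a e) <= B e) ->
  pn (fun e => iteri (n e) (fun i acc => h (un acc :: un i :: e)) (a e)).
Proof.
move=> pnn pa ph pB hB.
have E e i : iteri i (fun i acc => un (h (acc :: un i :: e))) (un (a e)) =
   un (iteri i (fun i acc => h (un acc :: un i :: e)) (a e)).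
  by elim: i => //= i ->.
apply: (@pf_eq (recf (fun e => un (n e)) (fun e => un (a e)) (fun e => un (h e)))).
  apply: (@pf_rec _ _ _ _ pnn pa ph pB) => e i; rewrite size_un => hi.
  by rewrite E size_un hB.
by move=> e; rewrite /recf size_un E.
Qed.

Lemma pn_add f g : pn f -> pn g -> pn (fun e => f e + g e).
Proof.
move=> pf' pg.
have E e i : iteri i (fun i acc => (V 0 (un acc :: un i :: e)).+1) (f e) = f e + i.
  by elim: i => [|i IH] /=; rewrite ?addn0 // IH /V /= size_un addnS.
apply: (@pn_eq (fun e => iteri (g e) (fun i acc => (V 0 (un acc :: un i :: e)).+1) (f e))).
  apply: (@pn_rec _ _ (fun e => (V 0 e).+1) (fun e => f e + g e)) => //.
  - exact/pn_S/pn_V.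
  - by apply: polyb_add; apply: pn_polyb.
  - by move=> e i hi; rewrite E leq_add2l.
by move=> e; rewrite E.
Qed.

Lemma pn_pred f : pn f -> pn (fun e => (f e).-1).
Proof. by move=> h; apply: pf_eq (pf_behead h) _ => e; case: (f e). Qed.

Lemma pn_sub f g : pn f -> pn g -> pn (fun e => f e - g e).
Proof.
move=> pf' pg.
have E e i : iteri i (fun i acc => (V 0 (un acc :: un i :: e)).-1) (f e) = f e - i.
  by elim: i => [|i IH] /=; rewrite ?subn0 // IH /V /= size_un subnS.
apply: (@pn_eq (fun e => iteri (g e) (fun i acc => (V 0 (un acc :: un i :: e)).-1) (f e))).
  apply: (@pn_rec _ _ (fun e => (V 0 e).-1) f) => //.
  - exact/pn_pred/pn_V.
  - exact: pn_polyb.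
  - by move=> e i hi; rewrite E leq_subr.
by move=> e; rewrite E.
Qed.

Lemma pn_drop k f : pn f -> pn (fun e => f (drop k e)).
Proof. exact: (@pf_drop k (fun e => un (f e))). Qed.

Lemma pn_mul f g : pn f -> pn g -> pn (fun e => f e * g e).
Proof.
move=> pf' pg.
pose h e := V 0 e + f (drop 2 e).
have E e i : iteri i (fun i acc => h (un acc :: un i :: e)) 0 = f e * i.
  by elim: i => [|i IH] /=; rewrite ?muln0 // IH /h /V /= size_un ?drop0 mulnS addnC.
apply: (@pn_eq (fun e => iteri (g e) (fun i acc => h (un acc :: un i :: e)) 0)).
  apply: (@pn_rec _ _ h (fun e => f e * g e)) => //.
  - exact: pn_const.
  - by apply: pn_add (pn_drop _ _) => //; apply: pn_V.
  - by apply: polyb_mul; apply: pn_polyb.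
  - by move=> e i hi; rewrite E leq_mul2l hi orbT.
by move=> e; rewrite E.
Qed.

Lemma pf_if b f g : pb b -> pf f -> pf g -> pf (fun e => if b e then f e else g e).
Proof.
by move=> hb hf hg; apply: pf_eq (pf_case hb hg hf hg) _ => e; case: (b e).
Qed.

Lemma pn_if b f g : pb b -> pn f -> pn g -> pn (fun e => if b e then f e else g e).
Proof.
by move=> hb hf hg; apply: pf_eq (pf_if hb hf hg) _ => e; case: (b e).
Qed.

Lemma pb_if b f g : pb b -> pb f -> pb g -> pb (fun e => if b e then f e else g e).
Proof. by move=> hb hf hg; apply: pn_eq (pn_if hb hf hg) _ => e; case: (b e). Qed.

Lemma pb_true : pb (fun=> true). Proof. exact: pn_const 1. Qed.
Lemma pb_false : pb (fun=> false). Proof. exact: pn_const 0. Qed.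

Lemma pb_const b : pb (fun=> b). Proof. by case: b; [exact: pb_true|exact: pb_false]. Qed.

Lemma pb_eq f g : pb f -> (forall e, f e = g e) -> pb g.
Proof. by move=> pff h; apply: pf_eq pff _ => e; rewrite h. Qed.

Lemma pb_and b c : pb b -> pb c -> pb (fun e => b e && c e).
Proof. by move=> hb hc; apply: (pb_if hb hc pb_false). Qed.

Lemma pb_or b c : pb b -> pb c -> pb (fun e => b e || c e).
Proof. by move=> hb hc; apply: (pb_if hb pb_true hc). Qed.

Lemma pb_not b : pb b -> pb (fun e => ~~ b e).
Proof. by move=> hb; apply: (pb_if hb pb_false pb_true). Qed.

Lemma pb_leq f g : pn f -> pn g -> pb (fun e => f e <= g e).
Proof.
move=> pf' pg; have h := pn_sub pf' pg.
apply: pf_eq (pf_case h pb_true pf_nil pf_nil) _ => e.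
by rewrite /leq; case: (f e - g e).
Qed.

Lemma pb_eqn f g : pn f -> pn g -> pb (fun e => f e == g e).
Proof.
move=> pf' pg; apply: pb_eq (pb_and (pb_leq pf' pg) (pb_leq pg pf')) _ => e.
by rewrite eqn_leq.
Qed.

Lemma pb_drop k b : pb b -> pb (fun e => b (drop k e)).
Proof. exact: (@pn_drop k (fun e => b e)). Qed.

Definition exb (n : env -> nat) (B : env -> bool) (e : env) : bool :=
  has (fun i => B (un i :: e)) (iota 0 (n e)).

Lemma iota_S n : iota 0 n.+1 = rcons (iota 0 n) n.
Proof. by rewrite -addn1 iotaD cats1. Qed.

Lemma pb_exb n B : pn n -> pb B -> pb (exb n B).
Proof.
move=> hn hB.
pose h e := nat_of_bool ((V 0 e == 1) || B (drop 1 e)).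
have E e i : iteri i (fun i acc => h (un acc :: un i :: e)) 0 =
    has (fun i => B (un i :: e)) (iota 0 i) :> nat.
  elim: i => // i IH; rewrite iota_S -cats1 has_cat /= orbF IH /h /V /= size_un ?drop0.
  by case: (has _ _).
apply: (@pn_eq (fun e => iteri (n e) (fun i acc => h (un acc :: un i :: e)) 0)).
  apply: (@pn_rec _ _ h (fun=> 1)) => //.
  - exact: pn_const.
  - by apply: pb_or; [apply: pb_eqn; [exact: pn_V|exact: pn_const]|exact: pb_drop].
  - exact: polyb_const.
  - by move=> e i _; rewrite E; case: (has _ _).
by move=> e; rewrite E.
Qed.

Definition allb (n : env -> nat) (B : env -> bool) (e : env) : bool :=
  ~~ exb n (fun e => ~~ B e) e.

Lemma pb_allb n B : pn n -> pb B -> pb (allb n B).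
Proof. by move=> hn hB; apply/pb_not/pb_exb => //; apply: pb_not. Qed.

Definition findb (n : env -> nat) (B : env -> bool) (e : env) : nat :=
  find (fun i => B (un i :: e)) (iota 0 (n e)).

Lemma pn_findb n B : pn n -> pb B -> pn (findb n B).
Proof.
move=> hn hB.
(* The accumulator keeps up with the counter as long as nothing has been found and is frozen at the
   first success. *)
pose h e := if V 1 e <= V 0 e then (if B (drop 1 e) then V 1 e else (V 1 e).+1) else V 0 e.
have E e i : iteri i (fun i acc => h (un acc :: un i :: e)) 0 =
    find (fun i => B (un i :: e)) (iota 0 i).
  elim: i => // i IH; rewrite iota_S -cats1 find_cat has_find size_iota /= IH.
  rewrite /h /V /= !size_un ?drop0 leqNgt; case: ltnP => //= h1.
  by case: (B _); rewrite ?addn0 ?addn1.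
apply: (@pn_eq (fun e => iteri (n e) (fun i acc => h (un acc :: un i :: e)) 0)).
  apply: (@pn_rec _ _ h n) => //.
  - exact: pn_const.
  - apply: pn_if; first by apply: pb_leq; apply: pn_V.
      by apply: pn_if; [exact: pb_drop|exact: pn_V|exact/pn_S/pn_V].
    exact: pn_V.
  - exact: pn_polyb.
  - move=> e i hi; rewrite E; apply: leq_trans (find_size _ _) _.
    by rewrite size_iota.
by move=> e; rewrite E.
Qed.

Lemma pn_div f g : pn f -> pn g -> pn (fun e => f e %/ g e).
Proof.
move=> hf hg.
(* The quotient counts the [i] with [i.+1 * g <= f]; division by zero is treated separately
   below. *)
pose h e := V 0 e + ((V 1 e).+1 * g (drop 2 e) <= f (drop 2 e)).
have E e i : 0 < g e ->
    iteri i (fun i acc => h (un acc :: un i :: e)) 0 = minn i (f e %/ g e).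
  move=> g0; elim: i => [|i IH]; first by rewrite min0n.
  rewrite /= IH /h /V /= !size_un ?drop0 -leq_divRL //.
  by move: (f e %/ g e) => q; case: (leqP i.+1 q) => hq /=; lia.
have B e i : iteri i (fun i acc => h (un acc :: un i :: e)) 0 <= i.
  elim: i => //= i; set a := iteri _ _ _ => IH.
  by rewrite /h /V /= !size_un; case: (_ <= f _); move: IH; clear; lia.
apply: (@pn_eq (fun e => if g e <= 0 then 0 else
   iteri (f e) (fun i acc => h (un acc :: un i :: e)) 0)).
  apply: pn_if; [by apply: pb_leq => //; apply: pn_const|exact: pn_const|].
  apply: (@pn_rec _ _ h f) => //.
  - exact: pn_const.
  - apply: pn_add; first exact: pn_V.
    apply: pb_leq; last exact: pn_drop.
    by apply: pn_mul; [exact/pn_S/pn_V|exact: pn_drop].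
  - exact: pn_polyb.
  - by move=> e i hi; apply: leq_trans (B e i) hi.
move=> e; case: leqP => g0; first by move: g0; case: (g e).
by rewrite E //; apply/minn_idPr/leq_div.
Qed.

Lemma pn_mod f g : pn f -> pn g -> pn (fun e => f e %% g e).
Proof.
move=> hf hg; apply: (@pn_eq (fun e => f e - (f e %/ g e) * g e)).
  by apply: pn_sub => //; apply: pn_mul => //; apply: pn_div.
by move=> e; rewrite {1}(divn_eq (f e) (g e)) addKn.
Qed.

Lemma behead_drop T i (s : seq T) : behead (drop i s) = drop i.+1 s.
Proof. by rewrite -drop1 drop_drop add1n. Qed.

Lemma pf_dropw n f : pn n -> pf f -> pf (fun e => drop (n e) (f e)).
Proof.
move=> hn hf.
have E e i : iteri i (fun i acc => behead (nth [::] (acc :: un i :: e) 0)) (f e) =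
    drop i (f e).
  by elim: i => [|i IH] /=; rewrite ?drop0 // IH behead_drop.
apply: (@pf_eq (recf (fun e => un (n e)) f (fun e => behead (nth [::] e 0)))).
  apply: (@pf_rec _ _ _ _ hn hf _ (pf_polyb hf)) => [|e i hi].
    exact/pf_behead/pf_var.
  by rewrite E size_drop leq_subr.
by move=> e; rewrite /recf size_un E.
Qed.

Lemma pb_nth n f : pn n -> pf f -> pb (fun e => nth false (f e) (n e)).
Proof.
move=> hn hf.
apply: pf_eq (pf_case (pf_dropw hn hf) pf_nil pb_true pf_nil) _ => e.
rewrite -[n e in RHS]addn0 -nth_drop.
by case: (drop _ _) => [|[]].
Qed.

Lemma pf_consb b f : pb b -> pf f -> pf (fun e => b e :: f e).
Proof.
move=> hb hf; apply: pf_eq (pf_if hb (pf_cons true hf) (pf_cons false hf)) _ => e.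
by case: (b e).
Qed.

Lemma pf_rev f : pf f -> pf (fun e => rev (f e)).
Proof.
move=> hf.
pose h e := nth false (f (drop 2 e)) (V 1 e) :: nth [::] e 0.
have E e i : i <= size (f e) ->
    iteri i (fun i acc => h (acc :: un i :: e)) [::] = rev (take i (f e)).
  elim: i => [|i IH] hi; first by rewrite take0.
  by rewrite (take_nth false) // rev_rcons -IH 1?ltnW //= /h /V /= size_un ?drop0.
apply: (@pf_eq (recf f (fun=> [::]) h)).
  apply: (@pf_rec _ _ _ _ hf pf_nil _ (pf_polyb hf)) => [|e i hi].
    apply: pf_consb (pf_var 0); apply: pb_nth; [exact: pn_V|exact: pf_drop].
  by rewrite E // size_rev size_take_min geq_min hi.
by move=> e; rewrite /recf E // take_size.
Qed.

Definition mkw (n : env -> nat) (B : env -> bool) (e : env) : seq bool :=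
  mkseq (fun i => B (un i :: e)) (n e).

(** The recursion adds each new bit in front, so its result has to be reversed. *)
Lemma pf_mkw n B : pn n -> pb B -> pf (mkw n B).
Proof.
move=> hn hB.
pose h e := B (drop 1 e) :: nth [::] e 0.
have E e i :
    iteri i (fun i acc => h (acc :: un i :: e)) [::] = rev (mkseq (fun i => B (un i :: e)) i).
  elim: i => // i IH.
  by rewrite /mkseq iota_S map_rcons rev_rcons /= IH /h /= ?drop0.
apply: (@pf_eq (fun e => rev (recf (fun e => un (n e)) (fun=> [::]) h e))).
  apply/pf_rev/(@pf_rec _ _ _ _ hn pf_nil _ (pn_polyb hn)) => [|e i].
    exact: pf_consb (pb_drop _ _) (pf_var 0).
  by rewrite E size_un size_rev size_mkseq.
by move=> e; rewrite /recf E revK size_un.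
Qed.

Fixpoint pns (hs : seq (env -> nat)) : Prop :=
  if hs is h :: hs' then pn h /\ pns hs' else True.

Lemma pn_switch hs f : pns hs -> pn f -> pn (fun e => nth 0 [seq h e | h <- hs] (f e)).
Proof.
move=> + hf; elim: hs f hf => [|h hs IH] f hf /=.
  by move=> _; apply: pn_eq (pn_const 0) _ => e; rewrite nth_nil.
move=> [hh hhs]; have {}IH := IH _ (pn_pred hf) hhs.
apply: pn_eq (pn_if (pb_leq hf (pn_const 0)) hh IH) _ => e.
by case: (f e).
Qed.

(** On a finite range an arbitrary function is computed by cases. This is how the transition table
    of a fixed machine enters a program. *)
Lemma pn_table (t : nat -> nat) n f : pn f -> (forall e, f e < n) -> pn (fun e => t (f e)).
Proof.
move=> hf hn.
have : pns [seq (fun=> t i) | i <- iota 0 n].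
  by elim: (iota 0 n) => //= i s IH; split=> //; apply: pn_const.
move/pn_switch/(_ hf) => h; apply: pn_eq h _ => e.
by rewrite -map_comp (nth_map 0) ?size_iota // nth_iota.
Qed.

Lemma pb_table (t : nat -> bool) n f : pn f -> (forall e, f e < n) -> pb (fun e => t (f e)).
Proof. exact: (@pn_table (fun i => t i)). Qed.

Lemma pn_horner (p : {poly nat}) f : pn f -> pn (fun e => (p.[f e])%R).
Proof.
move=> hf; rewrite /horner; elim: (polyseq p) => [|a s IH] /=.
  exact: pn_const.
by apply: pn_add; [apply: pn_mul|apply: pn_const].
Qed.

(** * Assembling the deterministic machine *)

Section Abstraction.
Variable C : Type.
Variable M : TM C.

Definition fabs (t : tape M) : ftape (tm_extra M) := (nth None t.1, nth None t.2).

Lemma fabs_act d a (t : tape M) : fabs (tape_move d (tape_write a t)) = ftape_act a d (fabs t).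
Proof.
case: t => l r; rewrite /fabs /ftape_act; case: d => /=; congr pair;
  apply: functional_extensionality => i.
- by rewrite nth_behead.
- by case: i => [|[|i]] //=; rewrite ?nth0 // nth_behead.
- by case: i => [|i] //=; rewrite nth_behead.
- by case: i.
- by rewrite nth_behead.
Qed.

Lemma fabs_read (t : tape M) : (fabs t).2 0 = tape_read t.
Proof. by rewrite /tape_read -nth0. Qed.

(** Writing beyond the end of the list and moving left add one cell each. *)
Lemma size_step_tape d a (t : tape M) :
  size (tape_move d (tape_write a t)).2 <= (size t.2).+2.
Proof. by case: t => l [|s r]; case: d => //=; lia. Qed.

End Abstraction.

Section Runs.
Variable M : TM unit.

Definition runs_from (c : config M) (t : nat) : config M := foldl (@step unit M) c (nseq t tt).

Lemma runs_fromS c t : runs_from c t.+1 = runs_from (step c tt) t.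
Proof. by []. Qed.

Lemma runs_from_halted c t : verdict c <> None -> runs_from c t = c.
Proof.
move=> h; elim: t => // t IH; rewrite runs_fromS (_ : step c tt = c) //.
by rewrite /step; case: (verdict c) h.
Qed.

Lemma runs_from_add c a b : runs_from c (a + b) = runs_from (runs_from c a) b.
Proof. by rewrite /runs_from nseqD foldl_cat. Qed.

Lemma output_size c t : size (output (runs_from c t)) <= size (c.2 ord0).2 + 2 * t.
Proof.
have lb (s : seq (sym M)) : size (leading_bits s) <= size s.
  by elim: s => //= -[[b|e]|] s IH.
apply: leq_trans (lb _) _; elim: t c => [|t IH] c; first by rewrite addn0.
rewrite runs_fromS; apply: leq_trans (IH _) _; rewrite mulnS addnA leq_add2r.
rewrite /step; case: (verdict c) => [b|]; first by rewrite leq_addr.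
case: (tm_delta _ _ _) => q act /=; rewrite ffunE addn2; exact: size_step_tape.
Qed.

End Runs.

Section Solver.
Variables (S : TM unit) (Kc : nat).
Let E := tm_extra S.
Let K := Kc + tm_tapes S.

Definition emb (j : 'I_(tm_tapes S).+1) : 'I_K.+1 := inord (Kc + j).
Lemma emb_val j : emb j = Kc + j :> nat.
Proof. by rewrite inordK // /K ltnS leq_add2l -ltnS ltn_ord. Qed.

(** The solver lives on the tapes from [Kc] on. It runs until it halts by itself, so its polynomial
    bounds the time without being computed. *)
Definition solver_frag : frag E K :=
  @Frag E K (tm_state S) (tm_start S) (fun q => tm_verdict q != None)
    (fun q rd =>
      let qa := tm_delta tt q [ffun j => rd (emb j)] in
      (qa.1, [ffun i : 'I_K.+1 => if Kc <= i then qa.2 (inord (i - Kc)) else (rd i, Stay)])).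

Lemma solver_fragP t (c : config S) (tp : ftapes E K) :
  (forall j, tp (emb j) = fabs (c.2 j)) -> verdict (runs_from c t) <> None ->
  exists t' tp', [/\ t' <= t, @frun _ _ solver_frag (c.1, tp) ((runs_from c t).1, tp') t',
    forall j, tp' (emb j) = fabs ((runs_from c t).2 j)
    & forall i : 'I_K.+1, i < Kc -> tp' i = tp i].
Proof.
elim: t c tp => [|t IH] c tp h v.
  by exists 0, tp; split=> //; apply: frun0.
case vc : (verdict c) => [b|].
  rewrite runs_from_halted ?vc //; exists 0, tp; split=> //; exact: frun0.
rewrite runs_fromS in v *.
pose c' := (c.1, tp); have e1 : (fstep (F := solver_frag) c').1 = (step c tt).1.
  rewrite /fstep /step vc /= (_ : [ffun j => reads tp (emb j)] = [ffun i => tape_read (c.2 i)]).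
    by case: (tm_delta _ _ _).
  by apply/ffunP => j; rewrite !ffunE h fabs_read.
have e2 j : (fstep (F := solver_frag) c').2 (emb j) = fabs ((step c tt).2 j).
  rewrite /fstep /step vc /= /act_all ffunE emb_val leq_addr addKn inord_val.
  rewrite (_ : [ffun j => reads tp (emb j)] = [ffun i => tape_read (c.2 i)]); last first.
    by apply/ffunP => i; rewrite !ffunE h fabs_read.
  by case: (tm_delta _ _ _) => q act /=; rewrite ffunE fabs_act h.
have e3 (i : 'I_K.+1) : i < Kc -> (fstep (F := solver_frag) c').2 i = tp i.
  rewrite /fstep /= /act_all ffunE ltnNge => /negbTE -> /=; rewrite ffunE.
  by case: (tp i) => l r; congr pair; apply: functional_extensionality; case.
have [t' [tp' [h1 h2 h3 h4]]] := IH (step c tt) _ e2 v.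
exists t'.+1, tp'; split=> //; last by move=> i hi; rewrite h4 ?e3.
apply: frunS; first by rewrite /= /verdict in vc *; rewrite vc.
by move: h2; rewrite -e1; case: (fstep _).
Qed.

Definition push_frag (b : bool) : frag E K :=
  fseq (compile E K (Push 1 b)) (fprim (on_tape Kc (fun a => (a, MoveRight)))).
(** The solver may leave other symbols around its output, so tape [Kc] is no stack any more. It is
    read up to the first symbol that is not a bit, as in [leading_bits], and register 1 receives the
    output reversed. *)
Definition extract_frag : frag E K :=
  fwhile (inord Kc) (fcase (inord Kc) (compile E K Skip) (push_frag true) (push_frag false)).

Lemma extract_fragP (s : store) (tp : ftapes E K) (l : seq (option (bool + E))) : 2 <= Kc ->
  represents Kc s tp -> (tp (inord Kc)).2 = nth None l ->
  exists tp', fexec extract_frag tp tp' (8 * size (leading_bits (M := S) l)).+1 /\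
    represents Kc (upd s 1 (rev (leading_bits (M := S) l) ++ s 1)) tp'.
Proof.
move=> K2; have vK : (inord Kc : 'I_K.+1) = Kc :> nat by rewrite inordK // /K ltnS leq_addr.
elim: l s tp => [|a l IH] s tp rep tpK.
  exists tp; split; first by apply: fwhile_stop; rewrite tpK.
  by move=> i hi; rewrite rep //; congr word_tape; rewrite /upd; case: eqP => [->|].
have stop : ~~ is_bit a -> exists tp', fexec extract_frag tp tp' 1 /\
    represents Kc (upd s 1 (s 1)) tp'.
  move=> na; exists tp; split; first by apply: fwhile_stop; rewrite tpK.
  by move=> i hi; rewrite rep //; congr word_tape; rewrite /upd; case: eqP => [->|].
case: a tpK stop => [[b|e]|] tpK stop; try exact: stop.
have [tp1 [x1 r1 f1]] := @compileP E K (Push 1 b) Kc _ _ _ tp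
  (leq_trans (leq_addr _ _) (leqnSn _)) K2 (EPush 1 b s) rep.
pose tp2 := act_all (on_tape Kc (fun a => (a, MoveRight)) (reads tp1)) tp1.
have [||tp' [x' r']] := IH (upd s 1 (b :: s 1)) tp2.
- move=> i hi; rewrite /tp2 act_on_tape ltn_eqF // r1 //.
- rewrite /tp2 act_on_tape vK eqxx /=; rewrite f1 ?vK // tpK.
  by apply: functional_extensionality => i.
exists tp'; split; last first.
  rewrite upd_upd updE in r'; by rewrite /= rev_cons cat_rcons.
rewrite /= (_ : (8 * _).+1 = (6 + (8 * size (leading_bits (M := S) l)).+1).+2); last by lia.
apply: (fwhile_next _ _ x'); first by rewrite tpK.
apply: fcaseP; rewrite tpK /=.
by case: (b) x1 => x1; apply: (fseqP x1 (fprimP _ _)).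
Qed.

End Solver.

Section Decider.
Variables (E : finType) (K : nat) (F : frag E K) (ra : 'I_K.+1).

Definition decider : TM unit :=
  @MkTM unit (fstate F + bool)%type E K (inl (fini F))
    (fun q => if q is inr b then Some b else None)
    (fun _ q rd => match q with
      | inl q => if fhalt q then (inr (if rd ra is Some (inl true) then true else false), noop rd)
                 else let qa := fdelta q rd in (inl qa.1, qa.2)
      | inr b => (inr b, noop rd) end).

Definition fconf (c : config decider) : ftapes E K := fun i => fabs (c.2 i).

Lemma decider_step (c : config decider) q : c.1 = inl q -> ~~ fhalt q ->
  (step c tt).1 = inl (fstep (F := F) (q, fconf c)).1 /\
  fconf (step c tt) = (fstep (F := F) (q, fconf c)).2.
Proof.
case: c => q0 tps /= -> hq; rewrite /step /verdict /= (negbTE hq) /fstep /=.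
have -> : [ffun i => tape_read (tps i)] = reads (fconf (inl q, tps) : ftapes E K).
  by apply/ffunP => i; rewrite !ffunE -fabs_read.
split=> //; apply: functional_extensionality => i.
by rewrite /fconf /= ffunE fabs_act.
Qed.

Lemma decider_run c1 c2 t (c : config decider) : frun c1 c2 t ->
  c.1 = inl c1.1 -> fconf c = c1.2 ->
  (runs_from c t).1 = inl c2.1 /\ fconf (runs_from c t) = c2.2.
Proof.
move=> r; elim: r c => {c1 c2 t} [c0|c1 c2 t hc _ IH] c e1 e2 //.
have [s1 s2] := decider_step e1 hc; rewrite e2 -surjective_pairing in s1 s2.
by rewrite runs_fromS; apply: IH.
Qed.

(** The strict bound [t < T] leaves one step for reading the answer on tape [ra] and entering a
    state with a verdict. *)
Lemma deciderP x (tp0 tp' : ftapes E K) t w T : fexec F tp0 tp' t ->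
  (forall i, tp0 i = word_tape E (if i == ord0 then x else [::])) ->
  tp' ra = word_tape E w -> t < T ->
  verdict (run_for decider T x) = Some (ohead w == Some true).
Proof.
move=> [q hq r] i0 ew tT.
have [|e1 e2] := decider_run (c := init decider x) r (erefl _).
  apply: functional_extensionality => i; rewrite /= i0 /fconf /= ffunE /fabs /word_tape /=.
  congr pair; first by apply: functional_extensionality => j; rewrite nth_nil.
  by case: (i == ord0).
rewrite /run_for /run -/(runs_from (init decider x) T) -(subnKC (ltnW tT)) runs_from_add.
case d : (T - t) => [|d']; first by lia.
rewrite runs_fromS; move: e1 e2; set c := runs_from _ t => e1 e2.
have v : verdict (step c tt) = Some (ohead w == Some true).
  rewrite /step {1}/verdict /= e1 /= hq /verdict /= ffunE -fabs_read.
  have -> : fabs (c.2 ra) = tp' ra by exact: (congr1 (fun f => f ra) e2).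
  by rewrite ew /=; case: (w) => [|[] ?].
by rewrite runs_from_halted v.
Qed.

End Decider.

Lemma polyb_horner (p : {poly nat}) g : polyb g -> polyb (fun e => (p.[g e])%R).
Proof.
move=> hg; rewrite /horner; elim: (polyseq p) => [|a s IH] /=; first exact: polyb_const.
by apply: polyb_add (polyb_const a); apply: polyb_mul.
Qed.

Lemma horner_power d n : ((('X + 2%:P)^+d : {poly nat}).[n])%R = (n + 2) ^ d.
Proof.
by rewrite horner_exp hornerD hornerX hornerC -natrXE.
Qed.

(** * Deciding a language with a single call of the solver *)

Section Oracle.
Variables (S : TM unit) (pS : {poly nat}) (g : seq bool -> seq bool)
  (chk : seq bool -> seq bool -> bool) (L : language).
Hypothesis hg : pf (fun e => g (nth [::] e 0)).
Hypothesis hchk : pb (fun e => chk (nth [::] e 0) (nth [::] e 1)).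
Let answer x := run_for S (pS.[size (g x)])%R (g x).
Hypothesis halts : forall x, verdict (answer x) <> None.
Hypothesis LP : forall x, L x <-> chk x (output (answer x)).

Theorem one_query_class_P : class_P L.
Proof.
case: hg => c1 [tm1 [q1 r1 h1]]; case: hchk => c2 [tm2 [[d2 q2] r2 h2]].
set k1 := c1 [:: 0] 1; set k2 := c2 [:: 0; 2] 3.
(* The registers below [Kc] belong to the stack programs; tape [Kc] is the input tape of the
   solver. *)
pose Kc := (maxn (maxn (maxreg k1) (maxreg k2)) 3).+1.
have K4 : 4 <= Kc by rewrite /Kc; lia.
pose K := Kc + tm_tapes S; pose E := tm_extra S.
pose A1 := Seq k1 (Seq (moverev 1 2) (moverev 2 Kc)).
pose A2 := Seq (moverev 1 2) k2.
pose F := fseq (compile E K A1) (fseq (solver_frag S Kc)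
  (fseq (extract_frag S Kc) (compile E K A2))).
pose D := decider F (inord 3).
(* [O] bounds the length of the output, since one step adds at most two cells to the right part of a
   tape. *)
pose G e := size (g (nth [::] e 0)); pose PS e := (pS.[G e])%R; pose O e := G e + 2 * PS e.
pose B e := tm1 e + 16 * G e + PS e + 16 * O e + (sz e + O e + 2) ^ d2 + 50.
have pB : polyb B.
  have pG : polyb G by exact: r1.
  have pPS : polyb PS by exact: polyb_horner.
  by rewrite /B /O; polyb.
case: pB => d hB; exists D, (('X + 2%:P)^+d)%R => x; rewrite horner_power.
set out := output (answer x).
suff run_ok : verdict (run_for D ((size x + 2) ^ d) x) = Some (chk x out).
  split; first by rewrite run_ok.
  by rewrite run_ok LP -/out; split=> [->|[]].
pose s0 : store := upd (fun=> [::]) 0 x.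
pose tp0 : ftapes E K := fun i => word_tape E (if i == ord0 then x else [::]).
have rep0 : represents Kc.+1 s0 tp0.
  by move=> i _; rewrite /tp0 /s0 /upd -val_eqE /=.
have hs0 : holds [:: x] [:: 0] 1 s0.
  by split=> // [[|]|[|r]] //.
have [t1 ht1 ex1] := h1 _ _ _ _ hs0.
rewrite /= -/k1 in ex1; set gx := g x in ex1.
pose sA : store := upd s0 Kc gx.
have exA1 : exec A1 s0 sA (t1 + ((8 * size gx).+1 + (8 * size gx).+1).+1).+1.
  apply: ESeq ex1 _.
  have m1 := @moverevP 1 2 (upd s0 1 gx) isT; rewrite updE in m1.
  apply: ESeq m1 _; set s2 := upd _ 1 [::].
  have e2 : s2 2 = rev gx by rewrite /s2 /s0 /upd /= cats0.
  have m2 := @moverevP 2 Kc s2 (ltac:(lia)); rewrite e2 revK size_rev in m2.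
  apply: exec_eq m2 _ => r; rewrite /sA /s2 /s0; updt; subst => //; rewrite ?cats0 //; lia.
have regA1 : maxreg A1 < Kc.+1 by rewrite /A1 /moverev /= /Kc; lia.
have KcK : Kc.+1 <= K.+1 by rewrite ltnS leq_addr.
(* For the first program tape [Kc] still counts as a register, which receives the query; for the
   second one only those below [Kc] do. *)
have [tp1 [x1 rep1 f1]] := compileP KcK regA1 exA1 rep0.
have init1 j : tp1 (emb Kc j) = fabs ((init S gx).2 j).
  rewrite ffunE /fabs /=; have ej := emb_val Kc j.
  have [j0|j0] := eqVneq j ord0.
    rewrite rep1 ej j0 addn0 // /sA updE; congr pair.
    by apply: functional_extensionality => i; rewrite nth_nil.
  have jp : 0 < j by rewrite lt0n; apply: contraNneq j0 => e; apply/eqP/val_inj.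
  have ge : Kc.+1 <= emb Kc j by rewrite ej; lia.
  rewrite (f1 _ ge) /tp0 ifF; last first.
    by apply/eqP => /(congr1 val) /=; rewrite ej; lia.
  by congr pair; apply: functional_extensionality => i; rewrite nth_nil.
have hv : verdict (runs_from (init S gx) (PS [:: x])) <> None by exact: halts.
have [t2 [tp2 [ht2 x2 e2 f2]]] := solver_fragP init1 hv.
have X2 : fexec (solver_frag S Kc) tp1 tp2 t2.
  by exists (runs_from (init S gx) (PS [:: x])).1 => //; apply/eqP.
have rep2 : represents Kc sA tp2.
  by move=> i hi; rewrite f2 // rep1 // ltnW.
have tK : (tp2 (inord Kc)).2 = nth None ((answer x).2 ord0).2.
  by have := e2 ord0; rewrite /emb addn0 => ->.
have [tp3 [x3 rep3]] := extract_fragP (leq_trans (isT : 2 <= 4) K4) rep2 tK.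
rewrite -[leading_bits _]/out in x3 rep3.
pose s3 : store := upd (upd (fun=> [::]) 0 x) 1 (rev out).
have rep3' : represents Kc s3 tp3.
  move=> i hi; rewrite rep3 //; congr word_tape; rewrite /s3 /sA /s0.
  by updt; subst => //; rewrite ?cats0 //; lia.
pose s4 : store := upd (upd (fun=> [::]) 0 x) 2 out.
have hs4 : holds [:: x; out] [:: 0; 2] 3 s4.
  by split=> // [[|[|]]|[|[|[|]]]] //.
have [t4 ht4 ex4] := h2 _ _ _ _ hs4; rewrite /= -/k2 in ex4.
have exA2 : exec A2 s3 (upd s4 3 (nseq (chk x out) true)) ((8 * size out).+1 + t4).+1.
  apply: ESeq ex4.
  have m1 := @moverevP 1 2 s3 isT; rewrite (_ : s3 1 = rev out) // revK size_rev in m1.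
  by apply: exec_eq m1 _ => r; rewrite /s4 /s3; updt; subst => //; rewrite ?cats0.
have regA2 : maxreg A2 < Kc by rewrite /A2 /moverev /= /Kc; lia.
have [tp4 [x4 rep4 _]] := compileP (ltnW KcK) regA2 exA2 rep3'.
have FX := fseqP x1 (fseqP X2 (fseqP x3 x4)).
have i3 : (inord 3 : 'I_K.+1) = 3 :> nat by rewrite inordK // /K; lia.
have w4 : tp4 (inord 3) = word_tape E (nseq (chk x out) true).
  by rewrite rep4 i3 //; apply: leq_trans K4.
have tot := deciderP (x := x) FX (fun i => erefl) w4.
rewrite (tot ((size x + 2) ^ d)); first by case: (chk x out).
have so : size out <= O [:: x].
  rewrite /out /answer; have := output_size (init S gx) (PS [:: x]).
  by rewrite ffunE /= size_map.
have b4 : t4 <= (sz [:: x] + O [:: x] + 2) ^ d2.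
  apply: leq_trans ht4 _; apply: leq_trans (q2 _) _.
  by rewrite leq_expl // leq_add2r /sz /= !addn0 leq_add2l.
have := hB [:: x]; rewrite (_ : sz [:: x] = size x) => [hBx|]; last by rewrite /sz /= addn0.
apply: leq_trans hBx.
have eG : size gx = G [:: x] by [].
rewrite /B; move: ht1 ht2 b4 so; rewrite eG.
move: (G _) (PS _) (O _) (tm1 _) (_ ^ d2) (size out) => a1 a2 a3 a4 a5 a6.
by clear; lia.
Qed.

End Oracle.

(** * From satisfiability to 3-colourability *)

Section Gadget.
(* [ny] variables, [nc] clauses of width [w]; the literal number [j] of the
   clause [c] is described at the slot [c * w + j]. *)
Variables (ny nc w : nat) (var : nat -> nat) (pol active : nat -> bool).

Definition base : nat := 2 + 2 * ny.
(** Every clause gets its vertices, active or not, so that vertex numbers are given by plain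
    arithmetic. *)
Definition nvert : nat := base + 3 * (nc * w).
Definition vP i := base + 3 * i.
Definition vQ i := base + 3 * i + 1.
Definition vO i := base + 3 * i + 2.
(** A clause is a chain of binary disjunctions: its first slot starts from the vertex for false,
    each later one from the output of its predecessor. *)
Definition vprev i := if i %% w == 0 then 1 else vO i.-1.
Definition vlit i := 2 + 2 * var i + pol i.

(* Vertex 0 is the neutral colour and vertex 1 is false. The triangle
   [vP i], [vQ i], [vO i] forces [vO i] to be false when [vprev i] and
   [vlit i] are false. *)
Definition var_edge u v t : bool :=
  [|| (u == 2 + 2 * t) && (v == 3 + 2 * t), (u == 0) && (v == 2 + 2 * t)
    | (u == 0) && (v == 3 + 2 * t)].

Definition slot_edge u v i : bool :=
  [|| (u == vP i) && (v == vQ i), (u == vP i) && (v == vO i),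
      (u == vQ i) && (v == vO i), (u == vprev i) && (v == vP i),
      (u == vlit i) && (v == vQ i)
    | [&& i %% w == w.-1, active (i %/ w), u == vO i & v == 1]].

Definition gadget_edge u v : bool :=
  [|| (u == 0) && (v == 1), has (var_edge u v) (iota 0 ny)
    | has (slot_edge u v) (iota 0 (nc * w))].

Definition colouring (col : nat -> nat) : Prop :=
  (forall u, u < nvert -> col u < 3) /\
  (forall u v, u < nvert -> v < nvert -> u != v -> gadget_edge u v -> col u != col v).

Definition satisfies (asg : nat -> bool) : Prop :=
  forall c, c < nc -> active c -> exists2 j, j < w & asg (var (c * w + j)) = pol (c * w + j).

Hypothesis w0 : 0 < w.
Hypothesis var_lt : forall i, i < nc * w -> var i < ny.

Lemma slot_lt c j : c < nc -> j < w -> c * w + j < nc * w.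
Proof. by move=> hc hj; apply: (@leq_trans (c.+1 * w)); [lia|rewrite leq_mul2r hc orbT]. Qed.

(** If all literals of an active clause had the colour of vertex 1, that colour would run along its
    chain to the last output, which is adjacent to vertex 1. *)
Lemma colouring_satisfies col : colouring col -> exists asg, satisfies asg.
Proof.
move=> [c3 pr].
have e01 : col 0 != col 1 by apply: pr; rewrite /nvert /base //; lia.
have ev t : t < ny -> [/\ col (2 + 2 * t) != col (3 + 2 * t), col 0 != col (2 + 2 * t)
    & col 0 != col (3 + 2 * t)].
  move=> ht; have ht' : has (var_edge (2 + 2 * t) (3 + 2 * t)) (iota 0 ny).
    by apply/hasP; exists t; rewrite ?mem_iota // /var_edge !eqxx.
  split; apply: pr; rewrite /nvert /base; try lia; rewrite /gadget_edge.
  - by rewrite ht' orbT.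
  - apply/or3P/Or32/hasP; exists t; rewrite ?mem_iota // /var_edge !eqxx ?orbT //.
  - apply/or3P/Or32/hasP; exists t; rewrite ?mem_iota // /var_edge !eqxx ?orbT //.
have es u v i : i < nc * w -> u < nvert -> v < nvert -> u != v -> slot_edge u v i ->
    col u != col v.
  move=> hi hu hv uv h; apply: pr => //; apply/or3P/Or33/hasP.
  by exists i; rewrite ?mem_iota.
(* Vertex [3 + 2 * t] is the positive literal of the variable [t], vertex [2 + 2 * t] the negative
   one. *)
pose asg t := col (3 + 2 * t) != col 1; exists asg => c hc ac.
have lits i : i < nc * w -> col (vlit i) = col 1 \/ asg (var i) = pol i.
  move=> hi; have vi := var_lt hi; have [l1 l2 l3] := ev _ vi.
  have := c3 0; have := c3 1; have := c3 (2 + 2 * var i); have := c3 (3 + 2 * var i).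
  rewrite /nvert /base /asg /vlit => h1 h2 h3 h4.
  have {h1}h1 := h1 ltac:(lia); have {h2}h2 := h2 ltac:(lia).
  have {h3}h3 := h3 ltac:(lia); have {h4}h4 := h4 ltac:(lia).
  case: (pol i) => /=.
    rewrite (_ : 2 + 2 * var i + 1 = 3 + 2 * var i); last by lia.
    by case: eqP; [left|right].
  rewrite addn0; case: (eqVneq (col (3 + 2 * var i)) (col 1)) => e; first by right.
  by left; lia.
have [/hasP[j]|/hasPn nh] :=
  boolP (has (fun j => asg (var (c * w + j)) == pol (c * w + j)) (iota 0 w)).
  by rewrite mem_iota => hj /eqP e; exists j.
have litF j : j < w -> col (vlit (c * w + j)) = col 1.
  move=> hj; case: (lits _ (slot_lt hc hj)) => // e.
  by have := nh j; rewrite mem_iota e eqxx => /(_ hj).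
have step j : j < w -> col (vprev (c * w + j)) = col 1 -> vprev (c * w + j) < vP (c * w + j) ->
    col (vO (c * w + j)) = col 1.
  move=> hj; move: (litF _ hj) (slot_lt hc hj); move: (c * w + j) => i lF hi pF lt.
  have vi := var_lt hi.
  have bP : vP i < nvert by rewrite /vP /nvert; lia.
  have bQ : vQ i < nvert by rewrite /vQ /nvert; lia.
  have bO : vO i < nvert by rewrite /vO /nvert; lia.
  have bL : vlit i < vQ i by rewrite /vlit /vQ /base; case: (pol i); lia.
  have p1 : col (vP i) != col (vQ i).
    by apply: (es _ _ i) => //; rewrite /slot_edge ?eqxx // /vP /vQ; lia.
  have p2 : col (vP i) != col (vO i).
    by apply: (es _ _ i) => //; rewrite /slot_edge ?eqxx ?orbT // /vP /vO; lia.
  have p3 : col (vQ i) != col (vO i).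
    by apply: (es _ _ i) => //; rewrite /slot_edge ?eqxx ?orbT // /vQ /vO; lia.
  have p4 : col (vlit i) != col (vQ i).
    by apply: (es _ _ i); rewrite ?(ltn_trans bL) ?ltn_eqF // /slot_edge !eqxx ?orbT.
  have p5 : col (vprev i) != col (vP i).
    by apply: (es _ _ i); rewrite ?(ltn_trans lt) ?ltn_eqF // /slot_edge !eqxx ?orbT.
  have c1 : col 1 < 3 by apply: c3; rewrite /nvert /base; lia.
  by move: (c3 _ bP) (c3 _ bQ) (c3 _ bO); rewrite lF in p4; rewrite pF in p5; lia.
have outF j : j < w -> col (vO (c * w + j)) = col 1.
  elim: j => [|j IH] hj; apply: step => //.
  - by rewrite /vprev addn0 modnMl.
  - by rewrite /vprev addn0 modnMl /vP /base /=; lia.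
  - by rewrite /vprev modnMDl modn_small //= addnS /= IH // ltnW.
  - by rewrite /vprev modnMDl modn_small //= addnS /= /vO /vP; lia.
have wp : w.-1 < w by lia.
have hi := slot_lt hc wp; have := outF _ wp.
suff : col (vO (c * w + w.-1)) != col 1 by move=> /eqP.
apply: (es _ _ (c * w + w.-1)) => //; rewrite /vO /nvert /base; try lia.
by rewrite /slot_edge modnMDl modn_small // divnMDl // divn_small // addn0 ac !eqxx !orbT.
Qed.

Section Extend.
Variable asg : nat -> bool.
Let lt i := asg (var i) == pol i.
Let orv i := has (fun j => lt (i - i %% w + j)) (iota 0 (i %% w).+1).
Let prv i := (i %% w != 0) && orv i.-1.

(** The colours are 0 for neutral, 1 for false, 2 for true. [orv i] is the disjunction of the
    literals up to slot [i] of its clause and [prv i] the one before that slot; the cases complete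
    each triangle properly for the given values of its two inputs. *)
Definition gadget_col (u : nat) : nat :=
  if u < 2 then u else
  if u < base then (if asg ((u - 2) %/ 2) == ((u - 2) %% 2 == 1) then 2 else 1) else
  let i := (u - base) %/ 3 in
  if (u - base) %% 3 == 0 then (if prv i then 1 else if lt i then 0 else 2) else
  if (u - base) %% 3 == 1 then (if ~~ prv i && lt i then 1 else 0) else
  if orv i then 2 else 1.

Let orvE i : orv i = prv i || lt i.
Proof.
rewrite /prv /orv; case: (posnP (i %% w)) => [->|i0].
  by rewrite /= subn0 addn0 orbF.
have i1 : 0 < i by apply: leq_trans i0 (leq_mod _ _).
have em : i.-1 %% w = (i %% w).-1.
  rewrite {1}(divn_eq i w) -(prednK i0) addnS /= modnMDl modn_small //.
  by have := ltn_pmod i w0; lia.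
have es : i.-1 - i.-1 %% w = i - i %% w.
  by rewrite em; have := leq_mod i w; lia.
by rewrite es em prednK // -addn1 iotaD has_cat /= orbF add0n subnK ?leq_mod.
Qed.

Let colS i s : s < 3 -> gadget_col (base + 3 * i + s) =
  if s == 0 then (if prv i then 1 else if lt i then 0 else 2) else
  if s == 1 then (if ~~ prv i && lt i then 1 else 0) else
  if orv i then 2 else 1.
Proof.
move=> hs; rewrite /gadget_col (_ : _ < 2 = false); last by rewrite /base; lia.
rewrite (_ : _ < base = false); last by rewrite ltnNge -addnA leq_addr.
have -> : base + 3 * i + s - base = i * 3 + s by rewrite -addnA addKn mulnC.
by rewrite divnMDl // modnMDl divn_small // modn_small // addn0.
Qed.

Let colL t (b : bool) : t < ny -> gadget_col (2 + 2 * t + b) = if asg t == b then 2 else 1.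
Proof.
move=> ht; rewrite /gadget_col (_ : _ < 2 = false); last by lia.
rewrite (_ : _ < base = true); last by rewrite /base; case: b; lia.
have -> : 2 + 2 * t + b - 2 = t * 2 + b by lia.
rewrite divnMDl // modnMDl divn_small ?modn_small ?addn0; last 2 first.
- by case: b.
- by case: b.
by case: b.
Qed.

Lemma gadget_col_colouring : satisfies asg -> colouring gadget_col.
Proof.
move=> sat; have cP i : gadget_col (vP i) = if prv i then 1 else if lt i then 0 else 2.
  by rewrite /vP -[_ + 3 * i]addn0 colS.
have cQ i : gadget_col (vQ i) = if ~~ prv i && lt i then 1 else 0 by rewrite /vQ colS.
have cO i : gadget_col (vO i) = if orv i then 2 else 1 by rewrite /vO colS.
split=> [u _|u v hu hv uv].
  by rewrite /gadget_col; repeat (case: ifP => //); lia.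
case/or3P => [/andP[/eqP-> /eqP->]//|/hasP[t]|/hasP[i]]; rewrite mem_iota => /= h.
  have l0 := colL false h; have l1 := colL true h; rewrite addn0 in l0.
  rewrite (_ : 2 + 2 * t + true = 3 + 2 * t) in l1; last by lia.
  case/or3P => /andP[/eqP-> /eqP->]; rewrite ?l0 ?l1; by case: (asg t).
have cprev : gadget_col (vprev i) = if prv i then 2 else 1.
  by rewrite /vprev /prv; case: (i %% w == 0) => //=; rewrite cO.
have clit : gadget_col (vlit i) = if lt i then 2 else 1.
  by rewrite /vlit colL ?var_lt.
have oE := orvE i.
case/or4P=> [|||/or3P[]] => [/andP[/eqP-> /eqP->]|/andP[/eqP-> /eqP->]|/andP[/eqP-> /eqP->]
  |/andP[/eqP-> /eqP->]|/andP[/eqP-> /eqP->]|/and4P[/eqP iw ac /eqP-> /eqP->]];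
  rewrite ?cP ?cQ ?cO ?cprev ?clit ?oE.
1-5: by case: (prv i); case: (lt i).
rewrite -oE; have ic : i %/ w < nc by rewrite ltn_divLR.
have [j hj e] := sat _ ic ac; have -> : orv i.
  apply/hasP; exists j; first by rewrite mem_iota iw; lia.
  have -> : i - i %% w = i %/ w * w by rewrite {1}(divn_eq i w) addnK.
  exact/eqP.
by [].
Qed.

End Extend.
End Gadget.

(** * Nondeterministic computations as satisfying assignments *)

Section Tableau.
Variable M : TM bool.

Let symb := option (bool + tm_extra M).
Let vec := {ffun 'I_(tm_tapes M).+1 -> symb}.

(* What a square of the tableau records: the state, the choice and the scanned
   symbols (the same along a row), and the symbols of all tapes at this
   distance from their heads. *)
Definition square := (tm_state M * bool * vec * vec)%type.
Definition sq_ctl (a : square) := a.1.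
Definition sq_cell (a : square) : vec := a.2.

Definition dim := #|{: square}|.
Definition width := 4 * dim.
(** An arbitrary condition on the variables of a window becomes clauses of fixed width: one for each
    forbidden pattern. *)
Definition pattern := {ffun 'I_width -> bool}.
Definition npat := #|{: pattern}|.

Lemma dim_gt0 : 0 < dim.
Proof. by apply/card_gt0P; exists (tm_start M, false, [ffun=> None], [ffun=> None]). Qed.

Lemma width_gt0 : 0 < width. Proof. by rewrite /width; have := dim_gt0; lia. Qed.
Lemma npat_gt0 : 0 < npat. Proof. by apply/card_gt0P; exists [ffun=> false]. Qed.

(** Several variables of a square may be true; [pick] selects one of them as a function of the truth
    values alone. *)
Definition decode (f : nat -> bool) : option square := [pick a : square | f (enum_rank a)].

(** Code 1 stands for a blank, 2 and 3 for the input bits; code 0, used below the first row, imposes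
    nothing. *)
Definition initial_cell (ic : nat) : vec :=
  [ffun i => if i == ord0 then
     (if ic == 2 then Some (inl false) else if ic == 3 then Some (inl true) else None)
   else None].

(* [pc] is 1, 2 or 3 when the centre of the window is left of, at, or right
   of the head. *)
Definition next_square (pc : nat) (l m r : square) : tm_state M * vec :=
  let: (q, ch, rd) := sq_ctl m in
  if tm_verdict q is Some _ then (q, sq_cell m) else
  let: (q', act) := tm_delta ch q rd in
  (q', [ffun i => match (act i).2 with
     | MoveLeft => if pc == 3 then (act i).1 else sq_cell l i
     | Stay => if pc == 2 then (act i).1 else sq_cell m i
     | MoveRight => if pc == 1 then (act i).1 else sq_cell r i end]).

(** State, choice and scanned symbols are global data. Equality of neighbours spreads them along the
    row, and the column of the heads ties the scanned symbols to the cells. *)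
Definition local_rule (ic pc : nat) (fc : bool) (l m r n : square) : bool :=
  [&& sq_ctl l == sq_ctl m, sq_ctl m == sq_ctl r,
      (pc == 2) ==> ((sq_ctl m).2 == sq_cell m),
      (ic != 0) ==> ((sq_ctl m).1.1 == tm_start M) && (sq_cell m == initial_cell ic),
      ((sq_ctl n).1.1, sq_cell n) == next_square pc l m r
    & fc ==> (tm_verdict (sq_ctl n).1.1 == Some true)].

Definition pattern_ok (ic pc : nat) (fc : bool) (f : nat -> bool) : bool :=
  match decode f, decode (fun a => f (dim + a)), decode (fun a => f (2 * dim + a)),
        decode (fun a => f (3 * dim + a)) with
  | Some l, Some m, Some r, Some n => local_rule ic pc fc l m r n
  | _, _, _, _ => false
  end.

Definition pattern_fun (k : nat) : nat -> bool :=
  fun j => if insub j is Some j' then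
    (if insub k is Some k' then (enum_val (k' : 'I_npat) : pattern) j' else false) else false.

Section Grid.
Variables (x : seq bool) (T : nat).
Hypothesis T0 : 0 < T.

(** All heads stay in this column. With [T.+1] columns on either side, the border, which no rule
    controls fully, cannot influence it within [T] steps. *)
Definition mid := T.+1.
Definition cols := 2 * mid + 1.
Definition nvars := T.+1 * cols * dim.
Definition nclauses := T * (cols - 2) * npat.

Definition clause_row c := c %/ npat %/ (cols - 2).
Definition clause_col c := (c %/ npat) %% (cols - 2).
Definition slot_var i :=
  let c := i %/ width in let z := i %% width %/ dim in
  ((clause_row c + (z == 3)) * cols + (clause_col c + (if z == 3 then 1 else z))) * dim
  + i %% width %% dim.
(** A clause excludes its pattern, so its literals are the negated entries. *)
Definition slot_pol i := ~~ pattern_fun (i %/ width %% npat) (i %% width).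

Definition init_code t P :=
  if t == 0 then (if (mid <= P) && (P < mid + size x) then 2 + nth false x (P - mid) else 1) else 0.
Definition pos_code P := if P == mid then 2 else if P.+1 == mid then 1 else if P == mid.+1 then 3 else 0.

Definition clause_active c :=
  ~~ pattern_ok (init_code (clause_row c) (clause_col c).+1) (pos_code (clause_col c).+1)
       ((clause_row c).+1 == T) (pattern_fun (c %% npat)).

Definition var_at t P a := (t * cols + P) * dim + a.

Definition window (asg : nat -> bool) t P j :=
  let z := j %/ dim in
  asg (var_at (t + (z == 3)) (P + (if z == 3 then 1 else z)) (j %% dim)).

Lemma pattern_fun_rank (f : pattern) (j : 'I_width) : pattern_fun (enum_rank f) j = f j.
Proof. by rewrite /pattern_fun !valK enum_rankK. Qed.

Lemma eq_pattern_ok ic pc fc f g : (forall j, j < width -> f j = g j) ->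
  pattern_ok ic pc fc f = pattern_ok ic pc fc g.
Proof.
move=> fg; rewrite /pattern_ok /decode.
have e z : z < 4 -> [pick a : square | f (z * dim + enum_rank a)] =
                    [pick a : square | g (z * dim + enum_rank a)].
  move=> hz; apply: eq_pick => a /=; apply: fg.
  have := ltn_ord (enum_rank a); rewrite -/dim /width => h.
  by apply: (@leq_trans (z.+1 * dim)); rewrite ?leq_mul2r ?hz ?orbT // mulSn; lia.
have := e 0 isT; have := e 1 isT; have := e 2 isT; have := e 3 isT.
by rewrite mul1n mul0n; do 4 move=> ->.
Qed.

Lemma clause_coords t P k : P < cols - 2 -> k < npat ->
  let c := (t * (cols - 2) + P) * npat + k in
  [/\ clause_row c = t, clause_col c = P & c %% npat = k].
Proof.
move=> hP hk c; have c2 : 0 < cols - 2 by apply: leq_ltn_trans hP.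
have e : c %/ npat = t * (cols - 2) + P.
  by rewrite /c divnMDl ?npat_gt0 // divn_small // addn0.
rewrite /clause_row /clause_col e divnMDl // divn_small // addn0.
by rewrite modnMDl modn_small // /c modnMDl modn_small.
Qed.

(** A clause fails exactly when its window shows its pattern, and the active clauses are those of
    the forbidden patterns. *)
Lemma satisfies_windows asg :
  satisfies nclauses width slot_var slot_pol clause_active asg <->
  forall t P, t < T -> P < cols - 2 ->
    pattern_ok (init_code t P.+1) (pos_code P.+1) (t.+1 == T) (window asg t P).
Proof.
have slotE c j : j < width -> asg (slot_var (c * width + j)) =
    window asg (clause_row c) (clause_col c) j.
  move=> hj; rewrite /slot_var divnMDl ?width_gt0 // divn_small // addn0.
  by rewrite modnMDl (modn_small hj).
have polE c j : j < width -> slot_pol (c * width + j) = ~~ pattern_fun (c %% npat) j.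
  move=> hj; rewrite /slot_pol divnMDl ?width_gt0 // divn_small // addn0.
  by rewrite modnMDl (modn_small hj).
split=> [sat t P hT hP|ok c hc ac].
  apply/negPn/negP => nok.
  pose f : pattern := [ffun j : 'I_width => window asg t P j].
  have [c1 c2 c3] := clause_coords t hP (ltn_ord (enum_rank f)).
  set c := (_ * npat + _) in c1 c2 c3.
  have fE j : j < width -> pattern_fun (c %% npat) j = window asg t P j.
    by move=> hj; rewrite c3 (pattern_fun_rank f (Ordinal hj)) ffunE.
  have hc : c < nclauses.
    rewrite /c /nclauses; apply: (@leq_trans ((t * (cols - 2) + P).+1 * npat)).
      by rewrite mulSn addnC ltn_add2r ltn_ord.
    rewrite leq_mul2r; apply/orP; right; apply: (@leq_trans (t.+1 * (cols - 2))).
      by rewrite mulSn addnC ltn_add2r.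
    by rewrite leq_mul2r hT orbT.
  have ac : clause_active c.
    by rewrite /clause_active c1 c2 (eq_pattern_ok _ _ _ fE).
  have [j hj] := sat c hc ac.
  by rewrite slotE // polE // c1 c2 fE //; case: (window _ _ _ _).
have [/existsP[j /eqP e]|nh] :=
    boolP [exists j : 'I_width, asg (slot_var (c * width + j)) == slot_pol (c * width + j)].
  by exists (nat_of_ord j).
exfalso; move: ac; rewrite /clause_active.
have eqw j : j < width -> pattern_fun (c %% npat) j = window asg (clause_row c) (clause_col c) j.
  move=> hj; move: nh; rewrite negb_exists => /forallP/(_ (Ordinal hj)) /=.
  by rewrite slotE // polE //; case: (window _ _ _ _); case: (pattern_fun _ _).
rewrite (eq_pattern_ok _ _ _ eqw) ok //.
  rewrite /clause_row ltn_divLR; last by rewrite /cols /mid; lia.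
  by rewrite ltn_divLR ?npat_gt0.
by rewrite /clause_col ltn_pmod // /cols /mid; lia.
Qed.

Definition symbol_at (t : seq symb * seq symb) P : symb :=
  if P < mid then nth None t.1 (mid - P.+1) else nth None t.2 (P - mid).

Definition cells (c : config M) P : vec := [ffun i => symbol_at (c.2 i) P].

Lemma pos_codeE P :
  ((pos_code P == 1) = (P.+1 == mid)) * ((pos_code P == 2) = (P == mid)) *
  ((pos_code P == 3) = (P == mid.+1)).
Proof.
rewrite /pos_code; have n_Sn n : (n == n.+1) = false by lia.
case: (P =P mid) => [->|h1]; first by rewrite [mid.+1 == _]eq_sym n_Sn.
case: (P.+1 =P mid) => [e|h2]; first by rewrite (_ : P == mid.+1 = false) //; lia.
by case: (P =P mid.+1).
Qed.

(** Relative to the head, a move to the left shifts the whole tape one column to the right, and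
    conversely; the symbol just written then appears beside the head. *)
Lemma symbol_at_step d a t P : 0 < P ->
  symbol_at (tape_move (M := M) d (tape_write a t)) P =
  match d with
  | MoveLeft => if pos_code P == 3 then a else symbol_at t P.-1
  | Stay => if pos_code P == 2 then a else symbol_at t P
  | MoveRight => if pos_code P == 1 then a else symbol_at t P.+1
  end.
Proof.
case: t => l r; case: P => // P _; rewrite !pos_codeE /symbol_at.
case: d; rewrite /tape_move /tape_write /=.
- have [h|h|h] := ltngtP P.+1 mid.
  + by rewrite eqSS ltn_eqF ?(ltnW h) // nth_behead subnSK.
  + have -> : P.+1 - mid = (P - mid).+1 by lia.
    rewrite /= eqSS; have [->|ne] := eqVneq P mid; first by rewrite subnn.
    rewrite (_ : P - mid = (P - mid.+1).+1); last by lia.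
    by rewrite /= nth_behead.
  + by rewrite h subnn (_ : mid == mid.+1 = false) ?nth0 //; lia.
- have [h|h|h] := ltngtP P.+1 mid => //; last by rewrite h subnn.
  have -> : P.+1 - mid = (P - mid).+1 by lia.
  by rewrite /= nth_behead.
- have [h|h|h] := ltngtP P.+1 mid.
  + have [e|ne] := eqVneq P.+2 mid; first by rewrite -e subnn.
    rewrite ifT; last by lia.
    by rewrite (_ : mid - P.+2 = (mid - P.+3).+1) //; lia.
  + have e1 : (P.+2 == mid) = false by lia.
    have e2 : (P.+2 < mid) = false by lia.
    have e3 : P.+2 - mid = (P.+1 - mid).+1 by lia.
    by rewrite e1 e2 e3 nth_behead.
  + have e1 : (P.+2 == mid) = false by lia.
    have e2 : (P.+2 < mid) = false by lia.
    have e3 : P.+2 - mid = (P.+1 - mid).+1 by lia.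
    by rewrite e1 e2 e3 nth_behead.
Qed.

Definition sq_of (c : config M) (ch : bool) P : square :=
  (c.1, ch, [ffun i => tape_read (c.2 i)], cells c P).

Lemma next_squareP c ch P l m r : 0 < P -> m = sq_of c ch P ->
  sq_cell l = cells c P.-1 -> sq_cell r = cells c P.+1 ->
  next_square (pos_code P) l m r = ((step c ch).1, cells (step c ch) P).
Proof.
move=> P0 -> el er; rewrite /next_square /= /step /verdict.
case: (tm_verdict c.1) => [b|] //.
case: (tm_delta _ _ _) => q' act; congr pair; apply/ffunP => i.
rewrite !ffunE symbol_at_step // el er /cells !ffunE.
by case: (act i).2.
Qed.

Lemma cells_mid c : cells c mid = [ffun i => tape_read (c.2 i)].
Proof. by apply/ffunP => i; rewrite !ffunE /symbol_at ltnn subnn /tape_read -nth0. Qed.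

Lemma cells_init P : cells (init M x) P = initial_cell (init_code 0 P).
Proof.
apply/ffunP => i; rewrite !ffunE /symbol_at /init_code /=.
case: ltnP => [h|h] /=; first by rewrite nth_nil; case: ifP.
have [i0|i0] := eqVneq i ord0; last by rewrite nth_nil.
case: ltnP => h2; last by rewrite nth_default ?size_map //; lia.
rewrite (nth_map false); last by lia.
by case: (nth _ _ _).
Qed.

Definition conf (cs : seq bool) t := run M x (take t cs).

Lemma conf_step cs t : t < size cs -> conf cs t.+1 = step (conf cs t) (nth false cs t).
Proof. by move=> h; rewrite /conf /run (take_nth false) // foldl_rcons. Qed.

Definition dsq asg t P := decode (fun a => asg (var_at t P a)).

Lemma pattern_ok_window asg ic pc fc t P :
  pattern_ok ic pc fc (window asg t P) =
  match dsq asg t P, dsq asg t P.+1, dsq asg t P.+2, dsq asg t.+1 P.+1 with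
  | Some l, Some m, Some r, Some n => local_rule ic pc fc l m r n
  | _, _, _, _ => false
  end.
Proof.
have e z : decode (fun a => window asg t P (z * dim + a)) =
    dsq asg (t + (z == 3)) (P + (if z == 3 then 1 else z)).
  apply: eq_pick => a /=; have h := ltn_ord (enum_rank a); rewrite -/dim in h.
  by rewrite /window divnMDl ?dim_gt0 // divn_small // addn0 modnMDl modn_small.
have := e 0; have := e 1; have := e 2; have := e 3.
rewrite /pattern_ok /= mul0n mul1n !addn0 !addn1 addn2 => -> -> ->.
by rewrite (_ : (fun a : nat => window asg t P (0 + a)) = window asg t P) // => ->.
Qed.

Lemma tableau_sound asg : (forall t P, t < T -> P < cols - 2 ->
    pattern_ok (init_code t P.+1) (pos_code P.+1) (t.+1 == T) (window asg t P)) ->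
  exists2 cs, size cs = T & verdict (run M x cs) = Some true.
Proof.
move=> ok.
pose v t P := odflt (tm_start M, false, [ffun=> None], [ffun=> None]) (dsq asg t P).
have rule t P : t < T -> P < cols - 2 -> local_rule (init_code t P.+1) (pos_code P.+1)
    (t.+1 == T) (v t P) (v t P.+1) (v t P.+2) (v t.+1 P.+1).
  move=> hT hP; have := ok t P hT hP; rewrite pattern_ok_window /v.
  by case: (dsq _ _ _) => // ?; case: (dsq _ _ _) => // ?; case: (dsq _ _ _) => // ?;
     case: (dsq _ _ _).
have ctl t P : t < T -> P < cols -> sq_ctl (v t P) = sq_ctl (v t mid).
  move=> hT; have h0 : forall P, P < cols -> sq_ctl (v t P) = sq_ctl (v t 0).
    elim=> // {}P IH hP; rewrite -IH; last by lia.
    have [hP'|hP'] := ltnP P (cols - 2).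
      by case/and5P: (rule t P hT hP') => /eqP->.
    have hP1 : P.-1 < cols - 2 by rewrite /cols /mid in hP hP' *; lia.
    have P0 : P.-1.+1 = P by rewrite /cols /mid in hP hP' *; lia.
    by case/and5P: (rule t P.-1 hT hP1); rewrite P0 => _ /eqP->.
  by move=> hP; rewrite h0 // h0 // /cols; lia.
(* The guesses are read off the column of the heads. *)
pose cs := mkseq (fun t => (sq_ctl (v t mid)).1.2) T.
have scs : size cs = T by rewrite size_mkseq.
exists cs => //.
(* Correctness is claimed only in a region that loses one column on each side per row; [mid] stays
   inside it up to row [T]. *)
have inv t P : t <= T -> t < P -> P + t < 2 * mid ->
    (sq_ctl (v t P)).1.1 = (conf cs t).1 /\ sq_cell (v t P) = cells (conf cs t) P.
  elim: t P => [|t IH] [|P] // hT h1 h2.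
    have hP : P < cols - 2 by rewrite /cols; lia.
    case/and5P: (rule 0 P T0 hP) => _ _ _ /implyP h _.
    have /h/andP[/eqP-> /eqP->] : init_code 0 P.+1 != 0 by rewrite /init_code /=; case: ifP.
    by rewrite /conf take0 /run /= cells_init.
  have hP : P < cols - 2 by rewrite /cols; lia.
  case/and5P: (rule t P hT hP) => _ _ _ _ /andP[/eqP e _].
  have [il1 il2] := IH P (ltnW hT) (ltac:(lia)) (ltac:(lia)).
  have [im1 im2] := IH P.+1 (ltnW hT) (ltac:(lia)) (ltac:(lia)).
  have [ir1 ir2] := IH P.+2 (ltnW hT) (ltac:(lia)) (ltac:(lia)).
  have [ic1 ic2] := IH mid (ltnW hT) (ltac:(rewrite /mid; lia)) (ltac:(rewrite /mid; lia)).
  have cP : sq_ctl (v t P.+1) = sq_ctl (v t mid) by apply: ctl; rewrite // /cols; lia.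
  have rd : (sq_ctl (v t mid)).2 = cells (conf cs t) mid.
    have hm : mid.-1 < cols - 2 by rewrite /cols /mid; lia.
    case/and5P: (rule t mid.-1 hT hm) => _ _ /implyP h _ _; rewrite -ic2; apply/eqP/h.
    by rewrite !pos_codeE.
  have vE : v t P.+1 = sq_of (conf cs t) (nth false cs t) P.+1.
    rewrite nth_mkseq // /sq_of -cells_mid -rd -im1 -im2 -cP.
    by case: (v t P.+1) => [[[? ?] ?] ?].
  move: e; rewrite (@next_squareP (conf cs t) (nth false cs t)) // conf_step ?scs //.
  by case.
have hm : mid.-1 < cols - 2 by rewrite /cols /mid; lia.
have TT : T.-1 < T by lia.
case/and5P: (rule T.-1 mid.-1 TT hm) => _ _ _ _ /andP[_].
rewrite prednK // eqxx /= => /eqP <-.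
have [-> _] := inv T mid (leqnn _) (ltac:(rewrite /mid; lia)) (ltac:(rewrite /mid; lia)).
by rewrite /conf take_oversize ?scs.
Qed.

Lemma tableau_complete cs : size cs = T -> verdict (run M x cs) = Some true ->
  exists asg, forall t P, t < T -> P < cols - 2 ->
    pattern_ok (init_code t P.+1) (pos_code P.+1) (t.+1 == T) (window asg t P).
Proof.
move=> scs acc.
pose v t P := sq_of (conf cs t) (nth false cs t) P.
pose asg k := k %% dim == enum_rank (v (k %/ dim %/ cols) ((k %/ dim) %% cols)).
have dE t P : P < cols -> dsq asg t P = Some (v t P).
  move=> hP; have c0 : 0 < cols by apply: leq_ltn_trans hP.
  have e (a : square) : asg (var_at t P (enum_rank a)) = (a == v t P).
    have h := ltn_ord (enum_rank a); rewrite -/dim in h.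
    rewrite /asg /var_at modnMDl (modn_small h) divnMDl ?dim_gt0 // (divn_small h) addn0.
    by rewrite divnMDl // (divn_small hP) addn0 modnMDl (modn_small hP) val_eqE (inj_eq enum_rank_inj).
  rewrite /dsq /decode; case: pickP => [a|/(_ (v t P))]; first by rewrite e => /eqP->.
  by rewrite e eqxx.
exists asg => t P hT hP; rewrite pattern_ok_window !dE; try by rewrite /cols in hP *; lia.
rewrite /local_rule /= !eqxx /=; apply/and4P; split.
- by rewrite pos_codeE; apply/implyP => /eqP->; rewrite cells_mid.
- have [t0|t0] := eqVneq t 0; last by rewrite /init_code (negbTE t0).
  by rewrite t0 /conf take0 /run /= cells_init !eqxx implybT.
- by rewrite (@next_squareP (conf cs t) (nth false cs t)) // conf_step ?scs.
- apply/implyP => /eqP e; rewrite e /conf take_oversize ?scs //.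
  by apply/eqP.
Qed.

Theorem tableauP :
  (exists asg, satisfies nclauses width slot_var slot_pol clause_active asg) <->
  exists2 cs, size cs = T & verdict (run M x cs) = Some true.
Proof.
split=> [[asg /satisfies_windows]|[cs scs acc]]; first exact: tableau_sound.
by have [asg h] := tableau_complete scs acc; exists asg; apply/satisfies_windows.
Qed.

Lemma slot_var_lt i : i < nclauses * width -> slot_var i < nvars.
Proof.
move=> hi; rewrite /slot_var /nvars.
set c := i %/ width; set z := i %% width %/ dim.
have hc : c < nclauses by rewrite ltn_divLR ?width_gt0.
have c2 : 0 < cols - 2 by rewrite /cols /mid; lia.
have h1 : clause_row c < T by rewrite /clause_row ltn_divLR // ltn_divLR ?npat_gt0.
have h2 : clause_col c < cols - 2 by rewrite /clause_col ltn_pmod.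
have h3 : z < 4 by rewrite ltn_divLR ?dim_gt0 // -/width ltn_pmod // width_gt0.
have h4 : i %% width %% dim < dim by rewrite ltn_pmod // dim_gt0.
set r := clause_row c + _; set q := clause_col c + _.
have hr : r <= T by rewrite /r; case: (z == 3); lia.
have hq : q < cols.
  by rewrite /q; case: eqP => ?; move: h2 h3; rewrite /cols /mid; lia.
apply: (@leq_trans ((r * cols + q).+1 * dim)); first by rewrite mulSn addnC ltn_add2r.
rewrite leq_mul2r; apply/orP; right; apply: (@leq_trans (r.+1 * cols)).
  by rewrite mulSn addnC ltn_add2r.
by rewrite leq_mul2r ltnS hr orbT.
Qed.

End Grid.
End Tableau.

(** * Trees as parent functions *)

Section Distance.
Variables (W : finType) (T : sgraph W).

Lemma dist_walk x p : path T x p -> dist T x (last x p) <= size p.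
Proof.
move=> h; rewrite /dist leqNgt; apply/negP => lt.
have sz : size p < #|W|.
  by apply: leq_trans lt _; apply: leq_trans (find_size _ _) _; rewrite size_iota.
have := before_find 0 lt; rewrite nth_iota // add0n => /negbT/negP; apply.
by rewrite /is_walk_length; apply/existsP; exists (in_tuple p); rewrite h eqxx.
Qed.

Lemma dist_attained x y : connect T x y ->
  exists p, [/\ path T x p, last x p = y & size p = dist T x y].
Proof.
move=> /connectP[p0 /shortenP[p hp up _] ->] {p0}.
have sz : size p < #|W|.
  by have := card_uniqP up; rewrite /= => <-; apply: max_card.
have : has (is_walk_length T x (last x p)) (iota 0 #|W|).
  apply/hasP; exists (size p); rewrite ?mem_iota //.
  by rewrite /is_walk_length; apply/existsP; exists (in_tuple p); rewrite hp eqxx.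
move=> h; have := nth_find 0 h; rewrite -/(dist T x (last x p)).
rewrite nth_iota ?add0n; last by move: h; rewrite has_find size_iota.
by rewrite {1}/is_walk_length; case/existsP => q /andP[q1 /eqP q2]; exists q; rewrite size_tuple.
Qed.

Lemma dist_le_card x y : dist T x y <= #|W|.
Proof. by apply: leq_trans (find_size _ _) _; rewrite size_iota. Qed.

Lemma dist0 x : dist T x x = 0.
Proof. by apply/eqP; rewrite -leqn0; apply: (@dist_walk x [::]). Qed.

End Distance.

(** * Ancestors and branches of a tree hung from a vertex *)

Section Parents.
Variables (W : finType) (T : sgraph W).
Hypothesis conT : forall x y, connect T x y.
Hypothesis acyT : forall c, ucycle T c -> size c <= 2.

Lemma dist_step x y z : T y z -> dist T x z <= (dist T x y).+1.
Proof.
move=> yz; have [p [p1 p2 <-]] := dist_attained (conT x y).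
have := @dist_walk _ T x (rcons p z); rewrite last_rcons size_rcons; apply.
by rewrite rcons_path p1 p2.
Qed.

Variable z : W.

(** The tree is hung from an arbitrary [z], later a median instead of the root [r]; the default
    value makes [z] a fixed point. *)
Definition par (x : W) : W :=
  odflt x [pick y | T x y && ((dist T z y).+1 == dist T z x)].

Lemma parP x : x != z -> T x (par x) /\ (dist T z (par x)).+1 = dist T z x.
Proof.
move=> xz; rewrite /par; case: pickP => [y /andP[h1 /eqP h2]|] //=.
have [p] := dist_attained (conT z x); case/lastP: p => [|p y].
  by case=> _ /= e _; rewrite e eqxx in xz.
rewrite last_rcons size_rcons rcons_path => -[/andP[p1 p2] yx sz]; subst y.
move/(_ (last z p)); rewrite adj_sym p2 /= => /negbT/negP h; exfalso; apply: h.
by rewrite eqn_leq (dist_step _ p2) andbT -sz ltnS dist_walk.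
Qed.

Lemma par_root : par z = z.
Proof. by rewrite /par; case: pickP => // y; rewrite dist0 andbF. Qed.

(** The edges to parents already connect the tree. Any other edge would close a cycle of more than
    two vertices with a path of such edges. *)
Lemma edge_par x y : T x y -> par x = y \/ par y = x.
Proof.
move=> xy; pose T' : rel W := fun a b => T a b && ((par a == b) || (par b == a)).
have sT' : connect_sym T'.
  by apply: sym_connect_sym => a b; rewrite /T' adj_sym orbC.
have cz a : connect T' a z.
  have [m] := ubnP (dist T z a); elim: m a => // m IH a hm.
  have [->|az] := eqVneq a z; first exact: connect0.
  have [p1 p2] := parP az; apply: connect_trans (IH (par a) _); last by lia.
  by apply: connect1; rewrite /T' p1 eqxx.
have : connect T' x y by apply: connect_trans (cz x) _; rewrite sT'.
case/connectP => p0 /shortenP[p hp up _] yE {p0}.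
have hp' : path T x p by apply: sub_path hp => a b /andP[].
case: p => [|a [|b p]] in hp up yE hp' *.
- by move: xy; rewrite yE adj_irrefl.
- by move: hp; rewrite /= -[a]/(last x [:: a]) -yE /T' andbT => /andP[_ /orP[]/eqP]; auto.
suff /acyT : ucycle T (x :: a :: b :: p) by [].
by rewrite /ucycle up andbT /path.cycle rcons_path hp' -yE adj_sym.
Qed.

Definition desc (x : W) : {set W} := [set y | fconnect par y x].
Definition children (x : W) : {set W} := [set y | (par y == x) && (y != z)].

Lemma fconnect_par y x : fconnect par y x = (y == x) || fconnect par (par y) x.
Proof.
apply/idP/orP => [/iter_findex <-|[/eqP->|h]].
- case: (findex _ _ _) => [|i]; first by left.
  by right; rewrite iterSr fconnect_iter.
- exact: connect0.
- exact: connect_trans (fconnect1 _ _) h.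
Qed.

Lemma mem_desc x : x \in desc x.
Proof. by rewrite inE connect0. Qed.

Lemma desc_root x : x \in desc z.
Proof.
rewrite inE; have [m] := ubnP (dist T z x); elim: m x => // m IH x hm.
have [->|xz] := eqVneq x z; first exact: connect0.
by rewrite fconnect_par IH ?orbT //; have [_ ] := parP xz; lia.
Qed.

Lemma desc_dist x y : y \in desc x -> dist T x y + dist T z x <= dist T z y.
Proof.
rewrite inE; have [m] := ubnP (dist T z y); elim: m y => // m IH y hm.
have [-> _|yx] := eqVneq y x; first by rewrite dist0.
rewrite fconnect_par (negbTE yx) /=.
have [->|yz] := eqVneq y z.
  by rewrite par_root => /iter_findex <-; rewrite iter_fix ?par_root // dist0.
have [p1 p2] := parP yz => h.
have {}h : dist T x (par y) + dist T z x <= dist T z (par y) by apply: IH => //; lia.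
have : dist T x y <= (dist T x (par y)).+1 by apply: dist_step; rewrite adj_sym.
lia.
Qed.

Lemma childP x c : c \in children x -> [/\ par c = x, T x c & dist T z c = (dist T z x).+1].
Proof.
rewrite inE => /andP[/eqP e cz]; have [p1 p2] := parP cz.
by rewrite e in p1 p2; rewrite adj_sym p1 p2.
Qed.

Lemma desc_split x y : (y \in desc x) = (y == x) || [exists c in children x, y \in desc c].
Proof.
apply/idP/orP => [|[/eqP->|/exists_inP[c /childP[e _ _]]]]; last 2 first.
- exact: mem_desc.
- rewrite !inE => h; apply: connect_trans h _; rewrite -e; exact: fconnect1.
rewrite inE; have [m] := ubnP (dist T z y); elim: m y => // m IH y hm.
have [->|yx] := eqVneq y x; first by left.
rewrite fconnect_par (negbTE yx) /= => h; right; apply/exists_inP.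
have yz : y != z.
  apply: contra yx => /eqP yz; move: h; rewrite yz par_root => /iter_findex <-.
  by rewrite iter_fix ?par_root.
have [p1 p2] := parP yz.
have [] := IH (par y) _ h; first by lia.
  by move=> /eqP e; exists y; rewrite ?mem_desc // inE e eqxx.
case/exists_inP => c c1 c2; exists c => //.
by move: c2; rewrite !inE => c2; rewrite fconnect_par c2 orbT.
Qed.

(** The ancestors of [y] form a chain, so one of two such children would lie above the other,
    against their equal depth. *)
Lemma desc_children_disjoint x c1 c2 y : c1 \in children x -> c2 \in children x ->
  y \in desc c1 -> y \in desc c2 -> c1 = c2.
Proof.
wlog le : c1 c2 / findex par y c1 <= findex par y c2.
  by move=> h; case/orP: (leq_total (findex par y c1) (findex par y c2)) => l a b c d;
     [|symmetry]; apply: h.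
move=> /childP[e1 _ d1] /childP[e2 _ d2]; rewrite !inE => /iter_findex i1 /iter_findex i2.
move: le; rewrite leq_eqVlt => /orP[/eqP e|lt]; first by rewrite -i1 -i2 e.
have h : c1 \in desc c2 -> c1 = c2.
  have [->//|ne] := eqVneq c1 c2; rewrite inE fconnect_par (negbTE ne) /= e1 => h.
  have := @desc_dist c2 x; rewrite inE => /(_ h); lia.
by apply: h; rewrite inE -i1 -{1}i2 -(subnK (ltnW lt)) iterD fconnect_iter.
Qed.

Lemma children_root_notin x : x != z -> par x \notin children x.
Proof.
move=> xz; apply/negP => /childP[_ _]; have [_ ] := parP xz; lia.
Qed.

Lemma degree_children x : degree T x = #|children x| + (x != z).
Proof.
rewrite /degree; have [->|xz] := eqVneq x z.
  rewrite addn0; congr #|pred_of_set _|; apply/setP => y; rewrite !inE.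
  apply/idP/andP => [zy|[/eqP e yz]]; last by rewrite adj_sym -e; case: (parP yz).
  have yz : y != z by apply: contraTneq zy => ->; rewrite adj_irrefl.
  by case: (edge_par zy) => // [|->//]; rewrite par_root => e; rewrite e eqxx in yz.
have := cardsU1 (par x) (children x); rewrite (children_root_notin xz) addnC => <-.
congr #|pred_of_set _|; apply/setP => y; rewrite !inE.
have [p1 p2] := parP xz.
apply/idP/orP => [xy|[/eqP->//|/andP[/eqP e yz]]]; last first.
  by rewrite adj_sym -e; case: (parP yz).
case: (edge_par xy) => [->|e]; [by left|right]; rewrite e eqxx /=.
by apply: contraNneq xz => yz; rewrite -e yz par_root.
Qed.

(** The only edge that leaves the branch of [y] leads to [z]. *)
Lemma desc_avoid y a b : y \in children z -> a \in desc y ->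
  connect (fun a b => [&& T a b, a != z & b != z]) a b -> b \in desc y.
Proof.
move=> yz ay /connectP[p hp ->] {b}; elim: p a ay hp => //= b p IH a ay.
case/andP => /and3P[ab az bz]; apply: IH.
case: (edge_par ab) => e; last by move: ay; rewrite !inE => h; rewrite fconnect_par e h orbT.
move: ay; rewrite !inE fconnect_par e => /orP[/eqP ay|//].
by case/negP: bz; rewrite -e ay; case: (childP yz) => ->.
Qed.

(** A vertex [x] other than [z] stands for the edge above it; the edges counted are those whose
    removal separates [u] from [v]. *)
Definition sepn (u v : W) : nat :=
  #|[set x | (x != z) && ((u \in desc x) != (v \in desc x))]|.

Lemma sepn_le u v : sepn u v <= dist T u v.
Proof.
have [p [h <- <-]] := dist_attained (conT u v); elim: p u h => [|a p IH] u /=.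
  rewrite /sepn leqn0 cards_eq0 => _; apply/eqP/setP => x.
  by rewrite !inE eqxx andbF.
case/andP => ua /IH h; apply: (@leq_trans (sepn u a + sepn a (last a p))).
  rewrite /sepn -cardsUI; apply: leq_trans (leq_addr _ _).
  apply: subset_leq_card; apply/subsetP => x.
  by rewrite !inE => /andP[-> /=]; do 3 case: (connect _ _ x).
rewrite -add1n leq_add // /sepn.
wlog e : u a ua {h} / par u = a.
  move=> hw; case: (edge_par ua) => e; first exact: hw.
  have au : T a u by rewrite adj_sym.
  apply: leq_trans (hw _ _ au e); apply/eq_leq/eq_card => x.
  by rewrite !inE; congr (_ && ~~ _); rewrite eq_sym.
rewrite -(cards1 u); apply: subset_leq_card; apply/subsetP => x.
rewrite !inE => /andP[xz]; rewrite (fconnect_par u) e; case: (eqVneq u x) => //= _.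
by rewrite eqxx.
Qed.

End Parents.

Section MinimalLayouts.
Import Order.TTheory GRing.Theory Num.Theory.

(** * Supporting lines of the minimal leaf distance sum *)

Section Lines.
Variables (n k : nat).
Hypothesis nk : n = 3 * 2 ^ k.

Local Open Scope ring_scope.

Definition pw (i : nat) : int := (2 ^ i)%N%:Z.
Definition unit_cost (i : nat) : int := i.+1%:Z * n%:Z - 2 * pw i + 1.

(* [pw i * unit_cost i] is the cost of a complete subtree with [2 ^ i] leaves,
   root edge included; [line i] interpolates this cost between the sizes
   [2 ^ i] and [2 ^ i.+1]. *)
Definition line (i : nat) (s : int) : int :=
  pw i * unit_cost i + (unit_cost i + 2 * (n%:Z - 2 * pw i)) * (s - pw i).

Lemma pwS i : pw i.+1 = 2 * pw i.
Proof. by rewrite /pw expnS PoszM. Qed.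

(** Consecutive lines cross at [2 ^ i.+1]. As [n = 3 * 2 ^ k], the factor [n - 6 * 2 ^ i] is
    nonnegative for [i < k], so the lines up to [k] are the supporting lines of a convex function;
    it vanishes at [i = k - 1], where two lines coincide. *)
Lemma line_step i s :
  line i.+1 s - line i s = (n%:Z - 6 * pw i) * (s - 2 * pw i).
Proof. by rewrite /line /unit_cost pwS -[i.+2]addn1 PoszD; ring. Qed.

(** Joining two subtrees on line [i] and paying for the edge above leads to line [i.+1], with an
    excess that is nonnegative for sizes from [2 ^ i.+1] to [2 ^ i.+2]. *)
Lemma line_merge i a b :
  line i a + line i b + (a + b) * (n%:Z - (a + b)) =
  line i.+1 (a + b) + (a + b - 2 * pw i) * (4 * pw i - (a + b)).
Proof. by rewrite /line /unit_cost pwS -[i.+2]addn1 PoszD; ring. Qed.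

Lemma pw_gt0 i : 0 < pw i.
Proof. by rewrite /pw ltz_nat expn_gt0. Qed.

Lemma pw_le i j : (i <= j)%N -> pw i <= pw j.
Proof. by move=> ij; rewrite /pw lez_nat leq_pexp2l. Qed.

Lemma n_pw : n%:Z = 3 * pw k.
Proof. by rewrite nk PoszM. Qed.

Lemma line_up i j s : (i <= j <= k)%N -> pw j <= s -> line i s <= line j s.
Proof.
case/andP => ij jk js; rewrite -(subnKC ij) in jk js *.
elim: (j - i)%N jk js => [|d IH]; rewrite ?addn0 // addnS => jk js.
have h1 := pwS (i + d); have h2 := pw_gt0 (i + d).
apply: le_trans (IH _ _) _; [by lia|by lia|].
rewrite -subr_ge0 line_step mulr_ge0 //; last by lia.
have := pw_le jk; rewrite n_pw; lia.
Qed.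

Lemma line_down i j s : (i <= j <= k)%N -> s <= 2 * pw i -> line j s <= line i s.
Proof.
case/andP => ij jk js; rewrite -(subnKC ij) in jk *.
elim: (j - i)%N jk => [|d IH]; rewrite ?addn0 // addnS => jk.
have h1 := pwS (i + d); have h2 := pw_le (leq_addr d i).
apply: le_trans (IH _); last by lia.
rewrite -subr_le0 line_step mulr_ge0_le0 //; last by lia.
have := pw_le jk; rewrite n_pw; lia.
Qed.

(** The height of a balanced subtree with [s] leaves, the edge above it included, capped at [k.+1].
    It is the factor with which the volume of [H] enters the bound. *)
Definition level (s : nat) : nat := (minn (up_log 2 s) k).+1.

Lemma level_le a b : (a <= b)%N -> (level a <= level b)%N.
Proof.
move=> ab; rewrite /level ltnS leq_min geq_minr andbT.
exact: leq_trans (geq_minl _ _) (leq_up_log _ ab).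
Qed.

(** Costs are [ta], [tb], volumes [ha], [hb]. Usually a child can be charged one level less than the
    whole, which pays for the new edge; where it cannot, the geometry of the lines yields at least
    the missing volume, thanks to [ha + hb < 2 ^ k]. The volume on the left leaves room to replace
    [s * (n - s)] by the true cut. *)
Lemma merge_bound (a b ta tb ha hb : nat) :
  (0 < a)%N -> (0 < b)%N -> (2 * (a + b) <= n)%N -> (ha + hb < 2 ^ k)%N ->
  (forall i, (i <= k)%N -> line i a%:Z <= (ta + level a * ha)%N%:Z) ->
  (forall i, (i <= k)%N -> line i b%:Z <= (tb + level b * hb)%N%:Z) ->
  forall i, (i <= k)%N -> line i (a + b)%N%:Z + (ha + hb)%N%:Z <=
    ((a + b) * (n - (a + b)) + ta + tb + level (a + b) * (ha + hb))%N%:Z.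
Proof.
move=> a0 b0 sn hk ia ib.
have s1 : (1 < a + b)%N by lia.
have [lo hi] := andP (up_log_bounds (isT : (1 < 2)%N) s1).
have u0 : (0 < up_log 2 (a + b))%N by rewrite up_log_gt0.
set s := (a + b)%N in lo hi s1 sn u0 *.
have sE : s%:Z = a%:Z + b%:Z by rewrite /s PoszD.
have mulE : (s * (n - s))%N%:Z = s%:Z * (n%:Z - s%:Z).
  by rewrite PoszM -subzn //; lia.
(* It suffices to treat the line that is highest at [s]. *)
have key q : (q <= k)%N -> (pw q <= s%:Z) -> (s%:Z <= 2 * pw q) || (q == k) ->
   line q s%:Z + (ha + hb)%N%:Z <= (s * (n - s) + ta + tb + level s * (ha + hb))%N%:Z ->
   forall i, (i <= k)%N -> line i s%:Z + (ha + hb)%N%:Z <=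
    (s * (n - s) + ta + tb + level s * (ha + hb))%N%:Z.
  move=> qk q1 q2 h i ik; apply: le_trans h; rewrite lerD2r.
  have [iq|qi] := leqP i q; first by apply: line_up; rewrite ?iq.
  by case/orP: q2 => [q2|/eqP q2]; [apply: line_down; rewrite ?ik ?(ltnW qi)|lia].
have child c tc hc q : (c <= s)%N -> (hc < 2 ^ k)%N -> (q < k)%N -> (level s = q.+3)%N ->
   (forall i, (i <= k)%N -> line i c%:Z <= (tc + level c * hc)%N%:Z) ->
   line q c%:Z <= (tc + q.+2 * hc)%N%:Z.
  move=> cs hck qk ls ic; have lc := level_le cs.
  have [c1|c1] := leqP c (2 ^ q.+1).
    apply: le_trans (ic q (ltnW qk)) _; rewrite lez_nat leq_add2l leq_mul2r.
    apply/orP; right; rewrite /level ltnS.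
    by apply: leq_trans (geq_minl _ _) _; rewrite up_log_min.
  have st := line_step q c%:Z.
  have c2 : 2 * pw q + 1 <= c%:Z by rewrite -pwS /pw; lia.
  have qk1 : (q.+1 < k)%N.
    have := geq_minr (up_log 2 s) k; move: ls; rewrite /level.
    by move: (minn _ _) => mn; clear; lia.
  have := pw_le qk1; rewrite !pwS => pk.
  (* The child is too large for the lower level. But there line [q.+1] exceeds line [q] by at least
     [2 ^ k], more than the volume that one level costs. *)
  have d : pw k <= (n%:Z - 6 * pw q) * (c%:Z - 2 * pw q).
    have p0 := pw_gt0 q.
    have h1 : pw k <= n%:Z - 6 * pw q by rewrite n_pw; lia.
    apply: le_trans h1 _; rewrite -{1}[n%:Z - _]mulr1 ler_wpM2l //; last by lia.
    by rewrite n_pw; lia.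
  have hck' : hc%:Z < pw k by rewrite /pw; lia.
  have := ic q.+1 qk; have : (level c * hc <= q.+3 * hc)%N by rewrite leq_mul2r -ls lc orbT.
  lia.
have pos0 q := pw_gt0 q.
have [sk|sk] := leqP (up_log 2 s) k.
  have ls : level s = (up_log 2 s).+1 by rewrite /level (minn_idPl sk).
  case eu : (up_log 2 s) u0 => [//|[|q]] _.
    have s2 : s = 2 by move: hi; rewrite eu; lia.
    have [ea eb] : a = 1%N /\ b = 1%N by move: s2 a0 b0; rewrite /s; lia.
    apply: (key 0%N) => //; rewrite ?s2 //.
    have l1 : level 1 = 1%N by rewrite /level up_log1 min0n.
    have := ia 0%N isT; have := ib 0%N isT; rewrite ea eb l1.
    have := line_merge 0 1%N%:Z 1%N%:Z; have := line_step 0 2%N%:Z; rewrite /pw expn0.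
    have k0 : (0 < k)%N by move: sk; rewrite eu.
    have ls2 : level 2 = 2 by move: ls; rewrite eu s2.
    rewrite ls2 -[1%N%:Z + 1%N%:Z]/(2%N%:Z); move: sn; rewrite s2; clear -a0.
    move: (line 0 _) (line 1 _) (line 0 1%N%:Z) => x y w; lia.
  have qk : (q < k)%N by lia.
  apply: (key q.+1); first by lia.
  - by rewrite /pw lez_nat ltnW // -[q.+1]/(q.+2.-1) -eu.
  - by rewrite -pwS /pw lez_nat -eu hi.
  have lsq : level s = q.+3 by rewrite ls eu.
  have ca := child a ta ha q (leq_addr _ _) (leq_ltn_trans (leq_addr _ _) hk) qk lsq ia.
  have cb := child b tb hb q (leq_addl _ _) (leq_ltn_trans (leq_addl _ _) hk) qk lsq ib.
  have := line_merge q a b; rewrite -sE.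
  have : 0 <= (s%:Z - 2 * pw q) * (4 * pw q - s%:Z).
    have h1 : 2 * pw q <= s%:Z.
      by rewrite -pwS /pw lez_nat ltnW // -[q.+1]/(q.+2.-1) -eu.
    have h2 : s%:Z <= 4 * pw q.
      have -> : 4 * pw q = pw q.+2 by rewrite !pwS; lia.
      by rewrite /pw lez_nat -eu hi.
    by rewrite mulr_ge0 // subr_ge0.
  rewrite lsq; move: mulE ca cb; clear; rewrite !PoszD => -> ca cb h1 h2.
  move: ca cb; rewrite !PoszM; lia.
have ls : level s = k.+1 by rewrite /level (minn_idPr (ltnW sk)).
have sk2 : (2 ^ k < s)%N.
  by rewrite ltnNge; apply/negP => h; have := up_log_min (isT : (1 < 2)%N) h; lia.
have [k' kE] : {k' | k = k'.+1}.
  by move: sn sk2; rewrite nk; case: (k) => [|k'] h1 h2; [exfalso; lia|exists k'].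
apply: (key k) => //; [by rewrite /pw lez_nat ltnW|by rewrite eqxx orbT|].
have cc c tc hc : (c <= s)%N ->
   (forall i, (i <= k)%N -> line i c%:Z <= (tc + level c * hc)%N%:Z) ->
   line k' c%:Z <= (tc + k.+1 * hc)%N%:Z.
  move=> cs ic; apply: le_trans (ic k' _) _; first by lia.
  by rewrite lez_nat leq_add2l leq_mul2r -ls level_le ?orbT.
have ca := cc a ta ha (leq_addr _ _) ia.
have cb := cc b tb hb (leq_addl _ _) ib.
have := line_merge k' a b; rewrite -sE -kE.
have e2 : pw k = 2 * pw k' by rewrite kE pwS.
(* Above [2 ^ k] the level is capped and the children are not charged less. The excess of the merge
   is smallest at [s = 2 ^ k + 1], and its value there, [2 ^ k - 1], covers the whole volume. *)
have : pw k - 1 <= (s%:Z - 2 * pw k') * (4 * pw k' - s%:Z).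
  have h1 : pw k + 1 <= s%:Z by rewrite /pw; lia.
  have h2 : 2 * s%:Z <= 3 * pw k by rewrite -n_pw; lia.
  have -> : (s%:Z - 2 * pw k') * (4 * pw k' - s%:Z) =
     pw k - 1 + (s%:Z - pw k - 1) * (2 * pw k - 1 - s%:Z) by rewrite e2; ring.
  rewrite lerDl mulr_ge0 //; last by have := pos0 k; have := pos0 k'; lia.
  by lia.
have : (ha + hb)%N%:Z <= pw k - 1 by rewrite /pw; lia.
rewrite ls; move: mulE ca cb; clear; rewrite !PoszD => -> ca cb h1 h2 h3.
move: ca cb; rewrite !PoszM; lia.
Qed.

End Lines.

(** * Cuts and volumes *)

Section Cuts.
Variables (n : nat).
Implicit Types (R : rel 'I_n) (S : {set 'I_n}).

Definition cut R S : nat := \sum_(u in S) \sum_(v in ~: S) R u v.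
Definition vol R S : nat := \sum_(u in S) \sum_v R u v.

Lemma cut_vol R S : cut R S <= vol R S.
Proof.
apply: leq_sum => u _; rewrite [X in _ <= X](bigID (mem (~: S))) /=.
exact: leq_addr.
Qed.

Lemma vol_le R S : vol R S <= vol R setT.
Proof.
rewrite /vol big_mkcond [X in _ <= X]big_mkcond; apply: leq_sum => u _.
by rewrite inE; case: ifP.
Qed.

Lemma vol_eq_cut R S u v : cut R S = vol R S -> u \in S -> v \in S -> ~~ R u v.
Proof.
move=> e uS vS; apply/negP => Ruv; move/eqP: e; apply/negP; rewrite neq_ltn.
apply/orP; left; rewrite /cut /vol (bigD1 u) // [X in _ < X](bigD1 u) //=.
rewrite -addSn leq_add //; last first.
  apply: leq_sum => w _; rewrite [X in _ <= X](bigID (mem (~: S))) /=.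
  exact: leq_addr.
rewrite [X in _ < X](bigID (mem (~: S))) /= -[X in X < _]addn0 ltn_add2l.
by rewrite (bigD1 v) ?inE ?vS //= Ruv.
Qed.

Lemma cut_compl R R' S : irreflexive R' -> (forall u v, R u v = (u != v) && ~~ R' u v) ->
  cut R S + cut R' S = #|S| * (n - #|S|).
Proof.
move=> irr RE; rewrite /cut -big_split /=.
rewrite (eq_bigr (fun=> n - #|S|)); first by rewrite sum_nat_const.
move=> u uS; rewrite -big_split /= (eq_bigr (fun=> 1)).
  by rewrite sum1_card cardsCs setCK card_ord.
move=> v; rewrite inE RE => vS.
have -> : u != v by apply: contraNneq vS => <-.
by case: (R' u v).
Qed.

Lemma sum_sym (G : sgraph 'I_n) (F : 'I_n -> 'I_n -> nat) : (forall u v, F u v = F v u) ->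
  \sum_u \sum_v G u v * F u v = 2 * \sum_(u < n) \sum_(v < n | (u < v) && G u v) F u v.
Proof.
move=> sF; pose A := \sum_(u < n) \sum_(v < n) (u < v) * (G u v * F u v).
have eA : \sum_(u < n) \sum_(v < n | (u < v) && G u v) F u v = A.
  apply: eq_bigr => u _; rewrite big_mkcond; apply: eq_bigr => v _.
  by case: (u < v); case: (G u v); rewrite ?mul1n ?mul0n.
rewrite eA mul2n -addnn {2}/A [X in _ + X]exchange_big /= -big_split; apply: eq_bigr => u _.
rewrite -big_split; apply: eq_bigr => v _ /=.
rewrite [G v u]adj_sym [F v u]sF -mulnDl.
case: (ltngtP u v) => [||/val_inj->]; rewrite ?adj_irrefl ?addn0 ?add0n ?mul1n ?mul0n /= ?addn0 ?add0n ?mul1n //.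
Qed.

End Cuts.

(** * The lower bound on the length of a layout *)

Section LowerBound.
Variables (n k : nat) (H : rel 'I_n) (G : sgraph 'I_n).
Hypothesis nk : n = 3 * 2 ^ k.
Hypotheses (Hirr : irreflexive H) (GE : forall u v, G u v = (u != v) && ~~ H u v).
Hypothesis volH : vol H setT < 2 ^ k.

Variables (W : finType) (T : sgraph W) (r : W) (phi : 'I_n -> W).
Hypothesis lay : layout T r phi.

Let conT : forall x y, connect T x y. Proof. by case: lay => -[[]]. Qed.
Let acyT : forall c, ucycle T c -> size c <= 2. Proof. by case: lay => -[[]]. Qed.
Let degr : degree T r = 2. Proof. by case: lay => -[]. Qed.
Let phi_inj : injective phi. Proof. by case: lay. Qed.
Let n3 : 3 <= n. Proof. by rewrite nk; have := expn_gt0 2 k; lia. Qed.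

Let deg_phi u : degree T (phi u) = 1.
Proof.
have [_ _ e] := lay; have : phi u \in leaves T by rewrite -e imset_f ?inE.
by rewrite inE => /eqP.
Qed.

Let leafP x : degree T x = 1 -> exists u, x = phi u.
Proof.
move=> dx; have [_ _ e] := lay.
have : x \in leaves T by rewrite inE dx.
by rewrite -e => /imsetP[u _ ->]; exists u.
Qed.

Let deg3 x : x != r -> degree T x != 1 -> degree T x = 3.
Proof. by move=> xr d1; case: lay => -[_ _ h] _ _; apply: h; rewrite ?inE. Qed.

Section Center.
Variable z : W.

Local Notation desc := (desc T z).
Local Notation children := (children T z).
Definition cluster (x : W) : {set 'I_n} := [set u | phi u \in desc x].

(** The map [g] is [phi] for sums over vertices of the graph and the identity for sums over vertices
    of the tree. *)
Lemma sum_desc (J : finType) (g : J -> W) (F : J -> nat) x :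
  \sum_(j | g j \in desc x) F j =
  \sum_(j | g j == x) F j + \sum_(c in children x) \sum_(j | g j \in desc c) F j.
Proof.
have ind y : (y \in desc x : nat) = (y == x) + \sum_(c in children x) (y \in desc c).
  rewrite (desc_split conT); have [->|yx] /= := eqVneq y x.
    rewrite big1 // => c /(childP conT)[_ _ d].
    by case: (boolP (x \in desc c)) => // /(desc_dist conT); rewrite d; lia.
  rewrite add0n; case: (boolP [exists _ in _, _]) => [/exists_inP[c cx yc]|].
    rewrite (bigD1 c) //= yc big1 // => c' /andP[c'x ne].
    case: (boolP (y \in desc c')) => // yc'.
    by rewrite (desc_children_disjoint conT c'x cx yc' yc) eqxx in ne.
  rewrite negb_exists_in => /forall_inP h; rewrite big1 // => c cx.
  by rewrite (negbTE (h _ cx)).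
have mk (P : pred J) : \sum_(j | P j) F j = \sum_j P j * F j.
  by rewrite big_mkcond; apply: eq_bigr => j _; case: (P j); rewrite ?mul1n.
rewrite !mk (eq_bigr _ (fun c _ => mk (fun j => g j \in desc c))) exchange_big -big_split.
by apply: eq_bigr => j _ /=; rewrite ind mulnDl big_distrl.
Qed.

Lemma cluster_split (F : 'I_n -> nat) x :
  \sum_(u in cluster x) F u =
  \sum_(u | phi u == x) F u + \sum_(c in children x) \sum_(u in cluster c) F u.
Proof.
have e y : \sum_(u in cluster y) F u = \sum_(u | phi u \in desc y) F u.
  by apply: eq_bigl => u; rewrite inE.
by rewrite e sum_desc; congr (_ + _); apply: eq_bigr => c _; rewrite e.
Qed.

Lemma sum_phi (F : 'I_n -> nat) x : degree T x != 1 -> \sum_(u | phi u == x) F u = 0.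
Proof. by move=> dx; rewrite big_pred0 // => u; apply: contraNF dx => /eqP<-; rewrite deg_phi. Qed.

(** Seen from another vertex, the root [r] has one child, and both edges at it make the same cut.
    Omitting the edge above [r] hides the subdivision from the recursion; [total_cut] accounts for
    that edge separately. *)
Definition Tot (x : W) : nat := \sum_(y in desc x | y != r) cut G (cluster y).

Lemma Tot_split x :
  Tot x = (if x != r then cut G (cluster x) else 0) + \sum_(c in children x) Tot c.
Proof.
have e y : Tot y = \sum_(w | w \in desc y) (if w != r then cut G (cluster w) else 0).
  by rewrite /Tot big_mkcondr.
rewrite e (@sum_desc _ id) big_pred1_eq; congr (_ + _).
by apply: eq_bigr => c _; rewrite e.
Qed.

Lemma card_cluster x : #|cluster x| = \sum_(u in cluster x) 1.
Proof. by rewrite sum1_card. Qed.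

Lemma subtree_bound x : x != z -> 2 * #|cluster x| <= n ->
  0 < #|cluster x| /\ forall i, i <= k ->
  (line n i #|cluster x|%:Z + (vol H (cluster x))%:Z <=
   (Tot x + cut H (cluster x) + level k #|cluster x| * vol H (cluster x))%N%:Z)%R.
Proof.
have [m] := ubnP (#|W| - dist T z x); elim: m x => // m IH x hm xz xn.
have dc := degree_children conT acyT z x; rewrite xz addn1 in dc.
have IHc c : c \in children x -> #|cluster c| <= #|cluster x| ->
    0 < #|cluster c| /\ forall i, i <= k ->
    (line n i #|cluster c|%:Z + (vol H (cluster c))%:Z <=
     (Tot c + cut H (cluster c) + level k #|cluster c| * vol H (cluster c))%N%:Z)%R.
  move=> /(childP conT)[_ _ dE] cx; apply: IH.
  - by have := dist_le_card T z c; lia.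
  - by apply/eqP => cz; move: dE; rewrite cz dist0.
  - by lia.
have sub c : c \in children x -> #|cluster c| <= #|cluster x|.
  by move=> cx; rewrite (card_cluster x) cluster_split (bigD1 c) //= -card_cluster addnCA leq_addr.
have [d1|d1] := eqVneq (degree T x) 1.
  have [u xE] := leafP d1.
  have c0 : children x = set0 by apply: cards0_eq; lia.
  have cl F : \sum_(v in cluster x) F v = F u.
    rewrite cluster_split c0 big_set0 addn0 (big_pred1 u) // => v.
    by rewrite xE (inj_eq phi_inj).
  have cE : #|cluster x| = 1 by rewrite card_cluster cl.
  rewrite cE; split=> // i ik.
  have xr : x != r by apply: contra_eq_neq d1 => ->; rewrite degr.
  have -> : Tot x = cut G (cluster x) by rewrite Tot_split c0 big_set0 xr addn0.
  have := cut_compl (cluster x) Hirr GE; rewrite cE => ->.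
  have -> : level k 1 = 1 by rewrite /level up_log1 min0n.
  apply: (@le_trans _ _ (line n 0 1%N%:Z + (vol H (cluster x))%:Z)%R).
    rewrite lerD2r; apply: (line_down nk); rewrite ?ik //.
  by rewrite /line /unit_cost /pw expn0; lia.
(* The subdividing root has the cluster and the total of its only child. *)
have [xr|xr] := eqVneq x r.
  have : #|children x| == 1 by rewrite xr degr in dc *; apply/eqP; lia.
  case/cards1P => c cE.
  have cl F : \sum_(v in cluster x) F v = \sum_(v in cluster c) F v.
    by rewrite cluster_split sum_phi // cE big_set1.
  have TE : Tot x = Tot c by rewrite Tot_split xr eqxx /= -xr cE big_set1.
  have clE : cluster x = cluster c.
    apply/setP => u; have := cl (fun v => v == u).
    have ind S : \sum_(v in S) (v == u) = (u \in S).
      rewrite big_mkcond (bigD1 u) //= eqxx big1 ?addn0; first by case: (u \in S).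
      by move=> v /negbTE ->; case: ifP.
    by rewrite !ind; case: (u \in _); case: (u \in _).
  by rewrite TE clE; apply: IHc; rewrite ?cE ?inE // clE.
have d3 := deg3 xr d1.
have : #|children x| == 2 by apply/eqP; lia.
case/cards2P => a [b [ab cE]].
have ax : a \in children x by rewrite cE !inE eqxx.
have bx : b \in children x by rewrite cE !inE eqxx orbT.
have cl F : \sum_(v in cluster x) F v = \sum_(v in cluster a) F v + \sum_(v in cluster b) F v.
  by rewrite cluster_split sum_phi // cE big_setU1 ?inE // big_set1.
have [a0 Ia] := IHc a ax (sub a ax); have [b0 Ib] := IHc b bx (sub b bx).
have cxE : #|cluster x| = #|cluster a| + #|cluster b|.
  by rewrite !card_cluster cl.
have vE : vol H (cluster x) = vol H (cluster a) + vol H (cluster b) by rewrite /vol cl.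
have TE : Tot x = cut G (cluster x) + (Tot a + Tot b).
  by rewrite Tot_split xr cE big_setU1 ?inE // big_set1.
split; first by rewrite cxE; lia.
have cc := cut_compl (cluster x) Hirr GE.
have vx : vol H (cluster a) + vol H (cluster b) < 2 ^ k.
  by rewrite -vE; apply: leq_ltn_trans volH; apply: vol_le.
have mg := @merge_bound n k nk #|cluster a| #|cluster b| (Tot a) (Tot b)
  (vol H (cluster a)) (vol H (cluster b)) a0 b0.
move=> i ik; rewrite vE cxE TE in cc *.
have {}mg := mg _ vx _ _ i ik.
have wk c : (forall i, i <= k ->
    (line n i #|cluster c|%:Z + (vol H (cluster c))%:Z <=
     (Tot c + cut H (cluster c) + level k #|cluster c| * vol H (cluster c))%N%:Z)%R) ->
   forall i, i <= k -> (line n i #|cluster c|%:Z <=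
     (Tot c + level k #|cluster c| * vol H (cluster c))%N%:Z)%R.
  by move=> h j jk; have := h j jk; have := cut_vol H (cluster c); lia.
apply: le_trans (mg _ (wk _ Ia) (wk _ Ib)) _; first by rewrite -cxE.
by rewrite lez_nat -cc; lia.
Qed.

(** Double counting of the pairs formed by an edge of the tree and an edge of [G] across it;
    [sepn_le] turns the count into a bound. *)
Lemma total_cut :
  \sum_(c in children z) Tot c + (if z != r then cut G (cluster r) else 0) <= layout_length G T phi.
Proof.
have -> : \sum_(c in children z) Tot c + (if z != r then cut G (cluster r) else 0) =
    \sum_(x | x != z) cut G (cluster x).
  have := Tot_split z; rewrite /Tot.
  rewrite (eq_bigl (fun y => y != r)); last by move=> y; rewrite (desc_root conT).
  have [->|zr] := eqVneq z r; first by rewrite add0n addn0 => ->.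
  have rz : r != z by rewrite eq_sym.
  rewrite (bigD1 z) //= => /addnI <-.
  rewrite [RHS](bigD1 r) //= addnC; congr (_ + _).
  by apply: eq_bigl => y; rewrite andbC.
rewrite -leq_double -!mul2n /layout_length.
have sD u v : sepn T z (phi u) (phi v) = sepn T z (phi v) (phi u).
  by apply: eq_card => x; rewrite !inE; congr (_ && ~~ _); rewrite eq_sym.
apply: (@leq_trans (2 * \sum_(u < n) \sum_(v < n | (u < v) && G u v) sepn T z (phi u) (phi v))); last first.
  by rewrite leq_mul2l /=; apply: leq_sum => u _; apply: leq_sum => v _; apply: sepn_le.
rewrite -(sum_sym G sD).
have sE u v : sepn T z (phi u) (phi v) =
   \sum_(x | x != z) ((u \in cluster x) != (v \in cluster x)).
  rewrite /sepn -sum1_card big_mkcond [RHS]big_mkcond; apply: eq_bigr => x _.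
  by rewrite !inE; case: (x != z) => //=; case: (_ != _).
have {sE} -> : \sum_u \sum_v G u v * sepn T z (phi u) (phi v) =
   \sum_(x | x != z) \sum_u \sum_v G u v * ((u \in cluster x) != (v \in cluster x)).
  rewrite [RHS]exchange_big; apply: eq_bigr => u _.
  rewrite [RHS]exchange_big; apply: eq_bigr => v _.
  by rewrite sE big_distrr.
rewrite big_distrr /=; apply: leq_sum => x _; set S := cluster x.
have -> : \sum_u \sum_v G u v * ((u \in S) != (v \in S)) =
   \sum_u \sum_v ((u \in S) && (v \notin S)) * G u v +
   \sum_u \sum_v ((v \in S) && (u \notin S)) * G u v.
  rewrite -big_split; apply: eq_bigr => u _; rewrite -big_split; apply: eq_bigr => v _ /=.
  by case: (u \in S); case: (v \in S); rewrite ?muln0 ?muln1 ?mul1n ?mul0n ?addn0.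
rewrite [X in _ + X]exchange_big /= mul2n -addnn.
have cE : cut G S = \sum_u \sum_v ((u \in S) && (v \notin S)) * G u v.
  rewrite /cut big_mkcond; apply: eq_bigr => u _; case: (u \in S); last by rewrite big1.
  rewrite big_mkcond; apply: eq_bigr => v _; rewrite inE.
  by case: (v \in S); rewrite ?mul1n.
rewrite leq_add // cE //.
by apply: leq_sum => u _; apply: leq_sum => v _; rewrite [G v u]adj_sym.
Qed.

(** A step from [z] to [y] brings the leaves below [y] closer by one and takes each other leaf at
    most one further away. *)
Lemma median_child y : (forall x, \sum_u dist T z (phi u) <= \sum_u dist T x (phi u)) ->
  y \in children z ->
  2 * #|cluster y| <= n /\
  \sum_u dist T y (phi u) + 2 * #|cluster y| <= \sum_u dist T z (phi u) + n.
Proof.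
move=> zmin yz.
suff h : \sum_u dist T y (phi u) + 2 * #|cluster y| <= \sum_u dist T z (phi u) + n.
  by split=> //; have := zmin y; lia.
have [_ zy d1] := childP conT yz; rewrite dist0 in d1.
rewrite card_cluster big_distrr /= [\sum_(i in cluster y) _]big_mkcond -big_split.
rewrite -[X in _ <= _ + X]card_ord -sum1_card -big_split.
apply: leq_sum => u _ /=; rewrite inE.
case: ifP => [/(desc_dist conT)|_]; first by rewrite d1; lia.
have [p [p1 p2 p3]] := dist_attained (conT z (phi u)).
have := @dist_walk _ T y (z :: p); rewrite /= p2 p1 andbT adj_sym zy p3; lia.
Qed.

End Center.

Lemma cluster_root z : cluster z z = setT.
Proof. by apply/setP => u; rewrite !inE; have := desc_root conT z (phi u); rewrite inE. Qed.

Lemma sum_children z (F : 'I_n -> nat) : degree T z != 1 ->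
  \sum_(c in children T z z) \sum_(u in cluster z c) F u = \sum_(u in setT) F u.
Proof. by move=> dz; rewrite -(cluster_root z) [RHS]cluster_split sum_phi. Qed.

Lemma sum_card_children z : degree T z != 1 -> \sum_(c in children T z z) #|cluster z c| = n.
Proof.
move=> /(sum_children (fun=> 1)); rewrite sum1_card cardsT card_ord => e.
by apply: etrans e; apply: eq_bigr => c _; rewrite card_cluster.
Qed.

(** A leaf is no median, since the other [n - 1] leaves lie on one side. If the root is a median,
    its two branches hold half of the leaves each, so its child [a] is a median too. *)
Lemma median_exists : exists z, [/\ z != r, degree T z = 3 &
  forall y, y \in children T z z -> 2 * #|cluster z y| <= n].
Proof.
pose f x := \sum_u dist T x (phi u).
have med z : (forall x, f z <= f x) -> degree T z != 1 ->
    z != r -> exists z, [/\ z != r, degree T z = 3 &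
    forall y, y \in children T z z -> 2 * #|cluster z y| <= n].
  move=> zmin d1 zr; exists z; split=> //; first exact: deg3.
  by move=> y yz; case: (median_child zmin yz).
have nl z : (forall x, f z <= f x) -> degree T z != 1.
  move=> zmin; apply/eqP => d1; have [u zE] := leafP d1.
  have := degree_children conT acyT z z; rewrite d1 eqxx addn0 => /esym/eqP/cards1P[c cE].
  have := cluster_split z (fun=> 1) z.
  rewrite [X in _ = X + _](big_pred1 u) => [|v]; last by rewrite /= zE (inj_eq phi_inj).
  rewrite cE big_set1 -!card_cluster.
  rewrite cluster_root cardsT card_ord.
  by have [|] := median_child zmin (y := c); [rewrite cE inE|lia].
have [z _ zmin] : exists2 z, z \in W & forall x, f z <= f x.
  by case: (arg_minnP f (isT : xpredT r)) => z _ h; exists z => // x; apply: h.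
have [zr|zr] := eqVneq z r; last exact: (med z zmin (nl z zmin)).
have : #|children T z z| == 2.
  by have := degree_children conT acyT z z; rewrite eqxx addn0 {1}zr degr => <-.
case/cards2P => a [b [ab cE]].
have az : a \in children T z z by rewrite cE !inE eqxx.
have bz : b \in children T z z by rewrite cE !inE eqxx orbT.
have := sum_card_children (nl z zmin); rewrite cE big_setU1 ?inE // big_set1 => sE.
have {}sE : #|cluster z a| + #|cluster z b| = n := sE.
have [a1 a2] := median_child zmin az; have [b1 b2] := median_child zmin bz.
have amin x : f a <= f x.
  apply: leq_trans (zmin x); move: a2 b1 sE; rewrite -!/(f _).
  by move: (f a) (f z) => fa fz; clear; lia.
apply: (med a amin (nl a amin)).
apply: contraTneq az => ->; rewrite -zr; apply/negP => /(childP conT)[_ + _].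
by rewrite adj_irrefl.
Qed.

Lemma layout_separated (d : nat) :
  (forall u, \sum_v H u v <= d) ->
  ((layout_length G T phi)%:Z <=
    3 * (pw k * unit_cost n k) - k.+1%:Z * (vol H setT)%:Z + n%:Z - 1 - d%:Z)%R ->
  exists z, forall u v, H u v ->
    ~~ connect (fun a b => [&& T a b, a != z & b != z]) (phi u) (phi v).
Proof.
move=> hd small; have [z [zr dz bal]] := median_exists; exists z.
have dz1 : degree T z != 1 by rewrite dz.
have tc := total_cut z; rewrite zr in tc.
have ch3 : #|children T z z| = 3.
  by have := degree_children conT acyT z z; rewrite eqxx addn0 dz.
(* A cluster of one vertex cuts [n - 1] minus its degree in [H]. A larger one cuts at least
   [2 * (n - 2)] minus a volume below [2 ^ k = n / 3], which is at least [n - 1]. *)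
have root_cut : (n%:Z - 1 - d%:Z <= (cut G (cluster z r))%:Z)%R.
  have rz : r != z by rewrite eq_sym.
  have [c cz c0] : exists2 c, c \in children T z z & r \in desc T z c.
    have := desc_root conT z r; rewrite (desc_split conT) (negbTE rz) /=.
    by case/exists_inP => c; exists c.
  have sub : cluster z r \subset cluster z c.
    apply/subsetP => u; rewrite !inE => h; apply: connect_trans h _.
    by move: c0; rewrite inE.
  have rn : 2 * #|cluster z r| <= n.
    by apply: leq_trans (bal c cz); rewrite leq_mul2l subset_leq_card.
  have [r0 _] := subtree_bound rz rn.
  have cc := cut_compl (cluster z r) Hirr GE; have cv := cut_vol H (cluster z r).
  have [r1|r1] := leqP #|cluster z r| 1.
    have /cards1P[u uE] : #|cluster z r| == 1 by rewrite eqn_leq r1.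
    move: cc cv (hd u); rewrite /vol uE big_set1 cards1; clear -n3; lia.
  have vk := leq_ltn_trans (vol_le H (cluster z r)) volH.
  have : 2 * (n - 2) <= #|cluster z r| * (n - #|cluster z r|) by clear -r1 rn; nia.
  move: cc cv vk nk n3; move: (#|_| * _) (cut G _) (cut H _) (vol H _) (2 ^ k) => x1 x2 x3 x4 x5.
  clear; lia.
have F3 : (3 * (pw k * unit_cost n k) + (vol H setT)%:Z <=
    (\sum_(c in children T z z) Tot z c + \sum_(c in children T z z) cut H (cluster z c)
     + k.+1 * vol H setT)%N%:Z)%R.
  have -> : vol H setT = \sum_(c in children T z z) vol H (cluster z c).
    by rewrite /vol sum_children.
  rewrite big_distrr -!big_split /= !(big_morph Posz PoszD (erefl _)).
  (* [line k] is affine and the three sizes add up to [3 * 2 ^ k], so the sum is independent of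
     their distribution. *)
  have -> : (3 * (pw k * unit_cost n k) = \sum_(c in children T z z) line n k #|cluster z c|%:Z)%R.
    rewrite /line big_split /= sumr_const ch3 -mulr_sumr sumrB sumr_const ch3.
    have -> : (\sum_(i in children T z z) #|cluster z i|%:Z = 3 * pw k)%R.
      have := big_morph Posz PoszD (erefl _) => sumZ.
      by rewrite -(n_pw nk) -[in RHS](sum_card_children dz1) sumZ.
    by move: (unit_cost n k) (pw k) (2 * _)%R => x1 x2 x3; clear; ring.
  rewrite -big_split; apply: ler_sum => c cz /=.
  have cnz : c != z by apply: contraTneq cz => ->; rewrite inE eqxx andbF.
  have [_ /(_ k (leqnn k))] := subtree_bound cnz (bal c cz).
  move/le_trans; apply; rewrite lez_nat leq_add2l leq_mul2r ltnS geq_minr orbT //.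
(* [F3], [root_cut] and [small] together force the cuts of the branches to add up to at least
   [vol H setT], so each must equal its volume. *)
have full c : c \in children T z z -> cut H (cluster z c) = vol H (cluster z c).
  move=> cz; apply/eqP; rewrite eqn_leq cut_vol leqNgt; apply/negP => lt.
  have : \sum_(c in children T z z) cut H (cluster z c) < vol H setT.
    have -> : vol H setT = \sum_(c in children T z z) vol H (cluster z c).
      by rewrite /vol sum_children.
    rewrite (bigD1 c) //= [X in _ < X](bigD1 c) //= -addSn leq_add //.
    by apply: leq_sum => ? _; apply: cut_vol.
  by move: F3 tc small root_cut; rewrite !PoszD PoszM; clear; lia.
move=> u v Huv; apply/negP => con.
have uz : phi u != z by apply: contra_eq_neq dz => <-; rewrite deg_phi.
have := desc_root conT z (phi u); rewrite (desc_split conT) (negbTE uz) /=.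
case/exists_inP => c cz uc; have vc := desc_avoid conT acyT cz uc con.
by have := vol_eq_cut (u := u) (v := v) (full c cz); rewrite !inE in uc vc *; rewrite uc vc Huv => /(_ isT isT).
Qed.

End LowerBound.

(** * The balanced layout that attains the bound *)

Lemma extend_injection (I : finType) (A : {set I}) (f : I -> I) :
  {in A &, injective f} -> exists g : {perm I}, {in A, g =1 f}.
Proof.
have [m] := ubnP #|A|; elim: m A => // m IH A hm fi.
have [->|[a aA]] := set_0Vmem A; first by exists 1%g => x; rewrite inE.
have [||g hg] := IH (A :\ a).
- by move: hm; rewrite (cardsD1 a A) aA.
- by move=> x y /setD1P[_ xA] /setD1P[_ yA]; apply: fi.
(* The transposition corrects the value at [a]; since [f] is injective on [A], it fixes the values
   at the other points of [A]. *)
exists (g * tperm (g a) (f a))%g => x xA; rewrite permM.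
have [->|xa] := eqVneq x a; first by rewrite tpermL.
have xA' : x \in A :\ a by rewrite !inE xa.
rewrite tpermD; first exact: hg.
  by rewrite (inj_eq perm_inj) eq_sym.
by rewrite (hg _ xA'); apply: contra xa => /eqP/fi->.
Qed.

Section DistanceSym.
Variables (W : finType) (T : sgraph W).
Hypothesis conT : forall x y, connect T x y.

Lemma dist_sym_le x y : dist T y x <= dist T x y.
Proof.
have [p [p1 p2 <-]] := dist_attained (conT x y).
have := @dist_walk _ T (last x p) (rev (belast x p)).
rewrite rev_path (eq_path (e' := T)) => [|a b]; last by rewrite adj_sym.
move/(_ p1); rewrite size_rev size_belast p2; congr (dist _ _ _ <= _).
by case: p p1 p2 => //= a p _ _; rewrite rev_cons last_rcons.
Qed.

Lemma dist_triangle x y w : dist T x w <= dist T x y + dist T y w.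
Proof.
have [p [p1 p2 <-]] := dist_attained (conT x y).
have [q [q1 <- <-]] := dist_attained (conT y w).
by rewrite -size_cat -p2 -last_cat; apply: dist_walk; rewrite cat_path p1 p2.
Qed.

Lemma dist_edge x y : T x y -> dist T x y <= 1.
Proof. by move=> xy; apply: (@dist_walk _ T x [:: y]); rewrite /= xy. Qed.

End DistanceSym.

Section ParentTree.
Variables (W : finType) (z : W) (pr : W -> W) (dep : W -> nat).
Hypothesis dep_pr : forall x, x != z -> dep (pr x) < dep x.

Definition parent_edge (x y : W) : bool :=
  (x != z) && (pr x == y) || (y != z) && (pr y == x).

Lemma parent_edge_sym : symmetric parent_edge.
Proof. by move=> x y; rewrite /parent_edge orbC. Qed.

Lemma parent_edge_irrefl : irreflexive parent_edge.
Proof.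
move=> x; rewrite /parent_edge orbb; apply/negbTE/negP => /andP[/dep_pr + /eqP e].
by rewrite e ltnn.
Qed.

Definition parent_tree : sgraph W := SGraph parent_edge_sym parent_edge_irrefl.

Lemma parent_tree_connected x y : connect parent_tree x y.
Proof.
have cz a : connect parent_tree a z.
  have [m] := ubnP (dep a); elim: m a => // m IH a hm.
  have [->|az] := eqVneq a z; first exact: connect0.
  have := dep_pr az; move=> da.
  apply: connect_trans (IH (pr a) _); last by lia.
  by apply: connect1; rewrite /= /parent_edge az eqxx.
by apply: connect_trans (cz x) _; rewrite (sym_connect_sym parent_edge_sym).
Qed.

(* Both neighbours of a deepest vertex of a cycle would be its parent. *)
Lemma parent_tree_is_tree : is_tree parent_tree.
Proof.
split=> [|c]; first exact: parent_tree_connected.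
rewrite /ucycle => /andP[cyc un]; rewrite leqNgt; apply/negP => sz.
have [x0 x0c] : {x0 | x0 \in c} by case: c sz {cyc un} => // a c _; exists a; rewrite inE eqxx.
case: (@arg_maxnP _ x0 (mem c) dep x0c) => x /= xc xmax.
have up y : y \in c -> parent_edge x y -> y = pr x.
  move=> yc /orP[/andP[_ /eqP->//]|/andP[yz /eqP e]].
  by have := xmax y yc; have := dep_pr yz; rewrite e; lia.
have [i s cE] := rot_to xc.
have cyc' : path.cycle parent_tree (x :: s) by rewrite -cE rot_cycle.
have un' : uniq (x :: s) by rewrite -cE rot_uniq.
have sz' : 2 < size (x :: s) by rewrite -cE size_rot.
have inc y : y \in s -> y \in c by move=> ys; rewrite -(mem_rot i) cE inE ys orbT.
case: s cyc' un' sz' inc {cE} => [|a s] //; case: (lastP s) => // {}s b.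
rewrite /path.cycle /= rcons_path last_rcons => /and3P[xa _ bx] un' _ inc.
have ea : a = pr x by apply: up => //; apply: inc; rewrite inE eqxx.
have eb : b = pr x.
  by apply: up; [apply: inc; rewrite inE mem_rcons inE eqxx orbT|rewrite parent_edge_sym].
by move: un'; rewrite ea eb mem_rcons !inE eqxx andbF.
Qed.

Lemma parent_tree_degree x :
  degree parent_tree x = #|[set y | (y != z) && (pr y == x)]| + (x != z).
Proof.
rewrite /degree; have [->|xz] /= := eqVneq x z.
  rewrite addn0; apply: eq_card => y; rewrite !inE /= /parent_edge eqxx.
  by [].
have pn : pr x \notin [set y | (y != z) && (pr y == x)].
  rewrite inE; apply/negP => /andP[h /eqP e].
  by have := dep_pr h; have := dep_pr xz; rewrite e; lia.
have := cardsU1 (pr x) [set y | (y != z) && (pr y == x)]; rewrite pn addnC => <-.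
by apply: eq_card => y; rewrite !inE /= /parent_edge xz eq_sym.
Qed.

End ParentTree.

Ltac iflia := repeat match goal with |- context [if ?b then _ else _] =>
  lazymatch b with context [if _ then _ else _] => fail | _ => case: (boolP b) => ? end
  end; lia.

Lemma count_block b c n : 0 < b -> c.+1 * b <= n ->
  \sum_(v < n) (c != v %/ b) = n - b.
Proof.
move=> b0 cn.
have eb : \sum_(v < n) (v %/ b == c) = b.
  rewrite -(big_mkord xpredT (fun v => nat_of_bool (v %/ b == c))).
  rewrite (big_cat_nat _ (n := c.+1 * b)) //= (big_cat_nat _ (n := c * b)) ?leq_mul2r ?leqnSn ?orbT //=.
  rewrite big_nat big1 => [|v /andP[_ hv]]; last first.
    by apply/eqP; rewrite eqb0 ltn_eqF // ltn_divLR.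
  rewrite big_nat (eq_bigr (fun=> 1)) => [|v /andP[v1 v2]]; last first.
    by apply/eqP; rewrite eqb1 eqn_leq -ltnS ltn_divLR // v2 leq_divRL // v1.
  rewrite -big_nat sum_nat_const_nat muln1 mulSn addnK add0n.
  rewrite big_nat big1 ?addn0 // => v /andP[v1 _].
  by apply/eqP; rewrite eqb0 gtn_eqF // leq_divRL // mulSn.
have e : \sum_(v < n) (c != v %/ b) + \sum_(v < n) (v %/ b == c) = n.
  rewrite -big_split -[RHS]card_ord -sum1_card; apply: eq_bigr => v _ /=.
  by rewrite eq_sym; case: (_ == _).
by rewrite -[X in X - _]e eb addnK.
Qed.

Section UpperBound.
Variables (n k h : nat) (H : rel 'I_n) (G : sgraph 'I_n) (v0 : 'I_n).
Hypotheses (nk : n = 3 * 2 ^ k) (k0 : 0 < k) (hk : h <= 2 ^ k).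
Hypothesis GE : forall u v, G u v = (u != v) && ~~ H u v.
Hypotheses (Hirr : irreflexive H) (Hsym : symmetric H).
Variable col : 'I_n -> nat.
Hypothesis col3 : forall u, col u < 3.
Hypothesis proper : forall u v, H u v -> col u != col v.
Hypothesis Hh : forall u v, H u v -> u < h.

Let n6 : 6 <= n. Proof. by rewrite nk -(prednK k0) expnS; have := expn_gt0 2 k.-1; lia. Qed.

(** The quotient by [2 ^ k] is the number of the branch. A vertex [u < h] of colour [c] takes
    position [c * 2 ^ k + u], in branch [c] because [h <= 2 ^ k]; the remaining vertices, isolated
    in [H], fill the other positions. *)
Lemma positions : exists pos : {perm 'I_n}, forall u v, H u v -> pos u %/ 2 ^ k != pos v %/ 2 ^ k.
Proof.
have bnd (u : 'I_n) : u < h -> col u * 2 ^ k + u < n.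
  move=> uh; apply: (@leq_trans (3 * 2 ^ k)); last by rewrite -nk.
  by have := col3 u; nia.
have n1 : n.-1.+1 = n by lia.
pose f (u : 'I_n) : 'I_n := cast_ord n1 (inord (col u * 2 ^ k + u)).
have fE (u : 'I_n) : u < h -> f u = col u * 2 ^ k + u :> nat.
  by move=> /bnd l; rewrite /= inordK // n1.
have fd (u : 'I_n) : u < h -> f u %/ 2 ^ k = col u.
  move=> uh; rewrite fE // divnMDl ?expn_gt0 // divn_small ?addn0 //; lia.
have fi : {in [set u : 'I_n | u < h] &, injective f}.
  move=> u v; rewrite !inE => uh vh e; apply/val_inj => /=.
  have ec : col u = col v by rewrite -(fd u uh) -(fd v vh) e.
  by have := fE u uh; rewrite e fE // ec => /addnI.
have [pos hp] := extend_injection fi.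
exists pos => u v huv; have uh := Hh huv; have vh : v < h by apply: (@Hh v u); rewrite Hsym.
by rewrite !hp ?inE // !fd //; apply: proper.
Qed.

Variable pos : {perm 'I_n}.
Hypothesis pos_sep : forall u v, H u v -> pos u %/ 2 ^ k != pos v %/ 2 ^ k.

(* Vertex codes: 2 is the centre, the children of [j >= 3] are [2j] and
   [2j + 1] (those of the centre are 3, 4, 5), the leaves are [n .. 2n - 1]; the
   root [2n] subdivides the pendant edge of the leaf [j0]. *)
Let j0 := n + pos v0.
Definition half (j : nat) := if j < 6 then 2 else j./2.
Definition up (j : nat) :=
  if j == 2 * n then half j0 else if j == j0 then 2 * n else half j.

Let m := (2 * n).-2.
Definition node := 'I_m.+1.
Definition code (x : node) : nat := x.+2.
Definition mk (j : nat) : node := inord (j - 2).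

Lemma codeK x : mk (code x) = x.
Proof. by rewrite /mk /code subn2 /= inord_val. Qed.
Lemma mkK j : 2 <= j <= 2 * n -> code (mk j) = j.
Proof. by move=> hj; rewrite /code /mk inordK /m; lia. Qed.
Lemma code_bounds x : 2 <= code x <= 2 * n.
Proof. by have := ltn_ord x; rewrite /code /m; lia. Qed.
Lemma code_inj : injective code.
Proof. exact: can_inj codeK. Qed.

Let j0_bounds : n <= j0 < 2 * n.
Proof. by have := ltn_ord (pos v0); rewrite /j0; lia. Qed.

Lemma half_bounds j : 2 < j -> 2 <= half j < j.
Proof. by rewrite /half; case: ifP; lia. Qed.

Lemma up_bounds j : 2 < j <= 2 * n -> 2 <= up j <= 2 * n.
Proof.
rewrite /up => hj; case: eqP => _.
  by have := @half_bounds j0; lia.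
by case: eqP => _; have := @half_bounds j; lia.
Qed.

Definition up_node (x : node) : node := mk (up (code x)).
Definition centre : node := mk 2.
(** Any measure that decreases towards the centre will do. Codes decrease except from [j0] to its
    parent, the root [2 * n]; doubling makes room to place the root just below [j0]. *)
Definition depth (x : node) : nat :=
  if code x == 2 * n then 2 * j0 - 1 else 2 * code x.

Lemma code_centre : code centre = 2. Proof. by rewrite mkK //; lia. Qed.

Lemma centreP x : (x != centre) = (2 < code x).
Proof. by rewrite -(inj_eq code_inj) code_centre; have := code_bounds x; lia. Qed.

Lemma code_up x : x != centre -> code (up_node x) = up (code x).
Proof. by rewrite centreP => hx; rewrite mkK // up_bounds // hx; case/andP: (code_bounds x). Qed.

Lemma depth_up x : x != centre -> depth (up_node x) < depth x.
Proof.
move=> xc; have := code_up xc; rewrite /depth => ->; move: xc; rewrite centreP /up => xc.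
have h0 := @half_bounds j0; have hx := half_bounds xc; have hb := code_bounds x.
have [e|ne] := eqVneq (code x) (2 * n); first by rewrite ifF; lia.
have [e|ne'] := eqVneq (code x) j0 => /=; first by rewrite eqxx; lia.
by rewrite ifF; lia.
Qed.

Definition best : sgraph node := parent_tree depth_up.
Definition root : node := mk (2 * n).
Definition leaf (u : 'I_n) : node := mk (n + pos u).

Let code_root : code root = 2 * n. Proof. by rewrite mkK //; lia. Qed.
Let code_leaf u : code (leaf u) = n + pos u.
Proof. by rewrite mkK //; have := ltn_ord (pos u); lia. Qed.

Lemma best_degree x : degree best x =
  if code x == 2 * n then 2 else if n <= code x then 1 else 3.
Proof.
rewrite /best (parent_tree_degree depth_up) centreP.
have chE y : (y != centre) && (up_node y == x) = (2 < code y) && (up (code y) == code x).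
  rewrite centreP -(inj_eq code_inj (up_node y)).
    by case: (ltnP 2 (code y)) => // y2; rewrite code_up // centreP.
have set_of (s : seq nat) : uniq s -> all (fun j => 2 < j <= 2 * n) s ->
    (forall j, 2 < j <= 2 * n -> (up j == code x) = (j \in s)) ->
    #|[set y | (y != centre) && (up_node y == x)]| = size s.
  move=> us sb sE; rewrite -(size_map mk s).
  have um : uniq (map mk s).
    rewrite map_inj_in_uniq // => i j /(allP sb) hi /(allP sb) hj e.
    by rewrite -[i]mkK -1?[j]mkK ?e //; lia.
  rewrite -(card_uniqP um); apply: eq_card => y; rewrite inE chE.
  have hy := code_bounds y; apply/andP/mapP => [[y2 e]|[j js ->]].
    by exists (code y); rewrite ?codeK // -sE // y2; case/andP: hy.
  have hj := allP sb _ js; rewrite mkK; last by lia.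
  by rewrite sE // js; case/andP: hj.
have hx := code_bounds x; have h0 := j0_bounds.
(* Where the leaf [j0] would be a child, the subdividing root takes its place. *)
pose sg j := if j == j0 then 2 * n else j.
case: eqP => [e|ne].
  rewrite (set_of [:: j0]) /=; [by rewrite e; lia|by []|by lia|].
  by move=> j hj; rewrite inE e /up /half; iflia.
case: (leqP n (code x)) => xn.
  rewrite (set_of [::]) //=; first by lia.
  by move=> j hj; rewrite in_nil /up /half; iflia.
have [e|x2] := eqVneq (code x) 2.
  rewrite (set_of [:: sg 3; sg 4; sg 5]) /=; first by rewrite e.
  - by rewrite !inE /sg; iflia.
  - by rewrite /sg; iflia.
  by move=> j hj; rewrite !inE e /up /half /sg; iflia.
rewrite (set_of [:: sg (2 * code x); sg (2 * code x).+1]) /=; first by lia.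
- by rewrite !inE /sg; iflia.
- by rewrite /sg; iflia.
by move=> j hj; rewrite !inE /up /half /sg; iflia.
Qed.

Lemma best_layout : layout best root leaf.
Proof.
have li : injective leaf.
  by move=> u v /(congr1 code); rewrite !code_leaf => /addnI/val_inj/perm_inj.
split=> //.
- split; first exact: parent_tree_is_tree.
    by rewrite best_degree code_root eqxx.
  move=> x xr; rewrite inE best_degree -(inj_eq code_inj) code_root in xr *.
  by rewrite (negbTE xr); case: ifP.
apply/setP => x; rewrite inE best_degree; apply/imsetP/idP => [[u _ ->]|].
  by rewrite code_leaf leq_addr ifF //; have := ltn_ord (pos u); lia.
have [//|ne] := eqVneq (code x) (2 * n).
have [xn _|//] := leqP n (code x).
have lt : code x - n < n by have := code_bounds x; lia.
exists (pos^-1 (Ordinal lt))%g => //; apply: code_inj.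
by rewrite code_leaf permKV /= subnKC.
Qed.

Let conB := parent_tree_connected depth_up.

Lemma best_up x : x != centre -> dist best x (up_node x) <= 1.
Proof. by move=> xc; apply: dist_edge; rewrite /= /parent_edge xc eqxx. Qed.

(** The ancestor of a leaf at height [q] when the subdividing root is skipped: the codes of that
    height start at [3 * 2 ^ (k - q)] and follow the order of the positions. *)
Definition anc q (u : 'I_n) : node := mk (3 * 2 ^ (k - q) + pos u %/ 2 ^ q).

Lemma code_anc q u : q <= k -> code (anc q u) = 3 * 2 ^ (k - q) + pos u %/ 2 ^ q.
Proof.
move=> qk; rewrite mkK //; have p0 : 0 < 2 ^ (k - q) by rewrite expn_gt0.
have : pos u %/ 2 ^ q < 3 * 2 ^ (k - q).
  by rewrite ltn_divLR ?expn_gt0 // -mulnA -expnD subnK // -nk.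
have : 2 ^ (k - q) <= 2 ^ k by rewrite leq_exp2l // leq_subr.
by move: nk p0; move: (2 ^ (k - q)) (2 ^ k) (_ %/ _) => a b c; clear; lia.
Qed.

Lemma anc_lt q u : q <= k -> pos u %/ 2 ^ q < 3 * 2 ^ (k - q).
Proof. by move=> qk; rewrite ltn_divLR ?expn_gt0 // -mulnA -expnD subnK // -nk. Qed.

(** Only the step above the leaf of [v0] is longer, as it passes the root. *)
Lemma dist_anc q u : q < k -> dist best (anc q u) (anc q.+1 u) <= 1 + ((q == 0) && (u == v0)).
Proof.
move=> qk.
have qk' := ltnW qk.
have e1 : 2 ^ (k - q) = 2 * 2 ^ (k - q.+1) by rewrite -expnS -subSn // subSS.
have cq := code_anc u qk'.
have p0 : 0 < 2 ^ (k - q.+1) by rewrite expn_gt0.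
have hf : half (code (anc q u)) = code (anc q.+1 u).
  rewrite cq code_anc // /half e1 expnSr divnMA divn2; move: (_ %/ _) p0 => a; clear => p0.
  by rewrite ifF; lia.
have lt := anc_lt u qk'.
have c2 : anc q u != centre.
  by rewrite centreP cq e1; apply: leq_trans (leq_addr _ _); move: p0; clear; lia.
have le2 : 2 ^ (k - q) <= 2 ^ k by rewrite leq_exp2l // leq_subr.
have ne : code (anc q u) != 2 * n.
  by rewrite cq; move: lt le2 nk; move: (_ %/ _) (2 ^ (k - q)) (2 ^ k) => a b c; clear -n6; lia.
case: (boolP ((q == 0) && (u == v0))) => [/andP[/eqP q0 /eqP uv]|nb].
  have e0 : code (anc q u) = j0 by rewrite cq q0 subn0 divn1 uv -nk.
  have r2 : root != centre by rewrite centreP code_root; lia.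
  have -> : anc q.+1 u = up_node root.
    by apply: code_inj; rewrite code_up // code_root /up eqxx -hf e0.
  apply: leq_trans (dist_triangle conB _ root _) _; rewrite leq_add ?best_up //.
  have -> : root = up_node (anc q u); last exact: best_up.
  apply: code_inj; rewrite code_up // code_root /up (negbTE ne) e0 eqxx //.
have -> : anc q.+1 u = up_node (anc q u); last exact: best_up.
apply: code_inj; rewrite code_up // /up (negbTE ne) hf ifF //.
apply/negbTE; apply: contra nb => /eqP e0.
have q0 : q = 0.
  case: (q) qk cq lt e0 => // q' q'k -> lt'; rewrite /j0.
  have : 2 * 2 ^ (k - q'.+1) <= 2 ^ k by rewrite -expnS leq_exp2l //; lia.
  by lia.
move: e0; rewrite cq q0 eqxx subn0 divn1 -nk => /addnI/val_inj/perm_inj->.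
by rewrite eqxx.
Qed.

(** Both ends climb until they meet, at the latest in the centre: two edges for each height at which
    the ancestors differ, and one more if an end is the leaf of [v0]. *)
Lemma dist_anc_pair q u v : q <= k -> u != v ->
  dist best (anc q u) (anc q v) <=
  2 * \sum_(q <= i < k.+1) (pos u %/ 2 ^ i != pos v %/ 2 ^ i) +
  (q == 0) * ((u == v0) != (v == v0)).
Proof.
move=> qk uv; have [d dE] : {d | k = q + d} by exists (k - q); lia.
elim: d q dE qk => [|d IH] q dE qk.
  rewrite big_ltn ?ltnS // big_geq ?addn0; last by lia.
  have [e|ne] := eqVneq.
    by rewrite /anc e dist0.
  rewrite muln1; apply: leq_trans (leq_addr _ _).
  have up_c w : up_node (anc q w) = centre.
    have cw := code_anc w qk; have lt := anc_lt w qk.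
    move: cw lt; rewrite (_ : k - q = 0); last by lia.
    rewrite expn0 muln1 => cw lt; apply: code_inj.
    have c2 : anc q w != centre by rewrite centreP cw.
    rewrite code_up // code_centre /up /half cw; move: (_ %/ _) lt => a lt.
    by move: n6 j0_bounds; clear -lt; iflia.
  have nc w : anc q w != centre.
    have p0 : 0 < 2 ^ (k - q) by rewrite expn_gt0.
    by rewrite centreP code_anc //; apply: leq_trans (leq_addr _ _); move: p0; clear; lia.
  apply: leq_trans (dist_triangle conB _ centre _) _; rewrite -[2]/(1 + 1) leq_add //.
    by have := best_up (nc u); rewrite up_c.
  by apply: leq_trans (dist_sym_le conB _ _) _; have := best_up (nc v); rewrite up_c.
rewrite big_ltn; last by lia.
have [e|ne] := eqVneq (pos u %/ 2 ^ q) (pos v %/ 2 ^ q).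
  by rewrite /anc e dist0.
have {}IH := IH q.+1; have qk1 : q < k by lia.
apply: leq_trans (dist_triangle conB _ (anc q.+1 u) _) _.
apply: leq_trans (leq_add (dist_anc u qk1) (dist_triangle conB _ (anc q.+1 v) _)) _.
have dv : dist best (anc q.+1 v) (anc q v) <= 1 + ((q == 0) && (v == v0)).
  by apply: leq_trans (dist_sym_le conB _ _) _; apply: dist_anc.
have {}IH : dist best (anc q.+1 u) (anc q.+1 v) <=
   2 * \sum_(q.+1 <= i < k.+1) (pos u %/ 2 ^ i != pos v %/ 2 ^ i).
  by apply: leq_trans (IH _ _) _; rewrite ?addn0 //; lia.
have : ((q == 0) && (u == v0)) + ((q == 0) && (v == v0)) <= (q == 0) * ((u == v0) != (v == v0)).
  case: (q == 0) => //=; rewrite mul1n.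
  case: (eqVneq u v0) => [e1|_]; case: (eqVneq v v0) => [e2|_] //=.
  by move: uv; rewrite e1 e2 eqxx.
move: dv IH; rewrite /= mulnDr muln1.
move: (\sum_(_ <= _ < _) _) (nat_of_bool ((q == 0) && (u == v0)))
  (nat_of_bool ((q == 0) && (v == v0))) ((q == 0) * _) (dist _ _ _) (dist _ _ _) => S a b c d1 d2.
by clear; lia.
Qed.

Definition apart (u v : 'I_n) : nat :=
  2 * \sum_(0 <= i < k.+1) (pos u %/ 2 ^ i != pos v %/ 2 ^ i) + ((u == v0) != (v == v0)).

Lemma dist_apart u v : dist best (leaf u) (leaf v) <= apart u v.
Proof.
have lE w : leaf w = anc 0 w by rewrite /anc subn0 divn1 -nk.
have [->|uv] := eqVneq u v; first by rewrite dist0.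
by rewrite !lE; apply: leq_trans (dist_anc_pair _ uv) _; rewrite // mul1n.
Qed.

(** At height [i] each vertex differs from the [n - 2 ^ i] vertices of the other blocks, and
    [2 * (n - 1)] ordered pairs contain [v0] exactly once. *)
Lemma sum_apart : \sum_u \sum_v apart u v =
  2 * (n * \sum_(0 <= i < k.+1) (n - 2 ^ i)) + 2 * (n - 1).
Proof.
have blk i (u : 'I_n) : i <= k -> \sum_(v < n) (pos u %/ 2 ^ i != pos v %/ 2 ^ i) = n - 2 ^ i.
  move=> ik; pose F (v : 'I_n) := nat_of_bool (pos u %/ 2 ^ i != v %/ 2 ^ i).
  have <- : \sum_v F v = \sum_v F (pos v) by rewrite (reindex_inj (@perm_inj _ pos)).
  rewrite count_block ?expn_gt0 //; have := anc_lt u ik => lt.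
  apply: (@leq_trans (3 * 2 ^ (k - i) * 2 ^ i)); first by rewrite leq_mul2r lt orbT.
  by rewrite -mulnA -expnD subnK // -nk.
rewrite /apart; under eq_bigr do rewrite big_split /=.
rewrite big_split /=; congr (_ + _).
  under eq_bigr do rewrite -big_distrr exchange_big /=.
  rewrite -big_distrr /=; congr (2 * _).
  rewrite (eq_bigr (fun=> \sum_(0 <= i < k.+1) (n - 2 ^ i))).
    by rewrite sum_nat_const card_ord.
  by move=> u _; rewrite !big_nat; apply: eq_bigr => i hi; apply: blk; lia.
rewrite (bigD1 v0) //= eqxx (bigD1 v0) //= eqxx add0n.
rewrite (eq_bigr (fun=> 1)); last by move=> v /negbTE->.
rewrite [X in _ + X](eq_bigr (fun=> 1)); last first.
  move=> u /negbTE uv; rewrite (bigD1 v0) //= eqxx uv big1 //.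
  by move=> v /negbTE->.
by rewrite !sum1_card cardC1 card_ord; lia.
Qed.

(** All pairs minus those of [H]. An edge of [H] joins different branches, so its ends differ at all
    [k.+1] heights and it saves [2 * k.+1], one more if it contains [v0]. *)
Lemma best_length :
  ((layout_length G best leaf)%:Z <=
    3 * (pw k * unit_cost n k) - k.+1%:Z * (vol H setT)%:Z + n%:Z - 1
    - (\sum_v H v0 v)%N%:Z)%R.
Proof.
have aS u v : apart u v = apart v u.
  rewrite /apart; congr (2 * _ + _); last by case: (u == v0); case: (v == v0).
  by apply: eq_bigr => i _; congr (nat_of_bool (~~ _)); rewrite eq_sym.
have L : 2 * layout_length G best leaf <= \sum_u \sum_v G u v * apart u v.
  rewrite (sum_sym G aS) leq_mul2l /=; apply: leq_sum => u _; apply: leq_sum => v _.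
  exact: dist_apart.
have a0 u : apart u u = 0 by rewrite /apart big1 ?eqxx // => i _; rewrite eqxx.
have aH u v : H u v -> apart u v = 2 * k.+1 + ((u == v0) != (v == v0)).
  move=> /pos_sep ne; rewrite /apart; congr (2 * _ + _).
  rewrite big_nat (eq_bigr (fun=> 1)) => [|i hi].
    by rewrite -big_nat sum_nat_const_nat; lia.
  apply/eqP; rewrite eqb1; apply: contra ne => /eqP e.
  have -> : 2 ^ k = 2 ^ i * 2 ^ (k - i) by rewrite -expnD subnKC //; lia.
  by rewrite !divnMA e.
have S : \sum_u \sum_v G u v * apart u v + \sum_u \sum_v H u v * apart u v =
   \sum_u \sum_v apart u v.
  rewrite -big_split; apply: eq_bigr => u _; rewrite -big_split; apply: eq_bigr => v _ /=.
  rewrite GE; have [->|_] := eqVneq u v; first by rewrite a0 !muln0.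
  by case: (H u v) => /=; lia.
have SH : \sum_u \sum_v H u v * apart u v = 2 * k.+1 * vol H setT + 2 * \sum_v H v0 v.
  have setT_sum (F : 'I_n -> nat) : \sum_(u in setT) F u = \sum_u F u.
    by apply: eq_bigl => u; rewrite inE.
  rewrite /vol setT_sum big_distrr /=.
  have one (F : 'I_n -> nat) : \sum_v F v * (v == v0) = F v0.
    rewrite (bigD1 v0) //= eqxx muln1 big1 ?addn0 // => v /negbTE ->; exact: muln0.
  have -> : 2 * \sum_v H v0 v = \sum_u \sum_v H u v * (u == v0) + \sum_u \sum_v H u v * (v == v0).
    rewrite mul2n -addnn; congr (_ + _).
      by rewrite exchange_big; apply: eq_bigr => v _; rewrite (one (fun u => H u v)).
    by apply: eq_bigr => u _; rewrite one Hsym.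
  rewrite -!big_split; apply: eq_bigr => u _ /=.
  rewrite big_distrr -!big_split; apply: eq_bigr => v _ /=.
  case: (boolP (H u v)) => [huv|_]; last by rewrite !mul0n muln0.
  rewrite aH // !mul1n muln1; congr (_ + _).
  case: (eqVneq u v0) => [e1|_]; case: (eqVneq v v0) => [e2|_] //=.
  by move: huv; rewrite e1 e2 Hirr.
have SN : ((\sum_(0 <= i < k.+1) (n - 2 ^ i))%N%:Z = unit_cost n k)%R.
  have e i : i <= k.+1 -> (\sum_(0 <= j < i) (n - 2 ^ j)) + 2 ^ i = i * n + 1.
    elim: i => [|i IH] ik; first by rewrite big_geq.
    have := IH (ltnW ik); rewrite big_nat_recr //= expnS [i.+1 * n]mulSn.
    have : 2 ^ i <= 2 ^ k by rewrite leq_exp2l.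
    by move: nk; move: (\sum_(0 <= _ < _) _) (2 ^ i) (2 ^ k) (i * n) => a b c d; clear; lia.
  have := e k.+1 (leqnn _); rewrite /unit_cost /pw expnS -PoszM.
  by move: (\sum_(0 <= _ < _) _) (2 ^ k) (k.+1 * n) => a b c; clear; lia.
have n1 : 0 < n by lia.
have nE : (n%:Z = 3 * pw k)%R by apply: n_pw.
rewrite -SN; move: L S; rewrite SH sum_apart.
have -> : (3 * (pw k * (\sum_(0 <= i < k.+1) (n - 2 ^ i))%N%:Z) =
    (n * \sum_(0 <= i < k.+1) (n - 2 ^ i))%N%:Z)%R by rewrite PoszM nE mulrA.
rewrite -PoszM -mulnA.
move: (n * _) (k.+1 * _) (\sum_v H v0 v) (\sum_u _) (layout_length _ _ _) => a b c d e.
by clear -n1; lia.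
Qed.

Lemma exists_short_layout : exists (V : finType) (T : sgraph V) r phi,
  layout (n := n) T r phi /\
  ((layout_length G T phi)%:Z <=
    3 * (pw k * unit_cost n k) - k.+1%:Z * (vol H setT)%:Z + n%:Z - 1
    - (\sum_v H v0 v)%N%:Z)%R.
Proof. by exists node, best, root, leaf; split; [exact: best_layout|exact: best_length]. Qed.

End UpperBound.

Theorem optimal_layout_separated (n k h : nat) (H : rel 'I_n) (G : sgraph 'I_n)
    (col : 'I_n -> nat) (W : finType) (T : sgraph W) (r : W) (phi : 'I_n -> W) :
  n = 3 * 2 ^ k -> 0 < k -> h <= 2 ^ k -> vol H setT < 2 ^ k ->
  (forall u v, G u v = (u != v) && ~~ H u v) -> irreflexive H -> symmetric H ->
  (forall u v, H u v -> u < h) ->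
  (forall u, col u < 3) -> (forall u v, H u v -> col u != col v) ->
  optimal_layout G T r phi ->
  exists z, forall u v, H u v ->
    ~~ connect (fun a b => [&& T a b, a != z & b != z]) (phi u) (phi v).
Proof.
move=> nk k0 hk vk GE Hirr Hsym Hh col3 proper [lay opt].
have n0 : 0 < n by rewrite nk muln_gt0 expn_gt0.
pose deg u := \sum_v H u v.
(* The lower bound subtracts a bound [d] on all degrees, the balanced layout the degree of the
   vertex at the root; a maximal degree makes the two agree. *)
have [v0 vmax] : exists v0, forall u, deg u <= deg v0.
  by case: (@arg_maxnP _ (Ordinal n0) xpredT deg isT) => v0 _ h0; exists v0 => u; apply: h0.
have [pos hpos] := positions nk k0 hk Hsym col3 proper Hh.
have [V [T' [r' [phi' [lay' len']]]]] :=
  exists_short_layout v0 nk k0 hk GE Hirr Hsym hpos.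
apply: (layout_separated nk Hirr GE vk lay vmax).
by apply: le_trans len'; rewrite lez_nat; apply: opt lay'.
Qed.

End MinimalLayouts.

(** * The reduction and the checker are polynomial-time functions *)

Lemma pf_at (F : seq bool -> seq bool) k :
  pf (fun e => F (nth [::] e 0)) -> pf (fun e => F (nth [::] e k)).
Proof. by move=> h; apply: pf_eq (pf_drop k h) _ => e; rewrite nth_drop addn0. Qed.

Lemma pn_at (F : seq bool -> nat) k :
  pn (fun e => F (nth [::] e 0)) -> pn (fun e => F (nth [::] e k)).
Proof. exact: (@pf_at (fun x => un (F x))). Qed.

Ltac pnstep := match goal with
  | |- pn (fun e => ?c) => exact: pn_const
  | |- pb (fun e => ?c) => exact: pb_const
  | |- pn (fun e => (@?f e).+1) => apply: pn_S
  | |- pn (fun e => (@?f e).-1) => apply: pn_pred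
  | |- pn (fun e => @?f e + @?g e) => apply: pn_add
  | |- pn (fun e => @?f e - @?g e) => apply: pn_sub
  | |- pn (fun e => @?f e * @?g e) => apply: pn_mul
  | |- pn (fun e => @?f e %/ @?g e) => apply: pn_div
  | |- pn (fun e => @?f e %% @?g e) => apply: pn_mod
  | |- pn (fun e => nat_of_bool (@?b e)) => apply: (_ : pb b)
  | |- pn (fun e => V ?k e) => exact: pn_V
  | |- pn (fun e => size (@?f e)) => apply: pn_size
  | |- pf (fun e => nth [::] e ?k) => exact: pf_var
  | |- pb (fun e => @?b e && @?c e) => apply: pb_and
  | |- pb (fun e => @?b e || @?c e) => apply: pb_or
  | |- pb (fun e => ~~ @?b e) => apply: pb_not
  | |- pb (fun e => @?f e <= @?g e) => apply: pb_leq
  | |- pb (fun e => @eq_op _ (@?f e) (@?g e)) => apply: pb_eqn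
  | |- pb (fun e => nth false (@?f e) (@?g e)) => apply: pb_nth
  | |- pb (fun e => exb _ _ e) => apply: pb_exb
  | |- pb (fun e => allb _ _ e) => apply: pb_allb
  | |- pn (fun e => findb _ _ e) => apply: pn_findb
  | |- pn (V ?k) => exact: pn_V
  end.

Lemma V0E i e : V 0 (un i :: e) = i.
Proof. exact: size_un. Qed.

Ltac pnhyp := match goal with
  | H : ?P |- ?Q => constr_eq P Q; exact H
  | H : pn ?f |- pn (fun e => ?f e) => exact H
  | H : pb ?f |- pb (fun e => ?f e) => exact H
  | H : pf ?f |- pf (fun e => ?f e) => exact H
  end.

Ltac pnif := match goal with
  | |- pn ?f => match f with context [if _ then _ else _] => apply: pn_if end
  end.

Ltac pnauto := repeat first [pnhyp | pnstep | pnif].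

Section Instance.
Variables (M : TM bool) (p : {poly nat}).

(** The tableau needs at least one step, whence the successor; a halted machine ignores the
    additional choice. *)
Definition clock (x : seq bool) : nat := (p.[size x])%R.+1.
Definition adj_code (x : seq bool) (u v : nat) : bool :=
  gadget_edge (nvars M (clock x)) (nclauses M (clock x)) (width M)
    (slot_var M (clock x)) (slot_pol M) (clause_active M x (clock x)) u v.
Definition nverts (x : seq bool) : nat :=
  nvert (nvars M (clock x)) (nclauses M (clock x)) (width M).

Lemma pn_clock k : pn (fun e => clock (nth [::] e k)).
Proof. by apply: (@pn_at clock); apply/pn_S/pn_horner/pn_V. Qed.

Lemma pn_nvars k : pn (fun e => nvars M (clock (nth [::] e k))).
Proof. by have := pn_clock k; rewrite /nvars /cols /mid => h; pnauto. Qed.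

Lemma pn_nclauses k : pn (fun e => nclauses M (clock (nth [::] e k))).
Proof. by have := pn_clock k; rewrite /nclauses /cols /mid => h; pnauto. Qed.

Lemma pn_nverts k : pn (fun e => nverts (nth [::] e k)).
Proof.
have := pn_nvars k; have := pn_nclauses k; rewrite /nverts /nvert /base => h1 h2.
by pnauto.
Qed.

Lemma pn_slot_var k i : pn i -> pn (fun e => slot_var M (clock (nth [::] e k)) (i e)).
Proof.
move=> hi; have h := pn_clock k.
by rewrite /slot_var /clause_row /clause_col /cols /mid; pnauto.
Qed.

(** The polarity depends on two residues modulo constants of the machine, so a finite table
    suffices. *)
Lemma pn_slot_pol i : pn i -> pb (fun e => slot_pol M (i e)).
Proof.
move=> hi; rewrite /slot_pol; apply: pb_not.
have w0 := width_gt0 M; have n0 := npat_gt0 M.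
pose t m := pattern_fun M (m %/ width M) (m %% width M).
apply: (@pb_eq (fun e => t ((i e %/ width M) %% npat M * width M + i e %% width M))).
  apply: (@pb_table t (npat M * width M)); first by pnauto.
  move=> e; apply: (@leq_trans (((i e %/ width M) %% npat M).+1 * width M)).
    by rewrite mulSn addnC ltn_add2r ltn_pmod.
  by rewrite leq_mul2r ltn_pmod // orbT.
by move=> e; rewrite /t divnMDl // modnMDl modn_mod (divn_small (ltn_pmod _ w0)) addn0.
Qed.

(** Besides the pattern, the rule depends on two codes below 4 and one bit, packed into a single
    table index; the table itself is a constant of [M]. *)
Lemma pb_clause_active k c : pn c ->
  pb (fun e => clause_active M (nth [::] e k) (clock (nth [::] e k)) (c e)).
Proof.
move=> hc; have h := pn_clock k; have n0 := npat_gt0 M.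
pose ic e := init_code (nth [::] e k) (clock (nth [::] e k))
  (clause_row M (clock (nth [::] e k)) (c e)) (clause_col M (clock (nth [::] e k)) (c e)).+1.
pose pc e := pos_code (clock (nth [::] e k)) (clause_col M (clock (nth [::] e k)) (c e)).+1.
pose fc e := (clause_row M (clock (nth [::] e k)) (c e)).+1 == clock (nth [::] e k).
have hic : pn ic.
  by rewrite /ic /init_code /clause_row /clause_col /cols /mid; pnauto.
have hpc : pn pc.
  by rewrite /pc /pos_code /clause_row /clause_col /cols /mid; pnauto.
have hfc : pb fc by rewrite /fc /clause_row /cols /mid; pnauto.
have lic e : ic e < 4 by rewrite /ic /init_code; do 2 (case: ifP => // _); case: (nth _ _ _).
have lpc e : pc e < 4 by rewrite /pc /pos_code; do 3 (case: ifP => //).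
pose t m := ~~ pattern_ok M (m %/ npat M %/ 2 %/ 4) ((m %/ npat M %/ 2) %% 4)
   ((m %/ npat M) %% 2 == 1) (pattern_fun M (m %% npat M)).
pose q e := (ic e * 4 + pc e) * 2 + fc e.
have lq e : q e < 32 by rewrite /q; have := lic e; have := lpc e; case: (fc e); lia.
apply: (@pb_eq (fun e => t (q e * npat M + c e %% npat M))).
  apply: (@pb_table t (32 * npat M)); first by rewrite /q; pnauto.
  move=> e; apply: (@leq_trans ((q e).+1 * npat M)).
    by rewrite mulSn addnC ltn_add2r ltn_pmod.
  by rewrite leq_mul2r lq orbT.
move=> e; rewrite /t divnMDl // modnMDl modn_mod (divn_small (ltn_pmod _ n0)) addn0.
rewrite /q divnMDl // modnMDl (divn_small (d := 2)); last by case: (fc e).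
rewrite addn0 divnMDl // modnMDl (divn_small (lpc e)) addn0 (modn_small (lpc e)).
by rewrite /clause_active -/(ic e) -/(pc e) -/(fc e); case: (fc e).
Qed.

Lemma pb_adj_code k u v : pn u -> pn v ->
  pb (fun e => adj_code (nth [::] e k) (u e) (v e)).
Proof.
move=> hu hv.
have hy := pn_nvars 2; have hc := pn_nclauses 2.
have g1 : pb (fun e => (V 0 e == 0) && (V 1 e == 1)) by pnauto.
have g2 : pn (fun e => nclauses M (clock (nth [::] e 2)) * width M) by pnauto.
(* Under the quantifier the environment consists of the bound index, [u], [v] and the input, in this
   order. *)
pose B1 e := var_edge (V 1 e) (V 2 e) (V 0 e).
pose B2 e := slot_edge (nvars M (clock (nth [::] e 3))) (width M)
  (slot_var M (clock (nth [::] e 3))) (slot_pol M)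
  (clause_active M (nth [::] e 3) (clock (nth [::] e 3))) (V 1 e) (V 2 e) (V 0 e).
have h1 : pb B1 by rewrite /B1 /var_edge; pnauto.
have h2 : pb B2.
  have hn := pn_nvars 3; have hv3 := pn_slot_var 3 (pn_V 0).
  have hp := pn_slot_pol (pn_V 0).
  have ha := @pb_clause_active 3 (fun e => V 0 e %/ width M) ltac:(pnauto).
  by rewrite /B2 /slot_edge /vP /vQ /vO /vlit /vprev /vO /base; pnauto.
pose g e := [|| (V 0 e == 0) && (V 1 e == 1),
   exb (fun e => nvars M (clock (nth [::] e 2))) B1 e
 | exb (fun e => nclauses M (clock (nth [::] e 2)) * width M) B2 e].
have hg : pb g by apply: pb_or g1 (pb_or (pb_exb hy h1) (pb_exb g2 h2)).
have hfs : pfs [:: (fun e => un (u e)); (fun e => un (v e)); (fun e => nth [::] e k)].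
  by do 2 split=> //; split; [exact: pf_var|].
apply: pf_eq (pf_comp hfs hg) _ => e.
congr (un (nat_of_bool _)); rewrite /g /adj_code /gadget_edge /= /V /= !size_un.
congr [|| _, _ | _].
  by apply: eq_has => i; rewrite /B1 /V /= !size_un.
by apply: eq_has => i; rewrite /B2 /V /= !size_un.
Qed.

(** [h * h] bounds the volume of a graph on [h] vertices. Doubling stops as soon as this is
    exceeded, so the result stays small enough for unary notation. *)
Definition big_power (h : nat) : nat :=
  iteri (h * h).+1 (fun _ acc => if acc <= h * h then 2 * acc else acc) 2.

(** As long as doubling goes on, the value after [i] rounds exceeds [i]; hence [h * h + 1] rounds
    are enough. *)
Lemma big_powerP h : exists k, [/\ 0 < k, big_power h = 2 ^ k & h * h < 2 ^ k].
Proof.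
rewrite /big_power; set a := h * h.
have inv i : exists2 k, 0 < k & iteri i (fun _ acc => if acc <= a then 2 * acc else acc) 2 = 2 ^ k
    /\ (a < 2 ^ k \/ i < 2 ^ k).
  elim: i => [|i [k k0 [e h0]]]; first by exists 1 => //; split=> //; right.
  rewrite /= e; case: leqP => hk; last by exists k => //; split=> //; left.
  exists k.+1 => //; rewrite expnS; split=> //; right.
  by case: h0 => h0; lia.
by have [k k0 [e h0]] := inv a.+1; exists k; split=> //; case: h0 => //; lia.
Qed.

Lemma pn_big_power f : pn f -> pn (fun e => big_power (f e)).
Proof.
move=> hf.
pose g e := if V 0 e <= f (drop 2 e) * f (drop 2 e) then 2 * V 0 e else V 0 e.
have hg : pn g by have := pn_drop 2 hf => h; rewrite /g; pnauto.
have E e i : iteri i (fun i acc => g (un acc :: un i :: e)) 2 =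
    iteri i (fun _ acc => if acc <= f e * f e then 2 * acc else acc) 2.
  by elim: i => //= i ->; rewrite /g /V /= size_un drop0.
apply: (@pn_eq (fun e => iteri (f e * f e).+1 (fun i acc => g (un acc :: un i :: e)) 2)).
  apply: (@pn_rec _ (fun=> 2) g (fun e => 2 * (f e * f e) + 2)) => //; try by pnauto.
    by have := pn_polyb hf => h; polyb.
  have bnd a i : iteri i (fun _ acc => if acc <= a then 2 * acc else acc) 2 <= 2 * a + 2.
    by elim: i => [|i IH]; [rewrite leq_addl|rewrite iteriS; case: ifP; lia].
  by move=> e i _; rewrite E.
by move=> e; rewrite E.
Qed.

Definition order (x : seq bool) : nat := 3 * big_power (nverts x).

Lemma pn_order k : pn (fun e => order (nth [::] e k)).
Proof. by have := pn_big_power (pn_nverts k) => h; rewrite /order; pnauto. Qed.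

Definition hard_edge (x : seq bool) (u v : nat) : bool :=
  [&& u < nverts x, v < nverts x, u != v & adj_code x u v || adj_code x v u].

Lemma pb_hard_edge k u v : pn u -> pn v ->
  pb (fun e => hard_edge (nth [::] e k) (u e) (v e)).
Proof.
move=> hu hv; have h1 := pn_nverts k.
have h2 := pb_adj_code k hu hv; have h3 := pb_adj_code k hv hu.
by rewrite /hard_edge; pnauto.
Qed.

Definition graph_bit (x : seq bool) (i : nat) : bool :=
  let n := order x in
  if i < n then true else if i == n then false else
  let j := i - n.+1 in
  (j %/ n != j %% n) && ~~ hard_edge x (j %/ n) (j %% n).

Definition graph_word (x : seq bool) : seq bool :=
  mkseq (graph_bit x) ((order x).+1 + order x * order x).

Lemma pf_graph_word : pf (fun e => graph_word (nth [::] e 0)).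
Proof.
have h0 := pn_order 0; have h1 := pn_order 1.
pose r e := (V 0 e - (order (nth [::] e 1)).+1) %/ order (nth [::] e 1).
pose c e := (V 0 e - (order (nth [::] e 1)).+1) %% order (nth [::] e 1).
have hr : pn r by rewrite /r; pnauto.
have hc : pn c by rewrite /c; pnauto.
pose B e := if V 0 e < order (nth [::] e 1) then true else
  if V 0 e == order (nth [::] e 1) then false else
  (r e != c e) && ~~ hard_edge (nth [::] e 1) (r e) (c e).
have hB : pb B.
  have h2 := pb_hard_edge 1 hr hc.
  apply: pb_if; [by pnauto|exact: pb_true|apply: pb_if; [by pnauto|exact: pb_false|]].
  by apply: pb_and (pb_not (pb_eqn hr hc)) (pb_not h2).
apply: pf_eq (pf_mkw _ hB) _; last first.
  move=> e; apply: eq_mkseq => i; rewrite /B /r /c V0E /graph_bit; reflexivity.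
by pnauto.
Qed.

(** The inverse of [enc_nat], applied at position [q] of [w]. *)
Definition runlen (w : seq bool) (q : nat) : nat :=
  find (fun i => ~~ nth false w (q + i)) (iota 0 (size w)).

Lemma pn_runlen f q : pf f -> pn q -> pn (fun e => runlen (f e) (q e)).
Proof.
move=> hf hq.
pose B e := ~~ nth false (nth [::] e 1) (V 2 e + V 0 e).
have hB : pb B by rewrite /B; pnauto.
have hg := pn_findb (n := V 0) (pn_V 0) hB.
have hfs : pfs [:: f; (fun e => un (q e))] by [].
apply: pf_eq (pf_comp hfs hg) _ => e.
congr un; rewrite /findb /runlen /= /V /=; apply: eq_find => i.
by rewrite /B /V /= !size_un.
Qed.

(* The word [w] is parsed as the output of [enc_layout]. *)
Definition tree_size (w : seq bool) : nat := runlen w 0.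
Definition tree_bit (w : seq bool) (a b : nat) : bool :=
  nth false w ((tree_size w).+1 + a * tree_size w + b).
(** The [u.+1] numbers skipped are the root and the images of the [u] smaller vertices. *)
Definition image_start (w : seq bool) (u : nat) : nat :=
  iteri u.+1 (fun _ q => q + (runlen w q).+1) ((tree_size w).+1 + tree_size w * tree_size w).
Definition image (w : seq bool) (u : nat) : nat := runlen w (image_start w u).

Lemma pn_tree_size f : pf f -> pn (fun e => tree_size (f e)).
Proof. by move=> hf; apply: pn_runlen => //; pnauto. Qed.

Lemma pb_tree_bit f a b : pf f -> pn a -> pn b -> pb (fun e => tree_bit (f e) (a e) (b e)).
Proof.
by move=> hf ha hb; have h := pn_tree_size hf; rewrite /tree_bit; pnauto.
Qed.

Lemma pn_image f u : pf f -> pn u -> pn (fun e => image (f e) (u e)).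
Proof.
move=> hf hu; apply: pn_runlen => //.
pose g e := V 0 e + (runlen (f (drop 2 e)) (V 0 e)).+1.
have hg : pn g.
  have := pn_runlen (pf_drop 2 hf) (pn_V 0) => h; rewrite /g; pnauto.
have hs := pn_tree_size hf.
have E e i : iteri i (fun i acc => g (un acc :: un i :: e)) ((tree_size (f e)).+1 + tree_size (f e) * tree_size (f e)) =
   iteri i (fun _ q => q + (runlen (f e) q).+1) ((tree_size (f e)).+1 + tree_size (f e) * tree_size (f e)).
  by elim: i => //= i ->; rewrite /g /V /= size_un drop0.
apply: (@pn_eq (fun e => iteri (u e).+1 (fun i acc => g (un acc :: un i :: e))
   ((tree_size (f e)).+1 + tree_size (f e) * tree_size (f e)))); last by move=> e; rewrite E.
apply: (@pn_rec _ _ g (fun e => ((tree_size (f e)).+1 + tree_size (f e) * tree_size (f e)) +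
   (u e).+1 * (size (f e)).+1)) => //; try by pnauto.
  by have := pn_polyb hs => h1; have := pf_polyb hf => h2; have := pn_polyb hu => h3; polyb.
move=> e i hi; rewrite E; set s := _ + _ * _.
apply: (@leq_trans (s + i * (size (f e)).+1)); last by rewrite leq_add2l leq_mul2r hi orbT.
elim: i {hi} => [|i IH] /=; first by rewrite addn0.
have : runlen (f e) (iteri i (fun _ q => q + (runlen (f e) q).+1) s) <= size (f e).
  by apply: leq_trans (find_size _ _) _; rewrite size_iota.
by rewrite mulSn; lia.
Qed.

(** One round of a breadth-first search that avoids [z]. As simple paths are shorter than the number
    of vertices, [tree_size w] rounds complete it. *)
Definition spread (w : seq bool) (z : nat) (l : seq bool) : seq bool :=
  mkseq (fun y => nth false l y || has (fun a => [&& nth false l a, tree_bit w a y, a != z & y != z])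
    (iota 0 (tree_size w))) (tree_size w).

Definition reach (w : seq bool) (z a b : nat) : bool :=
  nth false (iteri (tree_size w) (fun _ => spread w z) (mkseq (eq_op^~ a) (tree_size w))) b.

Lemma pb_reach f z a b : pf f -> pn z -> pn a -> pn b ->
  pb (fun e => reach (f e) (z e) (a e) (b e)).
Proof.
move=> hf hz ha hb.
have t k : pn (fun e => tree_size (nth [::] e k)) by apply: pn_tree_size (pf_var k).
pose g0 := mkw (fun e => tree_size (nth [::] e 0)) (fun e => V 0 e == V 3 e).
have h0 : pf g0 by apply: pf_mkw (t 0) _; pnauto.
(* environment of the step: [acc; i; w; z; a; b] *)
pose C e := [&& nth false (nth [::] e 2) (V 0 e), tree_bit (nth [::] e 4) (V 0 e) (V 1 e),
   V 0 e != V 5 e & V 1 e != V 5 e].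
have hC : pb C.
  have := @pb_tree_bit (fun e => nth [::] e 4) (V 0) (V 1) (pf_var 4) (pn_V 0) (pn_V 1) => h.
  by rewrite /C; pnauto.
pose B e := nth false (nth [::] e 1) (V 0 e) || exb (fun e => tree_size (nth [::] e 3)) C e.
have hB : pb B by apply: pb_or (pb_exb (t 3) hC); pnauto.
pose h := mkw (fun e => tree_size (nth [::] e 2)) B.
have h1 : pf h by apply: pf_mkw (t 2) hB.
pose rc := recf (fun e => un (tree_size (nth [::] e 0))) g0 h.
have hr : pf rc.
  apply: (@pf_rec _ _ _ (fun e => tree_size (nth [::] e 0)) (t 0) h0 h1).
    exact: pn_polyb (t 0).
  by move=> e [|i] _ /=; rewrite size_mkseq.
have hg : pb (fun e => nth false (rc e) (V 3 e)) by apply: pb_nth (pn_V 3) hr.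
have hfs : pfs [:: f; (fun e => un (z e)); (fun e => un (a e)); (fun e => un (b e))] by [].
apply: pf_eq (pf_comp hfs hg) _ => e.
congr (un (nat_of_bool _)).
set e' := map _ _; rewrite /reach (_ : V 3 e' = b e); last exact: size_un.
congr nth; rewrite /rc /recf size_un -[nth _ e' 0]/(f e).
have <- : g0 e' = mkseq (eq_op^~ (a e)) (tree_size (f e)).
  by apply: eq_mkseq => y; rewrite V0E (_ : V 3 _ = a e); last exact: size_un.
elim: (tree_size (f e)) => // i IH.
rewrite !iteriS IH; move: (iteri i _ _) => acc.
apply: eq_mkseq => y; rewrite /B V0E; congr (_ || _); apply: eq_has => v.
rewrite /C V0E (_ : V 1 _ = y); last exact: size_un.
by rewrite (_ : V 5 _ = z e); last exact: size_un.
Qed.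

Definition check (x w : seq bool) : bool :=
  has (fun z => ~~ has (fun u => has (fun v =>
     hard_edge x u v && reach w z (image w u) (image w v))
     (iota 0 (nverts x))) (iota 0 (nverts x))) (iota 0 (tree_size w)).

Lemma pb_check : pb (fun e => check (nth [::] e 0) (nth [::] e 1)).
Proof.
pose D e := hard_edge (nth [::] e 3) (V 1 e) (V 0 e) &&
  reach (nth [::] e 4) (V 2 e) (image (nth [::] e 4) (V 1 e)) (image (nth [::] e 4) (V 0 e)).
have hD : pb D.
  apply: pb_and (pb_hard_edge 3 (pn_V 1) (pn_V 0)) _.
  exact: pb_reach (pf_var 4) (pn_V 2) (pn_image (pf_var 4) (pn_V 1)) (pn_image (pf_var 4) (pn_V 0)).
have h1 := pb_exb (pn_nverts 2) hD.
have h2 := pb_not (pb_exb (pn_nverts 1) h1).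
apply: pb_eq (pb_exb (pn_tree_size (pf_var 1)) h2) _ => e.
apply: eq_has => z; congr (~~ _); apply: eq_has => u; apply: eq_has => v.
rewrite /D V0E (_ : V 1 _ = u); last exact: size_un.
by rewrite (_ : V 2 _ = z); last exact: size_un.
Qed.

End Instance.

(** * Parsing encoded graphs and layouts *)

Lemma allpairs_mkseq (g : nat -> nat -> bool) a b :
  [seq g u v | u <- iota 0 a, v <- iota 0 b] = mkseq (fun j => g (j %/ b) (j %% b)) (a * b).
Proof.
elim: a => [|a IH]; first by [].
rewrite iota_S -cats1 map_cat flatten_cat IH /= cats0 mulSn addnC /mkseq iotaD map_cat add0n.
congr (_ ++ _); rewrite -[in RHS](addn0 (a * b)) iotaDl -map_comp.
apply/eq_in_map => v; rewrite mem_iota /= => hv.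
by rewrite divnMDl ?modnMDl ?divn_small ?modn_small ?addn0 //; lia.
Qed.

Lemma enum_allpairs n (g : nat -> nat -> bool) (G : 'I_n -> 'I_n -> bool) :
  (forall u v, G u v = g u v) ->
  [seq G u v | u <- enum 'I_n, v <- enum 'I_n] = mkseq (fun j => g (j %/ n) (j %% n)) (n * n).
Proof.
move=> e; rewrite -allpairs_mkseq -val_enum_ord allpairs_mapl allpairs_mapr.
by apply: eq_allpairs.
Qed.

Lemma find_iota (q : pred nat) N k : k < N -> q k -> (forall i, i < k -> ~~ q i) ->
  find q (iota 0 N) = k.
Proof.
move=> kN qk nq; rewrite -(subnKC kN) addSnnS iotaD find_cat has_find size_iota.
rewrite (_ : find q (iota 0 k) = k); first by rewrite ltnn add0n /= qk addn0.
rewrite -[RHS](size_iota 0 k); apply/hasNfind/hasPn => i; rewrite mem_iota; exact: nq.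
Qed.

Lemma size_enc_nat k : size (enc_nat k) = k.+1.
Proof. by rewrite size_rcons size_nseq. Qed.

Lemma runlen_enc pre k suf : runlen (pre ++ enc_nat k ++ suf) (size pre) = k.
Proof.
apply: find_iota.
- by rewrite !size_cat size_enc_nat; lia.
- by rewrite nth_cat ltnNge leq_addr /= addKn nth_cat size_enc_nat ltnSn nth_rcons size_nseq ltnn eqxx.
- move=> i ik; rewrite nth_cat ltnNge leq_addr /= addKn nth_cat size_enc_nat ltnS ltnW //.
  by rewrite nth_rcons size_nseq ik nth_nseq ik.
Qed.

Lemma runlen_block pre (L : seq nat) i : i < size L ->
  runlen (pre ++ flatten (map enc_nat L)) (size pre + sumn (map succn (take i L))) = nth 0 L i.
Proof.
move=> hi; rewrite -{1}(cat_take_drop i L) (drop_nth 0) // map_cat flatten_cat /= catA.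
have -> : size pre + sumn (map succn (take i L)) = size (pre ++ flatten (map enc_nat (take i L))).
  rewrite size_cat size_flatten /shape -map_comp; congr (_ + sumn _).
  by apply: eq_map => k /=; rewrite size_enc_nat.
exact: runlen_enc.
Qed.

Section Parse.
Variables (n m : nat) (T : sgraph 'I_m) (r : 'I_m) (phi : 'I_n -> 'I_m).
Let w := enc_layout T r phi.

Lemma tree_size_enc : tree_size w = m.
Proof. by rewrite /tree_size /w /enc_layout /enc_graph -!catA; apply: (@runlen_enc [::]). Qed.

Let matE : [seq T a b | a <- enum 'I_m, b <- enum 'I_m] =
  mkseq (fun j => if insub (j %/ m) is Some a then if insub (j %% m) is Some b then T a b else false else false) (m * m).
Proof.
apply: (@enum_allpairs m (fun i j =>
  if insub i is Some a then if insub j is Some b then T a b else false else false)).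
by move=> a b; rewrite !valK.
Qed.

Lemma tree_bit_enc (a b : 'I_m) : tree_bit w a b = T a b.
Proof.
rewrite /tree_bit tree_size_enc /w /enc_layout /enc_graph -!catA nth_cat size_enc_nat.
rewrite ltnNge -addnA leq_addr /= addKn matE nth_cat size_mkseq.
have m0 : 0 < m by apply: leq_ltn_trans (ltn_ord a).
have -> : a * m + b < m * m.
  apply: (@leq_trans (a.+1 * m)); first by rewrite mulSn addnC ltn_add2r.
  by rewrite leq_mul2r ltn_ord orbT.
rewrite nth_mkseq; last first.
  apply: (@leq_trans (a.+1 * m)); first by rewrite mulSn addnC ltn_add2r.
  by rewrite leq_mul2r ltn_ord orbT.
by rewrite divnMDl // modnMDl divn_small // modn_small // addn0 !valK.
Qed.

Lemma image_enc (u : 'I_n) : image w u = phi u.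
Proof.
pose L := nat_of_ord r :: [seq nat_of_ord (phi v) | v <- enum 'I_n].
have sL : size L = n.+1 by rewrite /= size_map size_enum_ord.
have wE : w = enc_graph T ++ flatten (map enc_nat L).
  by rewrite /w /enc_layout /= -map_comp.
have sG : size (enc_graph T) = m.+1 + m * m.
  by rewrite size_cat size_enc_nat matE size_mkseq.
have st i : i <= n.+1 -> iteri i (fun _ q => q + (runlen w q).+1) (m.+1 + m * m) =
    size (enc_graph T) + sumn (map succn (take i L)).
  elim: i => [|i IH] hi; first by rewrite take0 addn0.
  rewrite iteriS IH; last exact: ltnW.
  rewrite {1}wE runlen_block ?sL // (take_nth 0) ?sL // map_rcons sumn_rcons.
  by rewrite addnA.
rewrite /image /image_start tree_size_enc st //.
rewrite {1}wE runlen_block ?sL ?ltnS //= (nth_map u) ?size_enum_ord // nth_ord_enum //.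
exact: leqW.
Qed.

Definition avoid (z : 'I_m) : rel 'I_m := fun a b => [&& T a b, a != z & b != z].

Lemma reach_enc (z a b : 'I_m) : reach w z a b = connect (avoid z) a b.
Proof.
rewrite /reach tree_size_enc.
pose L t := iteri t (fun _ => spread w z) (mkseq (eq_op^~ (a : nat)) m).
have LS t (y : 'I_m) : nth false (L t.+1) y =
    nth false (L t) y || has (fun c => [&& nth false (L t) c, tree_bit w c y, c != z & nat_of_ord y != z]) (iota 0 m).
  by rewrite /L iteriS /spread tree_size_enc nth_mkseq.
have L0 (y : 'I_m) : nth false (L 0) y = (y == a) by rewrite /L nth_mkseq.
apply/idP/idP => [|/connectP[p0 /shortenP[p hp up _] ->] {p0}].
  suff inv t (y : 'I_m) : nth false (L t) y -> connect (avoid z) a y by apply: inv.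
  elim: t y => [|t IH] y; first by rewrite L0 => /eqP->; exact: connect0.
  rewrite LS => /orP[/IH//|/hasP[c]]; rewrite mem_iota add0n /= => hc.
  move=> /and4P[h1 h2 h3 h4]; have := IH (Ordinal hc) h1 => h5.
  apply: connect_trans h5 _; apply: connect1; rewrite /avoid.
  by have := tree_bit_enc (Ordinal hc) y; rewrite /= h2 => <-; rewrite -!val_eqE h3.
have hs : size p <= m.
  by have := max_card (mem (a :: p)); rewrite (card_uniqP up) card_ord; apply: ltnW.
have mono t (y : 'I_m) : nth false (L t) y -> nth false (L t.+1) y by rewrite LS => ->.
have walk t q : path (avoid z) a q -> size q <= t -> nth false (L t) (last a q).
  elim: t q => [|t IH] q; first by rewrite leqn0 size_eq0 => _ /eqP->; rewrite L0.
  case: (lastP q) => [|q' y] hq sq; first by apply/mono/(IH [::]).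
  move: hq sq; rewrite rcons_path size_rcons ltnS last_rcons => /andP[hq e] sq.
  rewrite LS; apply/orP; right; apply/hasP; exists (nat_of_ord (last a q')).
    by rewrite mem_iota ltn_ord.
  by rewrite tree_bit_enc IH //= ; case/and3P: e => -> h3 h4; rewrite h3 h4.
exact: walk.
Qed.

End Parse.

(** * From a separating vertex to a 3-colouring *)

Section Colour.
Variables (n m : nat) (G : sgraph 'I_n) (T : sgraph 'I_m) (r : 'I_m) (phi : 'I_n -> 'I_m).
Hypothesis lay : layout T r phi.

Lemma degree_le3 z : degree T z <= 3.
Proof.
have [[_ dr d3] _ _] := lay; have [->|zr] := eqVneq z r; first by rewrite dr.
by case: (boolP (z \in leaves T)) => [|zl]; [rewrite inE => /eqP->|rewrite d3].
Qed.

(** A walk from [x] to [z] is cut off before its first visit to [z]. *)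
Lemma enter (z x : 'I_m) : x != z -> exists2 y, T z y & connect (avoid T z) x y.
Proof.
have [[[con _] _ _] _ _] := lay.
move=> xz; have /connectP[q hq zE] := con x z.
elim: q x xz hq zE => [|a q IH] x xz /=; first by move=> _ e; rewrite e eqxx in xz.
case/andP => xa hq zE; have [az|az] := eqVneq a z.
  by exists x; rewrite ?connect0 // adj_sym -az.
have [y zy ay] := IH a az hq zE; exists y => //.
by apply: connect_trans ay; apply: connect1; rewrite /avoid xa xz.
Qed.

(* The branches at [z] are the colour classes; when [z] is itself a leaf there
   is only one branch, and [z] gets a second colour. *)
Lemma separated_colouring z (H : rel 'I_n) :
  (forall u v, H u v -> u != v) ->
  (forall u v, H u v -> ~~ connect (avoid T z) (phi u) (phi v)) ->
  exists col : 'I_n -> nat, (forall u, col u < 3) /\ forall u v, H u v -> col u != col v.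
Proof.
move=> Hne sep; have [_ phi_inj phiL] := lay.
have symA : connect_sym (avoid T z).
  by apply: sym_connect_sym => a b; rewrite /avoid adj_sym [(a != z) && _]andbC.
pose N := enum [set y | T z y].
pose br x := odflt x [pick y | T z y && connect (avoid T z) x y].
have brP x : x != z -> br x \in N /\ connect (avoid T z) x (br x).
  move=> xz; rewrite /br; case: pickP => [y /andP[h1 h2]|h]; first by rewrite mem_enum inE.
  by have [y h1 h2] := enter xz; have := h y; rewrite h1 h2.
have sN : size N = degree T z by rewrite -cardE.
pose col u := if phi u == z then 1 else index (br (phi u)) N.
have leaf_case u v : phi u = z -> phi v != z -> col v = 0.
  move=> uz vz; rewrite /col (negbTE vz); have [+ _] := brP _ vz.
  rewrite -index_mem sN.
  have : z \in leaves T by rewrite -phiL -uz imset_f.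
  by rewrite inE => /eqP->; case: (index _ _).
exists col; split=> [u|u v huv].
  rewrite /col; case: ifP => // /negbT uz; have [+ _] := brP _ uz.
  by rewrite -index_mem sN => h; apply: leq_trans h (degree_le3 z).
have uv := Hne _ _ huv.
have [uz|uz] := eqVneq (phi u) z.
  have vz : phi v != z by rewrite -uz (inj_eq phi_inj) eq_sym.
  by rewrite (leaf_case u v) // /col uz eqxx.
have [vz|vz] := eqVneq (phi v) z.
  by rewrite (leaf_case v u) // /col vz eqxx.
rewrite /col (negbTE uz) (negbTE vz); apply: contra (sep _ _ huv) => /eqP e.
have [u1 u2] := brP _ uz; have [v1 v2] := brP _ vz.
have eb : br (phi u) = br (phi v) by rewrite -(nth_index z u1) e nth_index.
by apply: connect_trans u2 _; rewrite eb symA.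
Qed.

End Colour.

(** * Correctness of the reduction and of the checker *)

Section Correctness.
Variables (M : TM bool) (p : {poly nat}) (x : seq bool).
Let n := order M p x.
Let h := nverts M p x.
Let H : rel 'I_n := fun u v => hard_edge M p x u v.

Lemma hard_edge_sym u v : hard_edge M p x u v = hard_edge M p x v u.
Proof. by rewrite /hard_edge eq_sym orbC; case: (u < _); case: (v < _). Qed.

Lemma instance_sym : symmetric (fun u v : 'I_n => (u != v) && ~~ H u v).
Proof. by move=> u v; rewrite eq_sym /H hard_edge_sym. Qed.
Lemma instance_irrefl : irreflexive (fun u v : 'I_n => (u != v) && ~~ H u v).
Proof. by move=> u; rewrite eqxx. Qed.
Definition instance : sgraph 'I_n := SGraph instance_sym instance_irrefl.

Lemma graph_word_enc : graph_word M p x = enc_graph instance.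
Proof.
rewrite /graph_word /enc_graph -/n.
rewrite (@enum_allpairs n (fun u v => (u != v) && ~~ hard_edge M p x u v)) //.
apply: (@eq_from_nth _ false).
  by rewrite size_cat size_enc_nat !size_mkseq.
rewrite size_mkseq => i hi; rewrite nth_mkseq // nth_cat size_enc_nat /graph_bit -/n.
rewrite nth_rcons size_nseq; case: ltngtP => ni.
- by rewrite ltnS ltnW // nth_nseq ni.
- by rewrite ltnNge ni /= nth_mkseq //; lia.
- by rewrite ni ltnSn.
Qed.

Let kP : exists k, [/\ n = 3 * 2 ^ k, 0 < k & h * h < 2 ^ k].
Proof. by have [k [k0 e hk]] := big_powerP h; exists k; split=> //; rewrite /n /order e. Qed.

Lemma order_ge : 3 <= n.
Proof.
have [k [e _ _]] := kP; have k0 : 0 < 2 ^ k by rewrite expn_gt0.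
by rewrite e leq_pmulr.
Qed.

Let h0 : 0 < h. Proof. by rewrite /h /nverts /nvert /base; lia. Qed.

Let hn : h <= n.
Proof.
have [k [e _ hk]] := kP; rewrite e; have hh : h <= h * h by rewrite leq_pmulr.
by apply: leq_trans hh (leq_trans (ltnW hk) (leq_pmull _ _)).
Qed.

Lemma vol_hard : vol H setT <= h * h.
Proof.
have cnt : \sum_(u < n) (u < h) <= h.
  rewrite -(big_mkord xpredT (fun u => nat_of_bool (u < h))) (big_cat_nat _ (n := h)) //=.
  have -> : \sum_(h <= u < n) (u < h) = 0.
    by rewrite big_nat big1 // => u /andP[hu _]; rewrite ltnNge hu.
  rewrite addn0.
  apply: (@leq_trans (\sum_(0 <= u < h) 1)); first by apply: leq_sum => u _; case: (u < h).
  by rewrite sum_nat_const_nat subn0 muln1.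
apply: (@leq_trans ((\sum_(u < n) (u < h)) * (\sum_(v < n) (v < h)))); last exact: leq_mul.
rewrite /vol big_mkcond big_distrl; apply: leq_sum => u _; rewrite inE big_distrr.
apply: leq_sum => v _ /=; rewrite /H /hard_edge -/h.
by case: (u < h) => //=; case: (v < h) => //=; case: (_ && _).
Qed.

Definition accepts := exists2 cs, size cs = clock p x & verdict (run M x cs) = Some true.

Let T0 : 0 < clock p x. Proof. by []. Qed.
Let colP := @colouring (nvars M (clock p x)) (nclauses M (clock p x)) (width M)
  (slot_var M (clock p x)) (slot_pol M) (clause_active M x (clock p x)).

Lemma accepts_colouring : accepts <-> exists col, colP col.
Proof.
rewrite /accepts -(tableauP M x T0); split=> [[asg]|[col]].
  move/(gadget_col_colouring (width_gt0 M) (@slot_var_lt M (clock p x) T0)) => hc.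
  by eexists; apply: hc.
by apply: colouring_satisfies; [exact: width_gt0|exact: slot_var_lt].
Qed.

Variables (m : nat) (T : sgraph 'I_m) (r : 'I_m) (phi : 'I_n -> 'I_m).
Hypothesis opt : optimal_layout instance T r phi.

Lemma checkP : reflect (exists z : 'I_m, forall u v, H u v -> ~~ connect (avoid T z) (phi u) (phi v))
  (check M p x (enc_layout T r phi)).
Proof.
apply: (iffP hasP) => [[z]|[z hz]].
  rewrite mem_iota tree_size_enc add0n => /andP[_ hzm] nz; exists (Ordinal hzm) => u v huv.
  have [uh vh] : u < h /\ v < h by case/and4P: huv.
  apply/negP => cn; move/negP: nz; apply; apply/hasP; exists (nat_of_ord u); first by rewrite mem_iota.
  apply/hasP; exists (nat_of_ord v); first by rewrite mem_iota.
  rewrite -[hard_edge _ _ _ _ _]/(H u v) huv /= !image_enc.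
  by rewrite (reach_enc T r phi (Ordinal hzm)).
exists (nat_of_ord z); first by rewrite mem_iota tree_size_enc add0n ltn_ord.
apply/negP => /hasP[u]; rewrite mem_iota add0n -/h => /andP[_ uh] /hasP[v].
rewrite mem_iota add0n -/h => /andP[_ vh] /andP[huv]; apply/negP.
have un := leq_trans uh hn; have vn := leq_trans vh hn.
rewrite (image_enc T r phi (Ordinal un)) (image_enc T r phi (Ordinal vn)) reach_enc.
exact: hz.
Qed.

(** A separating vertex gives a colouring in any layout; optimality enters in the converse, through
    [optimal_layout_separated]. *)
Theorem check_accepts : check M p x (enc_layout T r phi) <-> accepts.
Proof.
rewrite accepts_colouring; split=> [/checkP[z sep]|[col [c3 pr]]].
  have Hne u v : H u v -> u != v by case/and4P.
  have [col [c3 pr]] := separated_colouring (proj1 opt) Hne sep.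
  have n1 : n.-1.+1 = n by have := order_ge; lia.
  pose o i : 'I_n := cast_ord n1 (inord i).
  have oE i : i < h -> o i = i :> nat by move=> ih; rewrite /= inordK // n1; apply: leq_trans hn.
  exists (fun i => col (o i)); split=> [u _|u v uh vh uv e]; first exact: c3.
  by apply: pr; rewrite /H /hard_edge !oE // uh vh uv /= /adj_code e.
apply/checkP; have [k [nk k0 hk]] := kP.
have Hh u v : H u v -> u < h by case/and4P.
(* The vertices from [h] on only pad the instance and are isolated in [H], so the default colour 0
   is harmless. *)
apply: (@optimal_layout_separated n k h H instance (fun u => if u < h then col u else 0)
  _ T r phi nk k0) => //.
- by apply: leq_trans (ltnW hk); rewrite leq_pmulr.
- exact: leq_ltn_trans vol_hard hk.
- by move=> u; rewrite /H /hard_edge eqxx !andbF.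
- by move=> u v; apply: hard_edge_sym.
- by move=> u; case: ifP => // uh; apply: c3.
move=> u v huv; case/and4P: (huv) => uh vh uv; rewrite uh vh => /orP[e|e].
  exact: pr.
by rewrite eq_sym; apply: pr => //; rewrite eq_sym.
Qed.

End Correctness.

(** A deterministic machine becomes a nondeterministic one that ignores its choices. *)
Lemma class_P_NP (L : language) : class_P L -> class_NP L.
Proof.
move=> [M [p h]].
pose N := @MkTM bool (tm_state M) (tm_extra M) (tm_tapes M) (tm_start M) (tm_verdict (t := M))
  (fun _ => @tm_delta _ M tt).
have rN x (cs : seq bool) : run N x cs = run_for M (size cs) x.
  rewrite /run_for /run; elim/last_ind: cs => [|cs c IH] //.
  by rewrite size_rcons -addn1 nseqD !foldl_cat -cats1 foldl_cat /= -IH.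
exists N, p => x; have [v LE] := h x; split=> [cs|].
  by rewrite rN size_tuple.
rewrite LE; split=> [e|[cs]]; last by rewrite rN size_tuple.
by exists [tuple of nseq _ false]; rewrite rN size_nseq.
Qed.

(** All runs have halted after [p] steps, so the additional choice counted by [clock] changes no
    verdict. *)
Lemma accepts_NP (M : TM bool) (p : {poly nat}) x :
  (forall cs : ((p.[size x])%R).-tuple bool, verdict (run M x cs) <> None) ->
  accepts M p x <-> exists cs : ((p.[size x])%R).-tuple bool, verdict (run M x cs) = Some true.
Proof.
move=> hv.
have ext (cs : ((p.[size x])%R).-tuple bool) b : run M x (rcons cs b) = run M x cs.
  rewrite /run -cats1 foldl_cat /= -/(run M x cs) /step.
  by case: (verdict _) (hv cs).
split=> [[cs scs acc]|[cs acc]].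
  case/lastP: cs scs acc => [//|cs b]; rewrite size_rcons => -[scs] acc.
  have scs' : size cs == (p.[size x])%R by apply/eqP.
  by exists (Tuple scs'); rewrite -(ext (Tuple scs') b).
by exists (rcons cs false); rewrite ?size_rcons ?size_tuple // ext.
Qed.

Theorem theorem5 : ~ P_eq_NP -> ~ min_layout_poly_time_solvable.
Proof.
move=> PNP [S [pS solve]]; apply: PNP => L; split; first exact: class_P_NP.
move=> [M [p hL]].
have n2 x : 2 <= order M p x by apply: leq_trans (order_ge M p x).
apply: (@one_query_class_P S pS (graph_word M p) (check M p) L).
- exact: pf_graph_word.
- exact: pb_check.
- by move=> x; have := solve _ (instance M p x) (n2 x); rewrite -graph_word_enc => -[].
move=> x; have := solve _ (instance M p x) (n2 x).
rewrite -graph_word_enc => -[_ [m [T [r [phi [-> opt]]]]]].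
by rewrite check_accepts //; have [hv ->] := hL x; rewrite accepts_NP.
Qed.
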